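(* (Fractional $\varepsilon$-Poincaré inequality) Let $d\in\mathbb N$, $d\ge2$, $s\in(0,1]$, $\gamma>-d$ with $-d<\gamma+2s\le0$, and $$\frac{d}{d+2s+\gamma}<q<\frac{d}{d+\gamma}.$$ Then there exists $C_0>0$ depending only on $d,\gamma,s,q$ such that, for any $\varepsilon>0$ and any suitable functions $\phi$ and $g\ge0$ on $\mathbb R^d$, $$\int_{\mathbb R^d}\phi^2\,\boldsymbol c_\gamma[g]\,\mathrm dv\le\varepsilon\left\|\langle\cdot\rangle^{\frac\gamma2}\phi\right\|_{\dot{\mathbb H}^s}^2+C_0\left(\|g\|_{L^1}+\varepsilon^{-\frac{\nu}{s-\nu}}\left\|\langle\cdot\rangle^{|\gamma|}g\right\|_{L^q}^{\frac{s}{s-\nu}}\right)\int_{\mathbb R^d}\phi^2\langle v\rangle^\gamma\,\mathrm dv,$$ where $\nu\in(0,s)$ is given by $\nu=\frac{d-q(d+\gamma)}{2q}$.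
   Context: $\langle v\rangle=\sqrt{1+|v|^2}$. For $\gamma<0$, $\boldsymbol c_\gamma[g](v)=\int_{\mathbb R^d}|v-v_*|^\gamma g(v_* )\,\mathrm dv_*$. $\|g\|_{\dot{\mathbb H}^\alpha}=\left(\int_{\mathbb R^d}|\widehat g(\xi)|^2|\xi|^{2\alpha}\,\mathrm d\xi\right)^{1/2}$ with $\widehat g(\xi)=\int e^{-ix\cdot\xi}g(x)\,\mathrm dx$. ''Suitable'' means regular and decaying enough (e.g. measurable with finite right-hand side, $\langle\cdot\rangle^{\gamma/2}\phi\in L^2\cap\dot{\mathbb H}^s$) for all terms to make sense. *)

(* Defs.v *)
From HB Require Import structures.
From mathcomp Require Import all_boot all_order all_algebra.
From mathcomp Require Import all_classical all_reals all_analysis.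
From mathcomp Require Export complex.

Set Implicit Arguments.
Unset Strict Implicit.
Unset Printing Implicit Defensive.

Import Order.TTheory GRing.Theory Num.Theory.
Import numFieldNormedType.Exports.

Local Open Scope classical_set_scope.
Local Open Scope ring_scope.

(* R^d with its Borel sigma-algebra (the product of the Borel sigma-algebras
   of the factors). *)
Notation Rd R d := (d.-tuple (measurableTypeR R)).

(* The library's canonical sigma-finite structure on m1 \x m2 is shadowed by
   the one for subprobabilities. *)
Lemma sigma_finite_prod d1 d2 (T1 : measurableType d1) (T2 : measurableType d2)
    (R : realType) (m1 : {sigma_finite_measure set T1 -> \bar R})
    (m2 : {sigma_finite_measure set T2 -> \bar R}) :
  sigma_finite setT (m1 \x m2)%E.
Proof.
have /sigma_finiteP[F [TF ndF Foo]] := sigma_finiteT m1.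
have /sigma_finiteP[G [TG ndG Goo]] := sigma_finiteT m2.
exists (fun n => F n `*` G n).
  rewrite -setXTT TF TG predeqE => -[x y]; split.
    move=> [/= [n _ Fnx] [k _ Gky]]; exists (maxn n k) => //; split.
    - by move: x Fnx; exact/subsetPset/ndF/leq_maxl.
    - by move: y Gky; exact/subsetPset/ndG/leq_maxr.
  by move=> [n _ []/= ? ?]; split; exists n.
move=> k; have [? ?] := Foo k; have [? ?] := Goo k.
split; first exact: measurableX.
by rewrite product_measure1E// lte_mul_pinfty// ge0_fin_numE.
Qed.

Section lebesgue_measure_Rd.
Context {R : realType}.

Definition cons_Rd (d : nat) (p : measurableTypeR R * Rd R d) : Rd R d.+1 :=
  [the d.+1.-tuple (measurableTypeR R) of p.1 :: p.2].

Lemma measurable_cons_Rd d : measurable_fun setT (@cons_Rd d).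
Proof. exact: measurable_cons. Qed.

Section step.
Variables (d : nat) (mu : {sigma_finite_measure set (Rd R d) -> \bar R}).

Definition lebesgue_step : set (Rd R d.+1) -> \bar R :=
  pushforward (@lebesgue_measure R \x mu)%E (@cons_Rd d).

Let lebesgue_step0 : lebesgue_step set0 = 0%E.
Proof. by rewrite /lebesgue_step /pushforward preimage_set0 measure0. Qed.

Let lebesgue_step_ge0 A : (0 <= lebesgue_step A)%E.
Proof. by rewrite /lebesgue_step /pushforward. Qed.

Let lebesgue_step_sigma_additive : semi_sigma_additive lebesgue_step.
Proof.
move=> F mF tF mUF; rewrite /lebesgue_step /pushforward preimage_bigcup.
apply: measure_semi_sigma_additive.
- by move=> n; rewrite -[X in measurable X]setTI; exact: measurable_cons_Rd.
- apply/trivIsetP => /= i j _ _ ij; rewrite -preimage_setI.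
  by move/trivIsetP : tF => /(_ _ _ _ _ ij) ->//; rewrite preimage_set0.
- rewrite -preimage_bigcup -[X in measurable X]setTI.
  exact: measurable_cons_Rd.
Qed.

HB.instance Definition _ := isMeasure.Build _ _ _ lebesgue_step
  lebesgue_step0 lebesgue_step_ge0 lebesgue_step_sigma_additive.

Let uncons (x : Rd R d.+1) : measurableTypeR R * Rd R d :=
  (tnth x ord0, [tuple of behead x]).

Let measurable_uncons : measurable_fun setT uncons.
Proof.
apply/measurable_fun_pair => /=; first exact: measurable_tnth.
exact: measurable_behead.
Qed.

Let cons_RdK : cancel (@cons_Rd d) uncons.
Proof.
by move=> [x t]; rewrite /uncons/=; congr pair; apply/val_inj.
Qed.

Let lebesgue_step_sigma_finite : sigma_finite setT lebesgue_step.
Proof.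
have [F TF Foo] := sigma_finite_prod (@lebesgue_measure R) mu.
exists (fun k => uncons @^-1` F k).
  by rewrite -preimage_bigcup -TF preimage_setT.
move=> k; have [mF Fk] := Foo k; split.
  by rewrite -[X in measurable X]setTI; exact: measurable_uncons.
rewrite /lebesgue_step /pushforward -comp_preimage.
by rewrite (_ : uncons \o @cons_Rd d = id)//; apply/funext => x /=.
Qed.

HB.instance Definition _ := Measure_isSigmaFinite.Build _ _ _ lebesgue_step
  lebesgue_step_sigma_finite.

End step.

(* On R^(d+1), the image under (x, t) |-> x :: t of the product of the Lebesgue
   measures on R and R^d. *)
Fixpoint lebesgue_Rd (d : nat) : {sigma_finite_measure set (Rd R d) -> \bar R} :=
  match d with
  | 0 => [the {sigma_finite_measure set (Rd R 0) -> \bar R} of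
            \d_([tuple] : Rd R 0)]
  | d'.+1 => [the {sigma_finite_measure set (Rd R d'.+1) -> \bar R} of
               lebesgue_step (lebesgue_Rd d')]
  end.

End lebesgue_measure_Rd.

Section euclidean.
Context {R : realType} {d : nat}.
Implicit Types v w : Rd R d.

Definition dotRd v w : R := \sum_(i < d) tnth v i * tnth w i.

Definition normRd v : R := Num.sqrt (\sum_(i < d) tnth v i ^+ 2).

Definition subRd v w : Rd R d := [tuple tnth v i - tnth w i | i < d].

Definition japanese v : R := Num.sqrt (1 + normRd v ^+ 2).

Definition weighted (a : R) (f : Rd R d -> R) : Rd R d -> R :=
  fun v => japanese v `^ a * f v.

(* The value 0 taken by [0 `^ gamma] on the diagonal, for gamma < 0, is
   immaterial because {v} is a null set (when d > 0). *)
Definition c_gamma (gamma : R) (g : Rd R d -> R) (v : Rd R d) : \bar R :=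
  (\int[lebesgue_Rd d]_w (normRd (subRd v w) `^ gamma * g w)%:E)%E.

(* Integral of exp(- i x.xi) f(x), for a real-valued integrable f. *)
Definition fourierL1 (f : Rd R d -> R) (xi : Rd R d) : R[i] :=
  Complex (\int[lebesgue_Rd d]_x (cos (dotRd x xi) * f x))
          (- \int[lebesgue_Rd d]_x (sin (dotRd x xi) * f x)).

(* For f in L^2 that is not integrable, the integral above need not converge:
   the Fourier transform is then, as in Plancherel's theorem, the limit in L^2,
   as n tends to infinity, of the Fourier transforms of the truncations of f to
   the balls of radius n. It is a function defined up to a null set, whence a
   relation between f and its transforms h. *)
Definition is_fourierL2 (f : Rd R d -> R) (h : Rd R d -> R[i]) : Prop :=
  [/\ measurable_fun setT (fun xi => complex.Re (h xi) : R),
      measurable_fun setT (fun xi => complex.Im (h xi) : R) &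
      (fun n : nat =>
         \int[lebesgue_Rd d]_xi
           (Normc.normc (h xi -
              fourierL1 (f \* \1_[set x | normRd x <= n%:R]) xi) ^+ 2)%:E)%E
        @ \oo --> 0%E].

(* All the Fourier transforms h of f agree almost everywhere, so that the
   infimum ranges over a single value; for f in L^2 there is such an h by
   Plancherel's theorem. *)
Definition sobolev_norm (alpha : R) (f : Rd R d -> R) : \bar R :=
  ereal_inf [set ((\int[lebesgue_Rd d]_xi
      (Normc.normc (h xi) ^+ 2 * normRd xi `^ (2 * alpha))%:E) `^ 2^-1)%E
    | h in is_fourierL2 f].

End euclidean.

(* Main.v *)
(* Put psi = <v>^(gamma/2) phi and G = <v>^|gamma| g. Distinguishing whether |v - w|
   is larger than <v>/2, one gets |v - w|^gamma g(w) <=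
   2^|gamma| <v>^gamma (g(w) + |v - w|^gamma G(w)), so that it remains to bound
   W = int int psi(v)^2 |v - w|^gamma G(w). The power is dominated by a sum, over
   the dyadic scales t around a scale r, of t^gamma times the indicator of the cube
   |v_i - w_i| < t; let J(t) be the form W with that indicator as kernel. By
   Hoelder's inequality J(t) <= (2t)^(d/q') |G|_q |psi|_2^2, and the scales
   t >= r sum up to C |G|_q |psi|_2^2 r^(-2 nu). For t < r, averaging Young's
   inequality bounds t^d J(t/2) by (1 + eta) (t/2)^d J(t) up to (2t)^(d/q') |G|_q
   times the double integral of (psi(v) - psi(v'))^2 over cubes of size t. As
   2^(-gamma-d) < 1, eta small makes the recursion on t^gamma J(t) contracting, and
   the scales t < r contribute at most
   C |G|_q (|psi|_2^2 r^(-2 nu) + r^(2 (s - nu)) |psi|_(H^s)^2),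
   once that double integral is at most C t^(d + 2 s) |psi|_(H^s)^2. For this,
   the indicator of the cube is dominated by a product of kernels
   4 t^3 / (t^2 + z^2)^2, whose Fourier transforms are explicit. Finally r is chosen
   so that the coefficient of |psi|_(H^s)^2 is epsilon. *)

Require Import Defs.
From mathcomp Require Import all_boot all_order all_algebra.
From mathcomp Require Import all_classical all_reals all_analysis measurable_realfun.
From mathcomp Require Import ring lra.

Set Implicit Arguments.
Unset Strict Implicit.
Unset Printing Implicit Defensive.

Import Order.TTheory GRing.Theory Num.Theory.
Import numFieldNormedType.Exports.

Local Open Scope classical_set_scope.
Local Open Scope ring_scope.

(** The exponents explain the hypotheses. Since [gamma + d / q' = - 2 nu], the two bounds on [q] say
    exactly that [0 < nu < s]: Hoelder's bound on [t^gamma J(t)], of order [t^(- 2 nu)], is summable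
    at large scales only, while the error of the recursion, of order [t^(2 (s - nu))], is summable
    at small scales. The contraction [2^(-gamma-d) < 1] is the hypothesis [gamma > -d]. No Sobolev
    embedding enters: [psi] is measured only in [L^2] and through its energies. The transform of an
    [L^2] function is known only as a limit of transforms of truncations. The bound of an energy by
    the transform is therefore first proved for integrable functions, in real form with sines and
    cosines; the passage to the limit uses [(a + b)^2 <= 2 a^2 + 2 b^2] and costs a constant factor.
    Cubes and product kernels are preferred to balls and radial kernels because volumes, masses,
    transforms and vanishing of energies then follow by induction on [d] from explicit integrals on
    the line. *)

(** * Integration coordinate by coordinate and on half-lines *)

Lemma integral_cons_Rd {R : realType} (d : nat) (f : Rd R d.+1 -> \bar R) :
  measurable_fun [set: Rd R d.+1] f -> (forall x, 0 <= f x)%E ->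
  (\int[lebesgue_Rd d.+1]_x f x =
   \int[@lebesgue_measure R]_x \int[lebesgue_Rd d]_t f (cons_Rd (x, t)))%E.
Proof.
move=> mf f0.
transitivity (\int[(@lebesgue_measure R \x lebesgue_Rd d)]_z f (cons_Rd z))%E.
  have := @ge0_integral_pushforward _ _ _ _ R _ (@measurable_cons_Rd R d)
    (@lebesgue_measure R \x lebesgue_Rd d)%E _ _ measurableT mf.
  by rewrite preimage_setT; apply => x _; exact: f0.
rewrite (fubini_tonelli1 (f \o @cons_Rd R d))//; last by move=> x; exact: f0.
by apply: measurableT_comp => //; exact: measurable_cons_Rd.
Qed.

(** Folds the line onto one half-line, where [FTC_half_line] applies. *)
Lemma integral_half_lines {R : realType} (f : R -> R) : continuous f ->
  (forall x, 0 <= f x) ->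
  (\int[@lebesgue_measure R]_x (f x)%:E =
   \int[@lebesgue_measure R]_(x in `[0%R, +oo[) (f x)%:E +
   \int[@lebesgue_measure R]_(x in `[0%R, +oo[) (f (- x))%:E)%E.
Proof.
move=> cf f0.
have mf : measurable_fun [set: R] f by exact: continuous_measurable_fun.
rewrite -(setUv `[0%R, +oo[%classic) ge0_integral_setU//=; last 4 first.
- exact: measurableC.
- by apply/measurable_EFinP; rewrite setUv.
- by move=> x _; rewrite lee_fin.
- exact/disj_setPCl.
congr +%E; rewrite setCitvr integral_itv_bndo_bndc; last first.
  exact/measurable_EFinP/measurable_funTS.
rewrite -{1}oppr0 ge0_integration_by_substitutionNy//.
exact: continuous_subspaceT.
Qed.

Lemma FTC_half_line {R : realType} (f F : R -> R) (a l : R) :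
  (forall x, a <= x -> 0 <= f x) -> continuous f ->
  (forall x : R, is_derive x (1 : R) F (f x)) -> F x @[x --> +oo] --> l ->
  (\int[@lebesgue_measure R]_(x in `[a, +oo[) (f x)%:E = (l - F a)%:E)%E.
Proof.
move=> f0 cf dF Fl; rewrite EFinB; apply: ge0_continuous_FTC2y => //.
- exact: continuous_subspaceT.
- apply: cvg_at_right_filter; apply: differentiable_continuous.
  by apply/derivable1_diffP; have [] := dF a.
- by move=> x _; rewrite derive1E; apply: derive_val.
Qed.

(** * The kernels on the line *)

(* A Fourier pair. Unlike [expR (- t * `|x|)], the transform of the Poisson
   kernel, [cauchy2_hat] has no corner at the origin: [1 - cauchy2_hat t x] is
   [O(x ^+ 2)], which is what exponents [s] up to 1 require. *)
Definition cauchy2_hat {R : realType} (t x : R) : R :=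
  (1 + t * `|x|) * expR (- (t * `|x|)).

Definition cauchy2 {R : realType} (t z : R) : R :=
  4 * t ^+ 3 / (t ^+ 2 + z ^+ 2) ^+ 2.

Section cauchy2_transform.
Context {R : realType}.
Implicit Types t x z : R.

Lemma cauchy2_hat_ge0 t x : 0 <= t -> 0 <= cauchy2_hat t x.
Proof. by move=> t0; rewrite mulr_ge0 ?expR_ge0// addr_ge0// mulr_ge0. Qed.

Lemma cauchy2_hat_le1 t x : 0 <= t -> cauchy2_hat t x <= 1.
Proof.
move=> t0; rewrite /cauchy2_hat expRN ler_pdivrMr ?expR_gt0// mul1r.
exact: expR_ge1Dx.
Qed.

Lemma cauchy2_ge0 t z : 0 <= t -> 0 <= cauchy2 t z.
Proof. by move=> t0; rewrite divr_ge0 ?sqr_ge0// mulr_ge0// exprn_ge0. Qed.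

Lemma cauchy2N t z : cauchy2 t (- z) = cauchy2 t z.
Proof. by rewrite /cauchy2 sqrrN. Qed.

Lemma continuous_cauchy2_hat t : continuous (cauchy2_hat t).
Proof.
have cm : continuous (fun y : R => t * `|y|).
  by move=> y; apply: cvgM; [exact: cvg_cst|exact: norm_continuous].
move=> x; rewrite /cauchy2_hat; apply: cvgM.
  by apply: cvgD; [exact: cvg_cst|exact: cm].
apply: (@continuous_comp _ _ _ (fun y => - (t * `|y|)) expR).
  by apply: cvgN; exact: cm.
exact: continuous_expR.
Qed.

Lemma continuous_cauchy2 t : 0 < t -> continuous (cauchy2 t).
Proof.
move=> t0 x; rewrite /cauchy2; apply: cvgM; first exact: cvg_cst.
apply: cvgV.
  by rewrite expf_neq0// gt_eqF// ltr_pwDl ?sqr_ge0// exprn_gt0.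
have cD : continuous (fun y : R => t ^+ 2 + y ^+ 2).
  by move=> y; apply: cvgD; [exact: cvg_cst|exact: exprn_continuous].
exact: (continuous_comp (cD x) (@exprn_continuous R 2 _)).
Qed.

(** On [x >= 0] the absolute value disappears. The first term is a primitive of
    [(1 + t x) exp(- t x)]; the rest is the real part of the primitive of
    [(1 + t x) exp((i z - t) x)] found by integrating by parts once. *)
Let primitive t z x : R := - (2 / t + x) * expR (- (t * x)) +
  ((1 + t * x) * (z * sin (z * x) - t * cos (z * x)) / (t ^+ 2 + z ^+ 2)
   - t * ((t ^+ 2 - z ^+ 2) * cos (z * x) - 2 * t * z * sin (z * x))
     / (t ^+ 2 + z ^+ 2) ^+ 2) * expR (- (t * x)).

Let is_derive_primitive t z x : 0 < t -> is_derive x 1 (primitive t z)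
  ((1 + t * x) * expR (- (t * x)) * (1 + cos (z * x))).
Proof.
move=> t0; have D0 : t ^+ 2 + z ^+ 2 != 0.
  by rewrite gt_eqF// ltr_pwDl ?sqr_ge0// exprn_gt0.
have dlin (k y : R) : is_derive y 1 (fun x => k * x) k.
  by apply: is_derive_eq; rewrite /GRing.scale/= mulr1.
have dc : is_derive x 1 (fun x => cos (z * x)) (- sin (z * x) * z).
  exact: (@is_derive1_comp _ cos ( *%R z)).
have ds : is_derive x 1 (fun x => sin (z * x)) (cos (z * x) * z).
  exact: (@is_derive1_comp _ sin ( *%R z)).
have de : is_derive x 1 (fun x => expR (- (t * x))) (expR (- (t * x)) * - t).
  apply: (@is_derive1_comp _ expR (fun x => - (t * x))).
rewrite /primitive; apply: is_derive_eq.
rewrite /GRing.scale/=; field.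
by rewrite D0 gt_eqF.
Qed.

Let cauchy2_hat_cvg t : 0 < t -> (1 + t * x) * expR (- (t * x)) @[x --> +oo] --> 0.
Proof.
move=> t0; apply: (@squeeze_cvgr _ _ _ _ (cst 0) (fun x => 2 * expR (- (t / 2 * x)))).
- near=> x; have x0 : 0 <= x by [].
  have tx0 : 0 <= t * x by rewrite mulr_ge0// ltW.
  rewrite /= mulr_ge0 ?expR_ge0 ?addr_ge0//=.
  (* Half of the exponential absorbs the affine factor, by [1 + u <= exp u] at [u = t x / 2]. *)
  have -> : - (t * x) = - (t / 2 * x) - (t / 2 * x) by field.
  rewrite expRD mulrA ler_wpM2r ?expR_ge0//.
  rewrite expRN ler_pdivrMr ?expR_gt0//.
  have h1 : 1 + t / 2 * x <= expR (t / 2 * x) by exact: expR_ge1Dx.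
  by lra.
- exact: cvg_cst.
- rewrite -[X in _ --> X](mulr0 2); apply: cvgM; first exact: cvg_cst.
  apply: (@cvg_comp _ _ _ (fun x : R => t / 2 * x) (fun y => expR (- y)) _ +oo); last exact: cvgr_expR.
  under eq_fun do rewrite mulrC.
  have t20 : 0 < t / 2 by rewrite divr_gt0.
  exact: (gt0_cvgMly t20 cvg_id).
Unshelve. all: by end_near. Qed.

Let primitive_cvg t z : 0 < t -> primitive t z x @[x --> +oo] --> 0.
Proof.
move=> t0; pose D := t ^+ 2 + z ^+ 2.
have D0 : 0 < D by rewrite ltr_pwDl ?sqr_ge0// exprn_gt0.
(* With [U = 1 + t x] and [E = exp(- t x)], every term of the primitive is at most a constant times
   [U * E], whose limit is [cauchy2_hat_cvg]. *)
have aux (U k E p q P Q a : R) : 1 <= U -> 0 <= E -> `|k| <= a * U ->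
    `|p| <= P -> `|q| <= Q ->
    `|k * E + (U * p - q) * E| <= (a + P + Q) * (U * E).
  move=> U1 E0 kaU pP qQ; have U0 : 0 <= U by apply: le_trans U1.
  rewrite -mulrDl normrM (ger0_norm E0) mulrA ler_wpM2r//.
  have Q0 : 0 <= Q by apply: le_trans qQ.
  rewrite !mulrDl -addrA (le_trans (ler_normD _ _))// lerD//.
  rewrite (le_trans (ler_normB _ _))// lerD//.
    by rewrite normrM (ger0_norm U0) mulrC ler_wpM2r.
  by rewrite (le_trans qQ)// ler_peMr.
pose P := (`|z| + t) / D.
pose Q := t * (`|t ^+ 2 - z ^+ 2| + `|2 * t * z|) / D ^+ 2.
apply/norm_cvg0P; apply: (@squeeze_cvgr _ _ _ _ (cst 0)
    (fun x => (2 / t + P + Q) * ((1 + t * x) * expR (- (t * x))))); last 2 first.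
- exact: cvg_cst.
- rewrite -[X in _ --> X](mulr0 (2 / t + P + Q)); apply: cvgM; first exact: cvg_cst.
  exact: cauchy2_hat_cvg.
near=> x; have x0 : 0 <= x by [].
have tx0 : 0 <= t * x by rewrite mulr_ge0// ltW.
rewrite normr_ge0/= /primitive -/D.
have cz : `|cos (z * x)| <= 1 by rewrite ler_norml cos_geN1 cos_le1.
have sz : `|sin (z * x)| <= 1 by rewrite ler_norml sin_geN1 sin_le1.
rewrite -[in X in _ + X](mulrA (1 + t * x)); apply: aux.
- by rewrite lerDl.
- exact: expR_ge0.
- rewrite normrN ger0_norm ?addr_ge0 ?divr_ge0 ?(ltW t0)//.
  have -> : 2 / t * (1 + t * x) = 2 / t + (x + x) by field; rewrite gt_eqF.
  by rewrite lerD2l lerDl.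
- rewrite normrM normfV (gtr0_norm D0) ler_wpM2r ?invr_ge0 ?(ltW D0)//.
  rewrite (le_trans (ler_normB _ _))// !normrM (gtr0_norm t0).
  by apply: lerD; rewrite ler_piMr // ltW.
- rewrite normrM normfV normrX (gtr0_norm D0) ler_wpM2r ?invr_ge0 ?sqr_ge0//.
  rewrite normrM (gtr0_norm t0) ler_wpM2l ?(ltW t0)//.
  rewrite (le_trans (ler_normB _ _))// normrM (normrM _ (sin _)).
  by apply: lerD; rewrite ler_piMr.
Unshelve. all: by end_near. Qed.

(* The factor [1 + cos] instead of [cos] keeps the integrand nonnegative, as the
   fundamental theorem of calculus on an unbounded interval requires. *)
Lemma integral_cauchy2_hat_half t z : 0 < t ->
  (\int[@lebesgue_measure R]_(x in `[0%R, +oo[)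
     (cauchy2_hat t x * (1 + cos (z * x)))%:E = (2 / t + cauchy2 t z / 2)%:E)%E.
Proof.
move=> t0; transitivity (\int[@lebesgue_measure R]_(x in `[0%R, +oo[)
     ((1 + t * x) * expR (- (t * x)) * (1 + cos (z * x)))%:E)%E.
  apply: eq_integral => x; rewrite inE/= in_itv/= andbT => x0.
  by rewrite /cauchy2_hat ger0_norm.
have dP x : is_derive x 1 (primitive t z)
  ((1 + t * x) * expR (- (t * x)) * (1 + cos (z * x))).
  exact: is_derive_primitive.
rewrite (FTC_half_line _ _ dP (primitive_cvg z t0)).
- rewrite /primitive !mulr0 sin0 cos0 oppr0 expR0 /cauchy2; congr EFin.
  by field; rewrite !gt_eqF// ltr_pwDl ?sqr_ge0// exprn_gt0.
- move=> x x0; rewrite mulr_ge0//.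
  by rewrite mulr_ge0 ?expR_ge0// addr_ge0// mulr_ge0// ltW.
- have dlin (k : R) : continuous ( *%R k).
    by move=> x; apply: cvgM; [exact: cvg_cst|exact: cvg_id].
  move=> x; apply: cvgM.
    apply: cvgM; first by apply: cvgD; [exact: cvg_cst|exact: dlin].
    apply: (@continuous_comp _ _ _ (fun y => - (t * y)) expR).
      by apply: cvgN; exact: dlin.
    exact: continuous_expR.
  apply: cvgD; first exact: cvg_cst.
  apply: (@continuous_comp _ _ _ (fun y => z * y) cos); first exact: dlin.
  exact: continuous_cos.
Qed.

Lemma measurable_cauchy2_hat t : measurable_fun [set: R] (cauchy2_hat t).
Proof. by apply: continuous_measurable_fun; exact: continuous_cauchy2_hat. Qed.

Lemma measurable_cauchy2 t : 0 < t -> measurable_fun [set: R] (cauchy2 t).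
Proof. by move=> t0; apply: continuous_measurable_fun; exact: continuous_cauchy2. Qed.

Let ge0_1cos z x : 0 <= 1 + cos (z * x).
Proof. by have := cos_geN1 (z * x); lra. Qed.

Let cM z : continuous ( *%R z : R -> R).
Proof. by move=> x; apply: cvgM; [exact: cvg_cst|exact: cvg_id]. Qed.

Lemma integral_cauchy2_hat_1cos t z : 0 < t ->
  (\int[@lebesgue_measure R]_x (cauchy2_hat t x * (1 + cos (z * x)))%:E =
   (4 / t + cauchy2 t z)%:E)%E.
Proof.
move=> t0; rewrite integral_half_lines.
- under [X in (_ + X)%E]eq_integral do rewrite /cauchy2_hat mulrN cosN normrN.
  rewrite -/(cauchy2_hat t) integral_cauchy2_hat_half// -EFinD; congr EFin.
  by field; rewrite gt_eqF.
- move=> x; apply: cvgM; first exact: continuous_cauchy2_hat.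
  apply: cvgD; first exact: cvg_cst.
  apply: (@continuous_comp _ _ _ (fun y => z * y) cos); first exact: cM.
  exact: continuous_cos.
- by move=> x; rewrite mulr_ge0// cauchy2_hat_ge0// ltW.
Qed.

Lemma integral_cauchy2_hat t : 0 < t ->
  (\int[@lebesgue_measure R]_x (cauchy2_hat t x)%:E = (4 / t)%:E)%E.
Proof.
move=> t0; have := @integral_cauchy2_hat_1cos t 0 t0.
have mb := measurable_cauchy2_hat t.
under eq_integral => x _ do rewrite mul0r cos0 mulrC EFinM.
rewrite ge0_integralZl//; last 2 first.
- exact/measurable_EFinP.
- by move=> x _; rewrite lee_fin cauchy2_hat_ge0// ltW.
rewrite /cauchy2 expr0n addr0 => /(congr1 (fun x : \bar R => (2^-1)%:E * x)%E).
rewrite muleA -EFinM mulVf// mul1e => ->; rewrite -EFinM; congr EFin.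
by field; rewrite gt_eqF.
Qed.

Lemma integrable_cauchy2_hat t : 0 < t ->
  (@lebesgue_measure R).-integrable setT (EFin \o cauchy2_hat t).
Proof.
move=> t0; apply/integrableP; split.
  by apply/measurable_EFinP; exact: measurable_cauchy2_hat.
under eq_integral => x _ do rewrite /= ger0_norm ?cauchy2_hat_ge0 ?(ltW t0)//.
by rewrite integral_cauchy2_hat// ltry.
Qed.

Let integrable_cauchy2_hatM t (f : R -> R) : 0 < t -> measurable_fun setT f ->
  (forall x, `|f x| <= 2) ->
  (@lebesgue_measure R).-integrable setT (EFin \o (fun x => cauchy2_hat t x * f x)).
Proof.
move=> t0 mf f2.
have i2 := integrableZl measurableT 2 (integrable_cauchy2_hat t0).
apply: le_integrable i2 => //.
  apply/measurable_EFinP/measurable_funM => //.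
  exact: measurable_cauchy2_hat.
move=> x _ /=; rewrite lee_fin [X in _ <= X]normrM (normrM (cauchy2_hat t x)).
by rewrite mulrC ler_wpM2r// [X in _ <= X]ger0_norm.
Qed.

Let mcos z : measurable_fun [set: R] (fun x => cos (z * x)).
Proof.
apply: continuous_measurable_fun => x.
apply: (@continuous_comp _ _ _ (fun y => z * y) cos); first exact: cM.
exact: continuous_cos.
Qed.

Let csin z : continuous (fun x : R => sin (z * x)).
Proof.
move=> x; apply: (@continuous_comp _ _ _ (fun y => z * y) sin); first exact: cM.
exact: continuous_sin.
Qed.

Lemma Rintegral_cauchy2_hat_cos t z : 0 < t ->
  \int[@lebesgue_measure R]_x (cauchy2_hat t x * cos (z * x)) = cauchy2 t z.
Proof.
move=> t0; transitivity (\int[@lebesgue_measure R]_x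
    (cauchy2_hat t x * (1 + cos (z * x)) - cauchy2_hat t x)).
  by apply: eq_Rintegral => x _; ring.
rewrite RintegralB//; last 2 first.
- apply: integrable_cauchy2_hatM => //.
    exact: measurable_funD.
  by move=> x; rewrite ger0_norm//; have := cos_le1 (z * x); lra.
- exact: integrable_cauchy2_hat.
by rewrite /Rintegral integral_cauchy2_hat_1cos// integral_cauchy2_hat//= addrAC subrr add0r.
Qed.

Lemma Rintegral_cauchy2_hat_sin t z : 0 < t ->
  \int[@lebesgue_measure R]_x (cauchy2_hat t x * sin (z * x)) = 0.
Proof.
move=> t0; transitivity (\int[@lebesgue_measure R]_x
    (cauchy2_hat t x * (1 + sin (z * x)) - cauchy2_hat t x)).
  by apply: eq_Rintegral => x _; ring.
have s0 x : 0 <= 1 + sin (z * x) by have := sin_geN1 (z * x); lra.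
have s0' x : 0 <= 1 - sin (z * x) by have := sin_le1 (z * x); lra.
have ms : measurable_fun [set: R] (fun x => sin (z * x)).
  exact: continuous_measurable_fun.
rewrite RintegralB//; last 2 first.
- apply: integrable_cauchy2_hatM => //; first exact: measurable_funD.
  by move=> x; rewrite ger0_norm//; have := sin_le1 (z * x); lra.
- exact: integrable_cauchy2_hat.
have mb := measurable_cauchy2_hat t.
rewrite /Rintegral integral_half_lines; last 2 first.
- move=> x; apply: cvgM; first exact: continuous_cauchy2_hat.
  by apply: cvgD; [exact: cvg_cst|exact: csin].
- by move=> x; rewrite mulr_ge0// cauchy2_hat_ge0// ltW.
rewrite -ge0_integralD//; last 4 first.
- by move=> x _; rewrite lee_fin mulr_ge0// cauchy2_hat_ge0// ltW.
- apply/measurable_EFinP/measurable_funTS/measurable_funM => //.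
  exact: measurable_funD.
- by move=> x _; rewrite lee_fin mulr_ge0// cauchy2_hat_ge0// ltW.
- apply/measurable_EFinP/measurable_funTS => /=.
  under eq_fun do rewrite mulrN sinN /cauchy2_hat normrN -/(cauchy2_hat _ _).
  apply/measurable_funM => //.
  exact: measurable_funB.
(* The sines at [x] and [- x] cancel, and what remains is the cosine formula at frequency 0. *)
have -> : (\int[@lebesgue_measure R]_(x in `[0%R, +oo[)
     ((cauchy2_hat t x * (1 + sin (z * x)))%:E +
      (cauchy2_hat t (- x) * (1 + sin (z * - x)))%:E))%E = (4 / t)%:E.
  transitivity (\int[@lebesgue_measure R]_(x in `[0%R, +oo[)
      (cauchy2_hat t x * (1 + cos (0 * x)))%:E)%E.
    apply: eq_integral => x _; rewrite mulrN sinN /cauchy2_hat normrN mul0r cos0.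
    by rewrite -EFinD; congr EFin; ring.
  rewrite integral_cauchy2_hat_half// /cauchy2 expr0n addr0; congr EFin.
  by field; rewrite gt_eqF.
by rewrite integral_cauchy2_hat// subrr.
Qed.

(** The translation and the dilation are put into the primitive, [F ((y - a) / t)]. As [F] is odd,
    the boundary terms of the two half-lines at 0 cancel and each half contributes [l]. *)
Lemma integral_scaled_even (f F : R -> R) (l t x : R) : 0 < t ->
  (forall y, 0 <= f y) -> continuous f -> (forall y, f (- y) = f y) ->
  (forall y : R, is_derive y (1 : R) F (f y)) -> (forall y, F (- y) = - F y) ->
  F y @[y --> +oo] --> l ->
  (\int[@lebesgue_measure R]_y (f ((x - y) / t) / t)%:E = (2 * l)%:E)%E.
Proof.
move=> t0 f0 cf fN dF FN Fl.
have cs a : continuous (fun y : R => (y - a) / t).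
  move=> y; apply: cvgM; last exact: cvg_cst.
  by apply: cvgB; [exact: cvg_id|exact: cvg_cst].
have cfs a : continuous (fun y : R => f ((y - a) / t) / t).
  move=> y; apply: cvgM; last exact: cvg_cst.
  by apply: (@continuous_comp _ _ _ (fun y => (y - a) / t) f); [exact: cs|exact: cf].
have dFs a (y : R) : is_derive y 1 (fun y => F ((y - a) / t)) (f ((y - a) / t) / t).
  apply: (@is_derive1_comp _ F (fun y => (y - a) / t)).
  by apply: is_derive_eq; rewrite scaler0 add0r subr0 /GRing.scale/= mulr1.
have Fls a : F ((y - a) / t) @[y --> +oo] --> l.
  apply: (@cvg_comp _ _ _ (fun y : R => (y - a) / t) F _ +oo) => //.
  apply: gt0_cvgMly; first by rewrite invr_gt0.
  exact: cvg_addrr.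
have half a : (\int[@lebesgue_measure R]_(y in `[0%R, +oo[)
    (f ((y - a) / t) / t)%:E = (l + F (a / t))%:E)%E.
  rewrite (FTC_half_line _ _ (dFs a) (Fls a)) ?sub0r ?mulNr ?FN ?opprK//.
  by move=> y _; rewrite divr_ge0// ltW.
under eq_integral => y _ do rewrite -fN -mulNr opprB.
rewrite integral_half_lines//; last first.
  by move=> y; rewrite divr_ge0// ltW.
rewrite half (_ : (\int[_]_(_ in _) _)%E = (l + F (- x / t))%:E).
  by rewrite mulNr FN -EFinD; congr EFin; ring.
rewrite -half; apply: eq_integral => y _.
by rewrite -opprD mulNr fN opprK.
Qed.

(** The unnormalized Poisson kernel: two copies of it dominate [cauchy2_kernel] across a point in
    [energy_ray_le]. *)
Lemma integral_cauchy t x : 0 < t ->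
  (\int[@lebesgue_measure R]_y (t / (t ^+ 2 + (x - y) ^+ 2))%:E = pi%:E)%E.
Proof.
move=> t0; have tn0 : t != 0 by rewrite gt_eqF.
have n0 y : 1 + y ^+ 2 != 0 :> R by rewrite gt_eqF// ltr_pwDl ?sqr_ge0.
rewrite -[in RHS](@mulfVK _ 2 _ pi)// [in RHS]mulrC.
rewrite -(@integral_scaled_even (fun y => (1 + y ^+ 2)^-1) atan (pi / 2) t x)//.
- apply: eq_integral => y _; congr EFin.
  have D0 : t ^+ 2 + (x - y) ^+ 2 != 0.
    by rewrite gt_eqF// ltr_pwDl ?sqr_ge0// exprn_gt0.
  by field; rewrite ?tn0 ?D0.
- by move=> y; rewrite invr_ge0 addr_ge0// sqr_ge0.
- move=> y; apply: cvgV => //.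
  by apply: cvgD; [exact: cvg_cst|exact: exprn_continuous].
- by move=> y; rewrite sqrrN.
- by move=> y; rewrite atanN.
- exact: cvgy_atan.
Qed.

Lemma integral_cauchy2 t x : 0 < t ->
  (\int[@lebesgue_measure R]_y (cauchy2 t (x - y))%:E = (2 * pi)%:E)%E.
Proof.
move=> t0; have tn0 : t != 0 by rewrite gt_eqF.
have n0 y : 1 + y ^+ 2 != 0 :> R by rewrite gt_eqF// ltr_pwDl ?sqr_ge0.
have cS : continuous (fun y : R => 1 + y ^+ 2).
  by move=> y; apply: cvgD; [exact: cvg_cst|exact: exprn_continuous].
have dB (y : R) : is_derive y (1 : R) (fun y => 2 * (atan y + y / (1 + y ^+ 2)))
    (4 / (1 + y ^+ 2) ^+ 2).
  have dV : is_derive y (1 : R) (fun y => (1 + y ^+ 2)^-1) (- (2 * y) / (1 + y ^+ 2) ^+ 2).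
    have dS : is_derive y (1 : R) (fun y => 1 + y ^+ 2) (2 * y).
      rewrite (_ : (fun y => _) = (fun y => 1 + y * y)); last first.
        by apply/funext => z; rewrite expr2.
      by apply: is_derive_eq; rewrite add0r /GRing.scale/=; ring.
    by have := @is_deriveV _ (fun y => 1 + y ^+ 2) _ _ _ (n0 y) dS; rewrite /GRing.scale/= mulNr mulrC -mulNr.
  apply: is_derive_eq; rewrite /GRing.scale/=.
  by field; rewrite n0.
rewrite -(integral_scaled_even (l := pi) x t0 _ _ _ dB).
- apply: eq_integral => y _; congr EFin; rewrite /cauchy2.
  have D0 : t ^+ 2 + (x - y) ^+ 2 != 0.
    by rewrite gt_eqF// ltr_pwDl ?sqr_ge0// exprn_gt0.
  by field; rewrite ?tn0 ?D0.
- by move=> y; rewrite divr_ge0// sqr_ge0.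
- move=> y; apply: cvgM; first exact: cvg_cst.
  apply: cvgV; first by rewrite expf_neq0.
  exact: (continuous_comp (cS y) (@exprn_continuous R 2 _)).
- by move=> y; rewrite sqrrN.
- by move=> y; rewrite atanN sqrrN; ring.
- rewrite -[X in _ --> X](_ : 2 * (pi / 2 + 0) = _); last by field.
  apply: cvgM; first exact: cvg_cst.
  apply: cvgD; first exact: cvgy_atan.
  apply: (@squeeze_cvgr _ _ _ _ (cst 0) (fun y => y^-1)).
  + near=> y; have y0 : 0 < y by [].
    rewrite /= divr_ge0 ?(ltW y0) ?addr_ge0 ?sqr_ge0//= ler_pdivrMr ?ltr_pwDl ?sqr_ge0//.
    by rewrite mulrDr mulr1 expr2 mulrA mulVf ?gt_eqF// mul1r lerDr invr_ge0 ltW.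
  + exact: cvg_cst.
  + apply/gtr0_cvgV0; last exact: cvg_id.
    by near=> y.
Unshelve. all: by end_near. Qed.
End cauchy2_transform.

(** * Measurability, monotonicity and Tonelli's theorem for curried integrands *)

Lemma measurable_fun_uncurried {d d1 d2 d3 : measure_display} {T : measurableType d}
    {T1 : measurableType d1} {T2 : measurableType d2} {T3 : measurableType d3}
    (F : T1 -> T2 -> T3) (f : T -> T1) (g : T -> T2) :
  measurable_fun [set: T1 * T2] (fun p => F p.1 p.2) ->
  measurable_fun setT f -> measurable_fun setT g ->
  measurable_fun setT (fun x => F (f x) (g x)).
Proof.
move=> mF mf mg.
exact: (@measurableT_comp _ _ _ _ _ _ (fun p => F p.1 p.2) _ (fun x => (f x, g x)) mF
  (measurable_fun_pair mf mg)).
Qed.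

Lemma measurable_section {d1 d2 d3 : measure_display} {T1 : measurableType d1}
    {T2 : measurableType d2} {T3 : measurableType d3} (F : T1 -> T2 -> T3) (x : T1) :
  measurable_fun [set: T1 * T2] (fun p => F p.1 p.2) -> measurable_fun setT (F x).
Proof. by move=> mF; exact: (@measurable_fun_pair2 _ _ _ _ _ _ (fun p => F p.1 p.2)). Qed.

(** Joint measurability is looked up among the hypotheses in the form [fun p => F p.1 p.2]; this is
    why proofs first name the instances they need, such as the kernel at a given scale. *)
Ltac measurability := repeat
  match goal with
  | |- measurable_fun _ _ => assumption
  | |- measurable_fun _ (fun x => x) => exact: measurable_id
  | |- measurable_fun _ fst => exact: measurable_fst
  | |- measurable_fun _ snd => exact: measurable_snd
  | |- measurable_fun _ (fun x => fst _) => apply: (measurableT_comp measurable_fst)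
  | |- measurable_fun _ (fun x => snd _) => apply: (measurableT_comp measurable_snd)
  | |- measurable_fun _ (fun x => ?c) => exact: measurable_cst
  | |- measurable_fun _ (fun x => EFin _) => apply/measurable_EFinP
  | |- measurable_fun _ (fun x => GRing.exp _ _) => apply: measurable_funX
  | |- measurable_fun _ (fun x => GRing.add _ (GRing.opp _)) =>
      first [apply: measurable_funB | apply: emeasurable_funB]
  | |- measurable_fun _ (fun x => GRing.add _ _) =>
      first [apply: measurable_funD | apply: emeasurable_funD]
  | |- measurable_fun _ (fun x => GRing.mul _ _) => apply: measurable_funM
  | |- measurable_fun _ (fun x => mule _ _) => apply: emeasurable_funM
  | H : measurable_fun _ (fun p => ?F (fst p) (snd p)) |- measurable_fun _ (fun x => ?F _ _) =>
      apply: (measurable_fun_uncurried H)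
  | H : measurable_fun _ (fun p => ?F (fst p) (snd p)) |- measurable_fun _ (?F _) =>
      exact: (measurable_section _ H)
  | H : measurable_fun _ ?f |- measurable_fun _ (fun x => ?f _) =>
      apply: (measurableT_comp H)
  end.

(** Holds because the integral of a nonnegative function is the supremum over the simple functions
    below it; it compares iterated integrals directly, one variable at a time. *)
Lemma ge0_le_integralT {d : measure_display} {T : measurableType d} {R : realType}
    (mu : {measure set T -> \bar R}) (f g : T -> \bar R) :
  (forall x, 0 <= f x)%E -> (forall x, f x <= g x)%E ->
  (\int[mu]_x f x <= \int[mu]_x g x)%E.
Proof.
move=> f0 fg; rewrite !ge0_integralTE//; last by move=> x; exact: le_trans (fg x).
apply: le_ereal_sup => _ /= [h hf <-]; exists h => // x.
exact: le_trans (fg x).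
Qed.

Section tonelli.
Context {d1 d2 : measure_display} {T1 : measurableType d1}
  {T2 : measurableType d2} {R : realType}.
Variables (m1 : {sigma_finite_measure set T1 -> \bar R})
  (m2 : {sigma_finite_measure set T2 -> \bar R}).
Variable F : T1 -> T2 -> \bar R.
Hypothesis mF : measurable_fun [set: T1 * T2] (fun p => F p.1 p.2).
Hypothesis F0 : forall x y, (0 <= F x y)%E.

Lemma tonelli_swap :
  (\int[m1]_x \int[m2]_y F x y = \int[m2]_y \int[m1]_x F x y)%E.
Proof. by rewrite (fubini_tonelli (fun p => F p.1 p.2)). Qed.

Lemma double_integral :
  (\int[m1]_x \int[m2]_y F x y = \int[m1 \x m2]_p F p.1 p.2)%E.
Proof. by rewrite (fubini_tonelli1 (fun p => F p.1 p.2)). Qed.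

Lemma measurable_tonelli : measurable_fun setT (fun x => \int[m2]_y F x y)%E.
Proof. exact: (@measurable_fun_fubini_tonelli_F _ _ _ _ _ _ (fun p => F p.1 p.2)). Qed.

End tonelli.

(** * Energies *)

Lemma ler_M_sqrD {R : realType} (k a b : R) : 0 <= k ->
  k * (a + b) ^+ 2 <= 2 * (k * a ^+ 2) + 2 * (k * b ^+ 2).
Proof.
move=> k0; rewrite -subr_ge0 (_ : _ - _ = k * (a - b) ^+ 2); last by ring.
by rewrite mulr_ge0// sqr_ge0.
Qed.

Section energy.
Context {d : measure_display} {T : measurableType d} {R : realType}.
Variable mu : {sigma_finite_measure set T -> \bar R}.

(** A nonlocal Dirichlet form, of the same type as the Gagliardo seminorm but with a kernel of
    finite mass. *)
Definition energy (K : T -> T -> R) (f : T -> R) : \bar R :=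
  (\int[mu]_x \int[mu]_y (K x y * (f x - f y) ^+ 2)%:E)%E.

(** The mass [c] is a parameter because it is the same at all scales for the kernels in use, which
    makes [energy_le] uniform in the scale. *)
Record averaging_kernel (c : R) (K : T -> T -> R) : Prop := AveragingKernel {
  kernel_measurable : measurable_fun [set: T * T] (fun p => K p.1 p.2) ;
  kernel_ge0 : forall x y, 0 <= K x y ;
  kernel_sym : forall x y, K x y = K y x ;
  kernel_mass : forall x, (\int[mu]_y (K x y)%:E = c%:E)%E }.

Section one_kernel.
Variables (c : R) (K : T -> T -> R).
Implicit Types f g : T -> R.
Hypothesis kK : averaging_kernel c K.
Let mK := kernel_measurable kK.
Let K0 := kernel_ge0 kK.

Lemma kernel_mass_ge0 (x : T) : 0 <= c.
Proof.
by rewrite -lee_fin -(kernel_mass kK x); apply: integral_ge0 => y _; rewrite lee_fin.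
Qed.

Lemma measurable_energy_integrand f : measurable_fun setT f ->
  measurable_fun [set: T * T] (fun p => K p.1 p.2 * (f p.1 - f p.2) ^+ 2).
Proof. by move=> mf; measurability. Qed.

Lemma integral_kernel_right f : measurable_fun setT f ->
  (\int[mu]_x \int[mu]_y (K x y * f x ^+ 2)%:E = c%:E * \int[mu]_x (f x ^+ 2)%:E)%E.
Proof.
(* A point of [T] forces [0 <= c], so [c < 0] is possible only when [T] is empty. *)
move=> mf; have [c0|c0] := leP 0 c; last first.
  have noT (x : T) : False by move: c0; rewrite ltNge (kernel_mass_ge0 x).
  have T0 : [set: T] = set0 by apply/seteqP; split => // x; have := noT x.
  by rewrite T0 !integral_set0 mule0.
rewrite -ge0_integralZl//; last 2 first.
- by measurability.
- by move=> x _; rewrite lee_fin sqr_ge0.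
apply: eq_integral => x _; rewrite muleC.
under eq_integral => y _ do rewrite mulrC EFinM.
rewrite ge0_integralZl ?(kernel_mass kK)// ?lee_fin ?sqr_ge0//.
- apply/measurable_EFinP.
  exact: measurable_section.
- by move=> y _; rewrite lee_fin.
Qed.

Lemma integral_kernel_left f : measurable_fun setT f ->
  (\int[mu]_x \int[mu]_y (K x y * f y ^+ 2)%:E = c%:E * \int[mu]_x (f x ^+ 2)%:E)%E.
Proof.
move=> mf; rewrite (@tonelli_swap _ _ _ _ _ mu mu (fun x y => (K x y * f y ^+ 2)%:E)).
- transitivity (\int[mu]_y \int[mu]_x (K y x * f y ^+ 2)%:E)%E; last first.
    exact: integral_kernel_right.
  apply: eq_integral => y _.
  by apply: eq_integral => x _; rewrite (kernel_sym kK).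
- by measurability.
- by move=> x y; rewrite lee_fin mulr_ge0// sqr_ge0.
Qed.

Lemma energy_ge0 f : (0 <= energy K f)%E.
Proof.
by apply: integral_ge0 => x _; apply: integral_ge0 => y _; rewrite lee_fin mulr_ge0// sqr_ge0.
Qed.

Lemma energyD f g : measurable_fun setT f -> measurable_fun setT g ->
  (energy K (fun x => (f x + g x)%R) <= 2%:E * energy K f + 2%:E * energy K g)%E.
Proof.
move=> mf mg.
have mef := measurable_energy_integrand mf.
have meg := measurable_energy_integrand mg.
have e0 h x y : (0 <= (K x y * (h x - h y) ^+ 2)%:E)%E.
  by rewrite lee_fin mulr_ge0// sqr_ge0.
rewrite /energy !double_integral//; [|by measurability|by measurability|
  by measurability|by move=> x y; exact: (e0 (fun x => f x + g x))].
rewrite -!ge0_integralZl//; [|by measurability..].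
rewrite -ge0_integralD//; [|by move=> p _; rewrite mule_ge0|
  by measurability|by move=> p _; rewrite mule_ge0|by measurability].
apply: ge0_le_integral => //; [|by measurability|by measurability|].
  by move=> p _; exact: (e0 (fun x => f x + g x)).
move=> p _; rewrite -!EFinM -EFinD lee_fin opprD addrACA.
exact: ler_M_sqrD.
Qed.

Lemma energyZ f k : measurable_fun setT f ->
  energy K (fun x => (k * f x)%R) = ((k ^+ 2)%:E * energy K f)%E.
Proof.
move=> mf; rewrite /energy !double_integral//;
  [|by measurability|by move=> x y; rewrite lee_fin mulr_ge0// sqr_ge0
   |by measurability|by move=> x y; rewrite lee_fin mulr_ge0// sqr_ge0].
rewrite -ge0_integralZl ?lee_fin ?sqr_ge0//.
- by apply: eq_integral => p _; rewrite -EFinM; congr EFin; ring.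
- by measurability.
- by move=> p _; rewrite lee_fin mulr_ge0// sqr_ge0.
Qed.

(** From [(f x - f y)^2 <= 2 f x^2 + 2 f y^2]: by symmetry of [K], both terms integrate to the same
    multiple of the squared [L^2] norm. *)
Lemma energy_le f : measurable_fun setT f ->
  (energy K f <= (4 * c)%:E * \int[mu]_x (f x ^+ 2)%:E)%E.
Proof.
move=> mf.
have h1 x y : (0 <= (K x y * f x ^+ 2)%:E)%E by rewrite lee_fin mulr_ge0// sqr_ge0.
have h2 x y : (0 <= (K x y * f y ^+ 2)%:E)%E by rewrite lee_fin mulr_ge0// sqr_ge0.
have h3 x y : (0 <= (K x y * (f x - f y) ^+ 2)%:E)%E.
  by rewrite lee_fin mulr_ge0// sqr_ge0.
have [noT|c0] : (forall x : T, False) \/ 0 <= c .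
  have [c0|c0] := leP 0 c; [by right|left=> x].
  by move: c0; rewrite ltNge (kernel_mass_ge0 x).
- have T0 : [set: T] = set0 by apply/seteqP; split => // x; have := noT x.
  by rewrite /energy T0 !integral_set0 mule0.
apply: (@le_trans _ _ (2%:E * (\int[mu]_x \int[mu]_y (K x y * f x ^+ 2)%:E)
     + 2%:E * (\int[mu]_x \int[mu]_y (K x y * f y ^+ 2)%:E))%E).
- rewrite /energy !double_integral//; [|by measurability|by measurability|
    by measurability].
  rewrite -!ge0_integralZl//; [|by measurability..].
  rewrite -ge0_integralD//; [|by move=> p _; rewrite mule_ge0|
    by measurability|by move=> p _; rewrite mule_ge0|by measurability].
  apply: ge0_le_integral => //; [by measurability|by measurability|].
  move=> p _; rewrite -!EFinM -EFinD lee_fin -(sqrrN (f p.2)).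
  exact: ler_M_sqrD.
- rewrite integral_kernel_right// integral_kernel_left//.
  rewrite muleA -EFinM -ge0_muleDl ?lee_fin ?mulr_ge0//.
  by rewrite -EFinD (_ : 2 * c + 2 * c = 4 * c)//; ring.
Qed.

End one_kernel.
End energy.

(** * Energies that vanish along a sequence of kernels *)

Lemma ge0_cvg0P {R : realType} (u : nat -> \bar R) : (forall n, 0 <= u n)%E ->
  (u @ \oo --> 0%E) <-> (forall e : R, 0 < e -> \forall n \near \oo, (u n <= e%:E)%E).
Proof.
move=> u0; split => [/fine_cvgP[ufin /cvgr0Pnorm_le uc] e e0|ue].
  have := uc _ e0; apply: filterS2 ufin => n /fineK unE une.
  by rewrite -unE lee_fin (le_trans (ler_norm _)).
apply/fine_cvgP; split.
  have := ue 1 ltr01; apply: filterS => n un1.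
  by rewrite ge0_fin_numE// (le_lt_trans un1)// ltry.
apply/cvgr0Pnorm_le => e e0; have := ue e e0; apply: filterS => n une.
rewrite ger0_norm ?fine_ge0//; have : u n \is a fin_num.
  by rewrite ge0_fin_numE// (le_lt_trans une)// ltry.
by move=> /fineK unE; rewrite -lee_fin unE.
Qed.

Lemma cvg_L2_dominated {d : measure_display} {T : measurableType d} {R : realType}
    (mu : {measure set T -> \bar R}) (f : T -> R) (g : nat -> T -> R) :
  measurable_fun setT f -> (forall n, measurable_fun setT (g n)) ->
  (forall x, g n x @[n --> \oo] --> f x) -> (forall n x, `|g n x| <= `|f x|) ->
  (\int[mu]_x (f x ^+ 2)%:E < +oo)%E ->
  (\int[mu]_x ((f x - g n x) ^+ 2)%:E)%E @[n --> \oo] --> 0%E.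
Proof.
move=> mf mg gf gle foo.
have := @dominated_convergence _ _ _ mu setT measurableT
  (fun n x => ((f x - g n x) ^+ 2)%:E) (cst 0%E) (fun x => (4 * f x ^+ 2)%:E).
case.
- by move=> n; have := mg n; move=> mgn; measurability.
- exact: measurable_cst.
- apply: aeW => x _; apply: cvg_EFin; first exact: nearW.
  rewrite [X in _ --> X](_ : _ = (f x - f x) * (f x - f x)); last by rewrite subrr mulr0.
  by under eq_fun do rewrite expr2; apply: cvgM;
    apply: cvgB => //; exact: cvg_cst.
- apply/integrableP; split; first by measurability.
  rewrite (eq_integral (fun x => 4%:E * (f x ^+ 2)%:E)%E); last first.
    by move=> x _; rewrite -EFinM gee0_abs// lee_fin mulr_ge0// sqr_ge0.
  rewrite ge0_integralZl//.
  + by rewrite lte_mul_pinfty.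
  + by measurability.
  + by move=> x _; rewrite lee_fin sqr_ge0.
- apply: aeW => x n _; rewrite /= lee_fin ger0_norm ?sqr_ge0//.
  rewrite -(real_normK (num_real (f x - g n x))) -(real_normK (num_real (f x))).
  have h : `|f x - g n x| <= 2 * `|f x|.
    by rewrite (le_trans (ler_normB _ _))//; have := gle n x; lra.
  have : 4 * `|f x| ^+ 2 = (2 * `|f x|) ^+ 2 by ring.
  by move=> ->; rewrite ler_sqr ?nnegrE ?mulr_ge0.
by move=> _ _; rewrite integral0.
Qed.

Section vanishing.
Context {d : measure_display} {T : measurableType d} {R : realType}.
Variables (mu : {sigma_finite_measure set T -> \bar R}) (c : R).
Variable K : nat -> T -> T -> R.
Hypothesis c0 : 0 <= c.
Hypothesis kK : forall n, averaging_kernel mu c (K n).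
Implicit Types f g : T -> R.

(* Continuity of the translations in L^2, in averaged form. *)
Definition vanishing_energy f := energy mu (K n) f @[n --> \oo] --> 0%E.

Lemma vanishing_energyD f g : measurable_fun setT f -> measurable_fun setT g ->
  vanishing_energy f -> vanishing_energy g ->
  vanishing_energy (fun x => f x + g x).
Proof.
move=> mf mg /ge0_cvg0P vf /ge0_cvg0P vg; apply/ge0_cvg0P => [n|e e0].
  exact: energy_ge0.
have e4 : 0 < e / 4 by rewrite divr_gt0.
have := vf (fun n => energy_ge0 (kK n) f) _ e4.
have := vg (fun n => energy_ge0 (kK n) g) _ e4.
apply: filterS2 => n gn fn; apply: (le_trans (energyD (kK n) mf mg)).
rewrite (_ : e%:E = 2%:E * (e / 4)%:E + 2%:E * (e / 4)%:E)%E; last first.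
  by rewrite -!EFinM -EFinD; congr EFin; field.
by apply: leeD; apply: lee_wpmul2l; [|exact: fn| |exact: gn].
Qed.

Lemma vanishing_energyZ f k : measurable_fun setT f ->
  vanishing_energy f -> vanishing_energy (fun x => k * f x).
Proof.
move=> mf vf; rewrite /vanishing_energy.
under eq_fun => n do rewrite (energyZ (kK n))//.
have k2 : (k ^+ 2)%:E \is a fin_num by [].
by have := cvgeZl k2 vf; rewrite mule0.
Qed.

(** The bound [energy_le] does not depend on [n], so functions of vanishing energy are closed under
    limits in [L^2]. *)
Lemma vanishing_energy_lim f (g : nat -> T -> R) :
  measurable_fun setT f -> (forall k, measurable_fun setT (g k)) ->
  (forall k, vanishing_energy (g k)) ->
  (\int[mu]_x ((f x - g k x) ^+ 2)%:E)%E @[k --> \oo] --> 0%E ->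
  vanishing_energy f.
Proof.
move=> mf mg vg /ge0_cvg0P gf; apply/ge0_cvg0P => [n|e e0].
  exact: energy_ge0.
have e4 : 0 < e / 4 by rewrite divr_gt0.
(* The factor [8 c] in front of the squared distance turns this into at most [e / 2]; [c + 1] covers
   [c = 0]. *)
have e16 : 0 < e / (16 * (c + 1)).
  by rewrite divr_gt0 ?mulr_gt0// ltr_wpDl.
have [k] : exists k, (\int[mu]_x ((f x - g k x) ^+ 2)%:E <= (e / (16 * (c + 1)))%:E)%E.
  have h0 k : (0 <= \int[mu]_x ((f x - g k x) ^+ 2)%:E)%E.
    by apply: integral_ge0 => x _; rewrite lee_fin sqr_ge0.
  by have [N _ /(_ N (leqnn N))] := gf h0 _ e16; exists N.
have mgk := mg k.
move=> fgk; have /ge0_cvg0P vgk := vg k.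
have := vgk (fun n => energy_ge0 (kK n) (g k)) _ e4.
apply: filterS => n gn.
have -> : f = (fun x => g k x + (f x - g k x)) by apply/funext => x; rewrite addrC subrK.
apply: (le_trans (energyD (kK n) _ _)) => //; first by measurability.
apply: (@le_trans _ _ (2%:E * (e / 4)%:E + 2%:E * ((4 * c)%:E * (e / (16 * (c + 1)))%:E))%E).
  apply: leeD; rewrite lee_pmul2l//.
  apply: (le_trans (energy_le (kK n) _)); first by measurability.
  by apply: lee_wpmul2l => //; rewrite lee_fin mulr_ge0.
rewrite -!EFinM -EFinD lee_fin.
have -> : 2 * (e / 4) + 2 * (4 * c * (e / (16 * (c + 1)))) = e / 2 * (1 + c / (c + 1)).
  by field; rewrite gt_eqF// ltr_wpDl.
have : c / (c + 1) <= 1 by rewrite ler_pdivrMr ?ltr_wpDl// mul1r lerDl.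
by nra.
Qed.

Let vanishing_energy0 : vanishing_energy (fun _ => 0).
Proof.
rewrite /vanishing_energy /energy; under eq_fun => n do under eq_integral => x _ do
  (under eq_integral => y _ do rewrite subrr expr0n mulr0; rewrite integral0).
by under eq_fun do rewrite integral0; exact: cvg_cst.
Qed.

Let vanishing_energy_sum (I : Type) (r : seq I) (g : I -> T -> R) :
  (forall i, measurable_fun setT (g i)) -> (forall i, vanishing_energy (g i)) ->
  vanishing_energy (fun x => \sum_(i <- r) g i x).
Proof.
move=> mg vg; elim: r => [|i r IH].
  by under eq_fun do rewrite big_nil; exact: vanishing_energy0.
under eq_fun do rewrite big_cons.
apply: vanishing_energyD; [exact: mg| |exact: vg|exact: IH].
by apply: measurable_sum => j; exact: mg.
Qed.

Import HBNNSimple.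

(** Density: simple functions cut off to [I m] are combinations of the given indicators; a
    nonnegative [f] is the dominated [L^2] limit of its increasing simple approximations cut off to
    [I n], and a signed [f] is split into its positive and negative parts. *)
Lemma vanishing_energy_L2 (I : nat -> set T) :
  (forall m, measurable (I m)) -> (forall x, \forall m \near \oo, I m x) ->
  (forall m A, measurable A -> vanishing_energy (\1_(A `&` I m))) ->
  forall f, measurable_fun setT f -> (\int[mu]_x (f x ^+ 2)%:E < +oo)%E ->
    vanishing_energy f.
Proof.
move=> mI Icov vI.
have vs (h : {nnsfun T >-> R}) m : vanishing_energy (fun x => h x * \1_(I m) x).
  rewrite (_ : (fun x => _) = (fun x => \sum_(i < size (finmap.enum_fset (fset_set (range h))))
      (finmap.enum_fset (fset_set (range h)))`_i *
      \1_(h @^-1` [set (finmap.enum_fset (fset_set (range h)))`_i] `&` I m) x)); last first.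
    apply/funext => x; rewrite (fimfunEord h) mulr_suml; apply: eq_bigr => i _.
    by rewrite indicI mulrA.
  apply: vanishing_energy_sum => i.
    by apply: measurable_funM => //; apply: measurable_indic; apply: measurableI.
  apply: vanishing_energyZ; last by apply: vI.
  by apply: measurable_indic; apply: measurableI.
have vp f : measurable_fun setT f -> (forall x, 0 <= f x) ->
    (\int[mu]_x (f x ^+ 2)%:E < +oo)%E -> vanishing_energy f.
  move=> mf f0 foo.
  have mEf : measurable_fun setT (EFin \o f) by exact/measurable_EFinP.
  pose g n := nnsfun_approx measurableT mEf n.
  apply: (@vanishing_energy_lim f (fun n x => g n x * \1_(I n) x)).
  - exact: mf.
  - by move=> n; apply: measurable_funM => //; exact: measurable_indic.
  - by move=> n; exact: vs.
  apply: cvg_L2_dominated => //.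
  - by move=> n; apply: measurable_funM => //; exact: measurable_indic.
  - move=> x; apply: (@cvg_trans _ (g n x @[n --> \oo])).
      apply: near_eq_cvg; have := Icov x; apply: filterS => n Inx.
      by rewrite indicE mem_set// mulr1.
    rewrite -[f x]/(fine (f x)%:E); have xT : [set: T] x by [].
    rewrite /g; under eq_fun do rewrite nnsfun_approxE.
    by apply: cvg_approx => //; [move=> y _; rewrite lee_fin|rewrite ltry].
  - move=> n x; rewrite !ger0_norm ?mulr_ge0//.
    apply: (@le_trans _ _ (g n x)).
      by rewrite ler_piMr// indicE lern1 leq_b1.
    rewrite -lee_fin /g nnsfun_approxE; apply: le_approx => // y _.
    by rewrite lee_fin.
move=> f mf foo.
have mfp : measurable_fun setT (f^\+)%R by exact: measurable_funrpos.
have mfn : measurable_fun setT (f^\-)%R by exact: measurable_funrneg.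
have dom (h : T -> R) : measurable_fun setT h -> (forall x, `|h x| <= `|f x|) ->
    (\int[mu]_x (h x ^+ 2)%:E < +oo)%E.
  move=> mh hf; apply: le_lt_trans foo; apply: ge0_le_integral => //.
  - by move=> x _; rewrite lee_fin sqr_ge0.
  - by measurability.
  - by measurability.
  - move=> x _; rewrite lee_fin -(real_normK (num_real (h x))).
    by rewrite -(real_normK (num_real (f x))) ler_sqr ?nnegrE.
have fD x : f^\+%R x + f^\-%R x = `|f x| := congr1 (fun h : T -> R => h x) (funrposDneg f).
rewrite (_ : f = (fun x => f^\+%R x + (-1) * f^\-%R x)); last first.
  apply/funext => x; by rewrite mulN1r -{1}(funrposBneg f).
apply: vanishing_energyD; first exact: mfp.
- by apply: measurable_funM.
- apply: vp; [exact: mfp|exact: funrpos_ge0|].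
  apply: dom => // x; rewrite ger0_norm ?funrpos_ge0// -fD lerDl.
  exact: funrneg_ge0.
- apply: vanishing_energyZ; first exact: mfn.
  apply: vp; [exact: mfn|exact: funrneg_ge0|].
  apply: dom => // x; rewrite ger0_norm ?funrneg_ge0// -fD lerDr.
  exact: funrpos_ge0.
Qed.
End vanishing.

(** * Vanishing energies on the line *)

Section cauchy2_energy.
Context {R : realType}.
Local Notation leb := (@lebesgue_measure R).
Implicit Types (t a : R) (f : measurableTypeR R -> R).

Definition cauchy2_kernel t : measurableTypeR R -> measurableTypeR R -> R :=
  fun x y => cauchy2 t (x - y).

Lemma averaging_cauchy2_kernel t : 0 < t -> averaging_kernel leb (2 * pi) (cauchy2_kernel t).
Proof.
move=> t0; split.
- rewrite /cauchy2_kernel; apply: (measurableT_comp (measurable_cauchy2 t0)).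
  by apply: measurable_funB; [exact: measurable_fst|exact: measurable_snd].
- by move=> x y; rewrite cauchy2_ge0// ltW.
- by move=> x y; rewrite /cauchy2_kernel -cauchy2N opprB.
- by move=> x; exact: integral_cauchy2.
Qed.

(** Only pairs separated by [a] contribute. For them [(x - y)^2] is at least both [(x - a)^2] and
    [(a - y)^2], so the square in the denominator of the kernel dominates a product of one factor in
    [x] and one in [y]. Each factor integrates to [pi], and a power of [t] is left. *)
Lemma energy_ray_le t a : 0 < t ->
  (energy leb (cauchy2_kernel t) (\1_(`]a, +oo[%classic)) <= (4 * pi ^+ 2 * t)%:E)%E.
Proof.
move=> t0; pose h (x : R) := t / (t ^+ 2 + (a - x) ^+ 2).
have D0 (x : R) : 0 < t ^+ 2 + x ^+ 2.
  by rewrite ltr_pwDl ?sqr_ge0// exprn_gt0.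
have h0 x : 0 <= h x by rewrite divr_ge0 // ltW.
have g0 x y : 0 <= 4 * t * h x * h y.
  by rewrite mulr_ge0 // mulr_ge0// mulr_ge0// ltW.
have mh : measurable_fun setT (h : measurableTypeR R -> R).
  apply: continuous_measurable_fun => x; apply: cvgM; first exact: cvg_cst.
  apply: cvgV; first by rewrite gt_eqF.
  apply: cvgD; first exact: cvg_cst.
  apply: (@continuous_comp _ _ _ (fun x => a - x) (fun y => y ^+ 2)).
    by apply: cvgB; [exact: cvg_cst|exact: cvg_id].
  exact: exprn_continuous.
apply: (@le_trans _ _ (\int[leb]_x \int[leb]_y (4 * t * h x * h y)%:E)%E).
  have mr : measurable_fun setT (\1_(`]a, +oo[%classic) : measurableTypeR R -> R).
    exact: measurable_indic.
  have mK := kernel_measurable (averaging_cauchy2_kernel t0).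
  have K0 := kernel_ge0 (averaging_cauchy2_kernel t0).
  rewrite /energy !double_integral//; [|by measurability|by measurability|]; last first.
    by move=> x y; rewrite lee_fin mulr_ge0// sqr_ge0.
  apply: ge0_le_integral => //; [|by measurability|by measurability|].
  - by move=> p _; rewrite lee_fin mulr_ge0// sqr_ge0.
  move=> [x y] _ /=; rewrite lee_fin.
  suff key : (x - a) * (a - y) >= 0 -> cauchy2_kernel t x y <= 4 * t * h x * h y.
    rewrite !indicE !mem_setE !in_itv/= !andbT.
    have [ax|xa] := ltP a x; have [ay|ya] := ltP a y;
      rewrite ?subrr ?subr0 ?sub0r ?sqrrN ?expr0n ?expr1n ?mulr0 ?mulr1//; apply: key.
      by rewrite mulr_ge0// subr_ge0 // ltW.
    by rewrite mulr_le0// subr_le0// ltW.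
  move=> xy; rewrite /cauchy2_kernel /cauchy2.
  have -> : 4 * t * h x * h y =
     4 * t ^+ 3 / ((t ^+ 2 + (a - x) ^+ 2) * (t ^+ 2 + (a - y) ^+ 2)).
    by rewrite /h; field; rewrite !gt_eqF.
  rewrite ler_wpM2l ?mulr_ge0 ?exprn_ge0 ?(ltW t0)//.
  rewrite lef_pV2 ?posrE ?mulr_gt0 ?exprn_gt0// [leRHS]expr2.
  apply: ler_pM; rewrite ?(ltW (D0 _))// lerD2l.
    have -> : x - y = (x - a) + (a - y) by ring.
    by have := sqr_ge0 (a - y); nra.
  have -> : x - y = (x - a) + (a - y) by ring.
  by have := sqr_ge0 (x - a); nra.
have ih : (\int[leb]_y (h y)%:E = pi%:E)%E by exact: integral_cauchy.
have t40 : 0 <= 4 * t by rewrite mulr_ge0// ltW.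
have hZ k : 0 <= k -> (\int[leb]_y (k * h y)%:E = (k * pi)%:E)%E.
  move=> k0; under eq_integral => y _ do rewrite EFinM.
  rewrite ge0_integralZl ?lee_fin//.
  - by rewrite ih.
  - by measurability.
  - by move=> y _; rewrite lee_fin.
under eq_integral => x _ do rewrite (hZ _ (mulr_ge0 t40 (h0 x))) mulrAC.
by rewrite (hZ _ (mulr_ge0 t40 (pi_ge0 R))) lee_fin le_eqVlt; apply/orP; left; apply/eqP; ring.
Qed.

Variable t_ : nat -> R.
Hypothesis t_gt0 : forall n, 0 < t_ n.
Hypothesis t_cvg0 : t_ n @[n --> \oo] --> 0.

Let K n := cauchy2_kernel (t_ n).
Let kK n := averaging_cauchy2_kernel (t_gt0 n).
Let pi2 : 0 <= 2 * pi :> R. Proof. by rewrite mulr_ge0// pi_ge0. Qed.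

Let vanishing_ray a : vanishing_energy leb K (\1_(`]a, +oo[%classic)).
Proof.
apply: (@squeeze_cvge _ _ _ _ (cst 0%E) _ (fun n => (4 * pi ^+ 2 * t_ n)%:E)).
- by near=> n; rewrite energy_ray_le// (energy_ge0 (kK n)).
- exact: cvg_cst.
- apply: cvg_EFin; first exact: nearW.
  by rewrite -[X in _ --> X](mulr0 (4 * pi ^+ 2)); apply: cvgM => //; exact: cvg_cst.
Unshelve. all: by end_near. Qed.

Let vanishing_itv a b : vanishing_energy leb K (\1_(`]a, b]%classic)).
Proof.
have [ab|ba] := leP a b; last first.
  rewrite set_itv_ge ?bnd_simp -?leNgt ?ltW// indic0.
  have := vanishing_energyZ kK 0 (measurable_indic (measurable_itv `]a, +oo[)) (vanishing_ray a).
  by congr (vanishing_energy _ _ _); apply/funext => x; rewrite mul0r.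
have -> : \1_(`]a, b]%classic) = (fun x : measurableTypeR R =>
    \1_(`]a, +oo[%classic) x + (-1) * \1_(`]b, +oo[%classic) x) :> (_ -> R).
  apply/funext => x; rewrite !indicE !mem_setE !in_itv/= !andbT.
  have [ax|xa] := ltP a x; have [bx|xb] := ltP b x => /=; rewrite ?mulr0 ?mulr1 ?addr0 ?subrr//.
  by have := lt_le_trans bx xa; rewrite ltNge ab.
apply: (vanishing_energyD kK).
- exact: measurable_indic.
- by apply: measurable_funM => //; exact: measurable_indic.
- exact: vanishing_ray.
- by apply: (vanishing_energyZ kK); [exact: measurable_indic|exact: vanishing_ray].
Qed.

(** Dynkin's theorem from half-open intervals. Intersecting with a bounded interval keeps the
    indicators in [L^2]: complements are then differences, and countable disjoint unions are [L^2]
    limits. *)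
Let vanishing_indic (m : nat) (A : set (measurableTypeR R)) : measurable A ->
  vanishing_energy leb K (\1_(A `&` `]- m%:R, m%:R]%classic)).
Proof.
pose I : set (measurableTypeR R) := `]- m%:R, m%:R]%classic.
have mI : measurable I by exact: measurable_itv.
have Ioo : (leb I < +oo)%E.
  by rewrite /I lebesgue_measure_itv/= lte_fin; case: ifPn => // _; rewrite -EFinB ltry.
rewrite -/I; move: A.
apply: (@dynkin_induction _ (measurableTypeR R) (@ocitv R)
  (fun A => vanishing_energy leb K (\1_(A `&` I)))).
- by [].
- exact: ocitvI.
- by rewrite setTI; exact: vanishing_itv.
- move=> A oA.
  have [x _ <-] : ocitv (A `&` I) by apply: ocitvI => //; exact: is_ocitv.
  exact: vanishing_itv.
- move=> A mA vA.
  have -> : \1_(~` A `&` I) = (fun x => \1_I x + (-1) * \1_(A `&` I) x) :> (_ -> R).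
    apply/funext => x; rewrite !indicE !in_setI in_setC.
    by case: (x \in A); case: (x \in I) => /=; ring.
  apply: (vanishing_energyD kK).
  + exact: measurable_indic.
  + by apply: measurable_funM => //; apply: measurable_indic; exact: measurableI.
  + exact: vanishing_itv.
  + by apply: (vanishing_energyZ kK) => //; apply: measurable_indic; exact: measurableI.
- move=> F mF tF vF.
  pose S n := \big[setU/set0]_(i < n) F i.
  have mS n : measurable (S n) by apply: bigsetU_measurable => i _; exact: mF.
  have mU : measurable (\bigcup_k F k) by exact: bigcup_measurable.
  apply: (vanishing_energy_lim (g := fun n => \1_(S n `&` I)) pi2 kK).
  + by apply: measurable_indic; exact: measurableI.
  + by move=> n; apply: measurable_indic; exact: measurableI.
  + elim => [|n IH].
      rewrite /S big_ord0 set0I.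
      have := vanishing_energyZ kK 0 (measurable_indic mI) (vanishing_itv (- m%:R) m%:R).
      by congr (vanishing_energy _ _ _); apply/funext => x; rewrite mul0r indic0.
    have -> : \1_(S n.+1 `&` I) = (fun x => \1_(S n `&` I) x + \1_(F n `&` I) x) :> (_ -> R).
      apply/funext => x; rewrite /S big_ord_recr/= -/(S n).
      have : (x \in S n) && (x \in F n) = false.
        rewrite -in_setI (_ : S n `&` F n = set0) ?in_set0//.
        have tF' : trivIset (fun x : nat => xpredT x) F by rewrite (_ : (fun _ => _) = setT)//; apply/seteqP.
        exact: (trivIset_bigsetUI tF' (n := n) (m := n)).
      rewrite !indicE !in_setI in_setU.
      by case: (x \in S n); case: (x \in F n); case: (x \in I) => //= _; ring.
    apply: (vanishing_energyD kK); [| |exact: IH|exact: vF];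
      apply: measurable_indic; exact: measurableI.
  + apply: cvg_L2_dominated.
    * by apply: measurable_indic; exact: measurableI.
    * by move=> n; apply: measurable_indic; exact: measurableI.
    * move=> x; apply: cvg_near_cst; have [[k _ Fkx]|nUx] := pselect ((\bigcup_k F k) x).
        exists k.+1 => // n /= kn; rewrite !indicE !in_setI.
        have -> : x \in \bigcup_k F k by rewrite inE; exists k.
        by have -> : x \in S n by rewrite inE /S (bigD1 (Ordinal kn))//=; left.
      near=> n; rewrite !indicE !in_setI [x \in \bigcup_k F k]memNset//.
      by rewrite [x \in S n]memNset// => Snx; apply: nUx; exact: bigsetU_bigcup Snx.
    * move=> n x; rewrite !indicE !in_setI.
      have : (x \in S n) ==> (x \in \bigcup_k F k).
        by apply/implyP; rewrite !inE; exact: bigsetU_bigcup.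
      by case: (x \in S n); case: (x \in \bigcup_k F k); case: (x \in I);
        rewrite //= ?normr0.
    * apply: le_lt_trans Ioo.
      rewrite -[X in (_ <= leb X)%E]setIT -integral_indic//.
      apply: ge0_le_integral => //.
      - apply/measurable_EFinP; apply: measurable_funX; apply: measurable_indic.
        exact: measurableI.
      - by apply/measurable_EFinP; exact: measurable_indic.
      - move=> x _; rewrite lee_fin !indicE !in_setI.
        by case: (_ \in \bigcup_k F k); case: (_ \in I); rewrite //= ?expr0n ?expr1n.
Unshelve. all: by end_near. Qed.

Lemma vanishing_cauchy2_energy (f : measurableTypeR R -> R) :
  measurable_fun setT f -> (\int[leb]_x (f x ^+ 2)%:E < +oo)%E ->
  vanishing_energy leb K f.
Proof.
apply: (vanishing_energy_L2 pi2 kK (I := fun m => `]- m%:R, m%:R]%classic)).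
- by move=> m; exact: measurable_itv.
- move=> x; exists (Num.truncn `|x|).+1 => // m /= mx.
  have xm : `|x| < m%:R by rewrite (lt_le_trans (truncnS_gt _))// ler_nat.
  by move: xm; rewrite ltr_norml in_itv/= => /andP[-> /ltW].
- by move=> m A mA; exact: vanishing_indic.
Qed.
End cauchy2_energy.

(** * Energies on a product space *)

Section tensor_energy.
Context {d1 d2 : measure_display} {T1 : measurableType d1}
  {T2 : measurableType d2} {R : realType}.
Variables (m1 : {sigma_finite_measure set T1 -> \bar R})
  (m2 : {sigma_finite_measure set T2 -> \bar R}).

Section one_scale.
Variables (c1 c2 : R) (K1 : T1 -> T1 -> R) (K2 : T2 -> T2 -> R).
Hypotheses (kK1 : averaging_kernel m1 c1 K1) (kK2 : averaging_kernel m2 c2 K2).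
Hypotheses (c10 : 0 <= c1) (c20 : 0 <= c2).
Let mK1 := kernel_measurable kK1.
Let mK2 := kernel_measurable kK2.
Let K10 := kernel_ge0 kK1.
Let K20 := kernel_ge0 kK2.
Variable F : T1 -> T2 -> R.
Hypothesis mF : measurable_fun [set: T1 * T2] (fun p => F p.1 p.2).

Lemma measurable_energy_left : measurable_fun setT (fun x2 => energy m1 K1 (F ^~ x2)).
Proof.
apply: measurable_tonelli => [|x2 x1]; last first.
  by apply: integral_ge0 => y1 _; rewrite lee_fin mulr_ge0// sqr_ge0.
apply: (@measurable_tonelli _ _ _ _ _ m1 (fun (p : T2 * T1) y1 =>
  (K1 p.2 y1 * (F p.2 p.1 - F y1 p.1) ^+ 2)%:E)); first by measurability.
by move=> p y1; rewrite lee_fin mulr_ge0// sqr_ge0.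
Qed.

Lemma measurable_energy_right : measurable_fun setT (fun x1 => energy m2 K2 (F x1)).
Proof.
apply: measurable_tonelli => [|x1 x2]; last first.
  by apply: integral_ge0 => y1 _; rewrite lee_fin mulr_ge0// sqr_ge0.
apply: (@measurable_tonelli _ _ _ _ _ m2 (fun (p : T1 * T2) y2 =>
  (K2 p.2 y2 * (F p.1 p.2 - F p.1 y2) ^+ 2)%:E)); first by measurability.
by move=> p y1; rewrite lee_fin mulr_ge0// sqr_ge0.
Qed.

(* [F x1 x2 - F y1 y2] is split through [F y1 x2]. *)
Lemma tensor_energy_le :
  (\int[m1]_x1 \int[m2]_x2 \int[m1]_y1 \int[m2]_y2
     (K1 x1 y1 * K2 x2 y2 * (F x1 x2 - F y1 y2) ^+ 2)%:E
   <= (2 * c2)%:E * \int[m2]_x2 energy m1 K1 (F ^~ x2)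
    + (2 * c1)%:E * \int[m1]_x1 energy m2 K2 (F x1))%E.
Proof.
pose A (x1 : T1) (x2 : T2) (y1 : T1) : \bar R :=
  (K1 x1 y1 * (F x1 x2 - F y1 x2) ^+ 2)%:E.
pose B (y1 : T1) (x2 : T2) : \bar R :=
  (\int[m2]_y2 (K2 x2 y2 * (F y1 x2 - F y1 y2) ^+ 2)%:E)%E.
have A0 x1 x2 y1 : (0 <= A x1 x2 y1)%E by rewrite lee_fin mulr_ge0// sqr_ge0.
have B0 y1 x2 : (0 <= B y1 x2)%E.
  by apply: integral_ge0 => y2 _; rewrite lee_fin mulr_ge0// sqr_ge0.
have mB : measurable_fun [set: T1 * T2] (fun p => B p.1 p.2).
  apply: (@measurable_tonelli _ _ _ _ _ m2 (fun (p : T1 * T2) y2 =>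
    (K2 p.2 y2 * (F p.1 p.2 - F p.1 y2) ^+ 2)%:E)); first by measurability.
  by move=> p y2; rewrite lee_fin mulr_ge0// sqr_ge0.
have KB0 x1 y1 x2 : (0 <= (K1 x1 y1)%:E * B y1 x2)%E.
  by rewrite mule_ge0// lee_fin.
(* The first difference does not involve [y2], so [K2] integrates to [c2] there. *)
have inner x1 x2 y1 : (\int[m2]_y2 (K1 x1 y1 * K2 x2 y2 * (F x1 x2 - F y1 y2) ^+ 2)%:E
    <= (2 * c2)%:E * A x1 x2 y1 + 2%:E * ((K1 x1 y1)%:E * B y1 x2))%E.
  apply: (@le_trans _ _ (\int[m2]_y2 (2 * K1 x1 y1 * (F x1 x2 - F y1 x2) ^+ 2 * K2 x2 y2 +
      2 * K1 x1 y1 * (K2 x2 y2 * (F y1 x2 - F y1 y2) ^+ 2))%:E)%E).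
    apply: ge0_le_integral => //.
    - by move=> y2 _; rewrite lee_fin mulr_ge0 ?sqr_ge0// mulr_ge0.
    - by measurability.
    - by measurability.
    - move=> y2 _; rewrite lee_fin.
      have -> : F x1 x2 - F y1 y2 = (F x1 x2 - F y1 x2) + (F y1 x2 - F y1 y2) by ring.
      apply: (le_trans (ler_M_sqrD _ _ _)); first by rewrite mulr_ge0.
      by rewrite le_eqVlt; apply/orP; left; apply/eqP; ring.
  under eq_integral do rewrite EFinD EFinM (EFinM _ (K2 x2 _ * _)).
  have k2 : 0 <= 2 * K1 x1 y1 by rewrite mulr_ge0.
  have k3 : 0 <= 2 * K1 x1 y1 * (F x1 x2 - F y1 x2) ^+ 2 by rewrite mulr_ge0 ?sqr_ge0.
  have k4 y2 : 0 <= K2 x2 y2 * (F y1 x2 - F y1 y2) ^+ 2 by rewrite mulr_ge0 ?sqr_ge0.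
  rewrite ge0_integralD//; last 4 first.
  - by move=> y2 _; rewrite mule_ge0// lee_fin.
  - by measurability.
  - by move=> y2 _; rewrite mule_ge0// lee_fin.
  - by measurability.
  rewrite ge0_integralZl//; last 2 first.
  - by measurability.
  - by move=> y2 _; rewrite lee_fin.
  rewrite ge0_integralZl//; last 2 first.
  - by measurability.
  - by move=> y2 _; rewrite lee_fin.
  rewrite (kernel_mass kK2) -/(B _ _) muleA -!EFinM leeD//.
  by rewrite lee_fin le_eqVlt; apply/orP; left; apply/eqP; ring.
pose a (x1 : T1) (x2 : T2) : \bar R := (\int[m1]_y1 A x1 x2 y1)%E.
pose b (x1 : T1) (x2 : T2) : \bar R := (\int[m1]_y1 ((K1 x1 y1)%:E * B y1 x2))%E.
have a0 x1 x2 : (0 <= a x1 x2)%E by apply: integral_ge0.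
have b0 x1 x2 : (0 <= b x1 x2)%E by apply: integral_ge0.
have ma : measurable_fun [set: T1 * T2] (fun p => a p.1 p.2).
  apply: (@measurable_tonelli _ _ _ _ _ m1 (fun p y1 => A p.1 p.2 y1)) => //.
  by rewrite /A; measurability.
have mb : measurable_fun [set: T1 * T2] (fun p => b p.1 p.2).
  apply: (@measurable_tonelli _ _ _ _ _ m1 (fun p y1 => (K1 p.1 y1)%:E * B y1 p.2)%E) => //.
  by measurability.
apply: (@le_trans _ _ (\int[m1]_x1 \int[m2]_x2
    ((2 * c2)%:E * a x1 x2 + 2%:E * b x1 x2))%E).
  apply: ge0_le_integralT => x1.
    apply: integral_ge0 => x2 _; apply: integral_ge0 => y1 _.
    by apply: integral_ge0 => y2 _; rewrite lee_fin mulr_ge0 ?sqr_ge0// mulr_ge0.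
  apply: ge0_le_integralT => x2.
    apply: integral_ge0 => y1 _.
    by apply: integral_ge0 => y2 _; rewrite lee_fin mulr_ge0 ?sqr_ge0// mulr_ge0.
  apply: (@le_trans _ _ (\int[m1]_y1
      ((2 * c2)%:E * A x1 x2 y1 + 2%:E * ((K1 x1 y1)%:E * B y1 x2)))%E).
    apply: ge0_le_integralT => y1; last exact: inner.
    by apply: integral_ge0 => y2 _; rewrite lee_fin mulr_ge0 ?sqr_ge0// mulr_ge0.
  have mA : measurable_fun setT (A x1 x2).
    by rewrite /A; measurability; exact: measurable_section.
  have mKB : measurable_fun setT (fun y1 => (K1 x1 y1)%:E * B y1 x2)%E.
    by measurability.
  have c22 : 0 <= 2 * c2 by rewrite mulr_ge0.
  rewrite ge0_integralD//; last 4 first.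
  - by move=> y1 _; rewrite mule_ge0.
  - by measurability.
  - by move=> y1 _; rewrite mule_ge0.
  - by measurability.
  by rewrite !ge0_integralZl.
have c22 : 0 <= 2 * c2 by rewrite mulr_ge0.
rewrite double_integral; last 2 first.
- by measurability.
- by move=> x1 x2; rewrite adde_ge0// mule_ge0.
rewrite ge0_integralD//; last 4 first.
- by move=> p _; rewrite mule_ge0.
- by measurability.
- by move=> p _; rewrite mule_ge0.
- by measurability.
rewrite !ge0_integralZl//.
rewrite -(double_integral m1 m2 ma a0) -(double_integral m1 m2 mb b0).
rewrite (tonelli_swap m1 m2 ma a0) (tonelli_swap m1 m2 mb b0).
apply: leeD; first exact: lexx.
rewrite EFinM -muleA; apply: lee_wpmul2l; first by rewrite lee_fin.
rewrite (_ : (\int[m1]_x1 energy m2 K2 (F x1) = \int[m2]_x2 \int[m1]_y1 B y1 x2)%E); last first.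
  exact: (tonelli_swap m1 m2 mB B0).
rewrite -ge0_integralZl//; last 2 first.
- apply: measurable_tonelli => //; by measurability.
- by move=> x2 _; exact: integral_ge0.
apply: ge0_le_integralT => x2; first exact: integral_ge0.
(* In the second term only [K1] depends on [x1]: integrating in [x1] first gives [c1], by symmetry
   of [K1]. *)
rewrite (@tonelli_swap _ _ _ _ _ m1 m1 (fun x1 y1 => (K1 x1 y1)%:E * B y1 x2)%E)//; last first.
  by measurability.
rewrite -ge0_integralZl//; last first.
  by measurability.
apply: ge0_le_integralT => y1; first exact: integral_ge0.
rewrite ge0_integralZr//; last 2 first.
- by measurability.
- by move=> x1 _; rewrite lee_fin.
under eq_integral do rewrite (kernel_sym kK1).
by rewrite (kernel_mass kK1).
Qed.
End one_scale.
End tensor_energy.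

(** Convergence is asked where [g] is finite, hence almost everywhere. In use, [g x] is a multiple
    of the squared [L^2] norm of a slice, and the energy of a slice is known to vanish only if that
    norm is finite. *)
Lemma dominated_cvg0 {d : measure_display} {T : measurableType d} {R : realType}
    (mu : {measure set T -> \bar R}) (u : nat -> T -> \bar R) (g : T -> \bar R) :
  (forall n, measurable_fun setT (u n)) -> measurable_fun setT g ->
  (forall n x, 0 <= u n x)%E -> (forall n x, u n x <= g x)%E ->
  (\int[mu]_x g x < +oo)%E ->
  (forall x, (g x < +oo)%E -> u n x @[n --> \oo] --> 0%E) ->
  (\int[mu]_x u n x)%E @[n --> \oo] --> 0%E.
Proof.
move=> mu_ mg u0 ug goo ucvg.
have g0 x : (0 <= g x)%E by apply: le_trans (u0 0 x) (ug 0 x).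
have ig : mu.-integrable setT g.
  apply/integrableP; split => //.
  by under eq_integral do rewrite gee0_abs//.
have gfin := integrable_ae measurableT ig.
have := @dominated_convergence _ _ _ mu setT measurableT u (cst 0%E) g.
case => //.
- by apply: filterS gfin => x /= /(_ I) gx _; apply: ucvg; rewrite -ge0_fin_numE.
- by apply: aeW => x n _; rewrite gee0_abs.
by move=> _ _; rewrite integral0.
Qed.

Lemma lty_pmull {R : realType} (k : R) (x : \bar R) : 0 < k ->
  (k%:E * x < +oo)%E -> (x < +oo)%E.
Proof.
by case: x => [x _ _||]; rewrite ?ltry// => k0; rewrite mulry gtr0_sg// mul1e.
Qed.

(** * Product kernels in dimension [d] and their vanishing energies *)

Section Rd_kernel.
Context {R : realType}.

Definition Rd_kernel (d : nat) (t : R) (x y : Rd R d) : R :=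
  \prod_(i < d) cauchy2 t (tnth x i - tnth y i).

Definition Rd_mass (d : nat) : R := (2 * pi) ^+ d.

Lemma Rd_mass_ge0 d : 0 <= Rd_mass d.
Proof. by rewrite exprn_ge0// mulr_ge0// pi_ge0. Qed.

Lemma Rd_kernelS d t (x0 y0 : measurableTypeR R) (x y : Rd R d) :
  Rd_kernel t (cons_Rd (x0, x)) (cons_Rd (y0, y)) =
  cauchy2_kernel t x0 y0 * Rd_kernel t x y.
Proof.
rewrite /Rd_kernel big_ord_recl !(tnth_nth 0)/=; congr (_ * _).
by apply: eq_bigr => i _; rewrite !(tnth_nth 0).
Qed.

Lemma cons_Rd_surj d (x : Rd R d.+1) : exists x0 y, x = cons_Rd (x0, y).
Proof. by case/tupleP: x => x0 y; exists x0, y; apply/val_inj. Qed.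

Lemma measurable_Rd_kernel d t : 0 < t ->
  measurable_fun [set: Rd R d * Rd R d] (fun p => Rd_kernel t p.1 p.2).
Proof.
move=> t0; apply: measurable_prod => i _.
apply: (measurableT_comp (measurable_cauchy2 t0)); apply: measurable_funB.
  exact: (measurableT_comp (measurable_tnth i) measurable_fst).
exact: (measurableT_comp (measurable_tnth i) measurable_snd).
Qed.

Lemma averaging_Rd_kernel d t : 0 < t ->
  averaging_kernel (lebesgue_Rd d) (Rd_mass d) (Rd_kernel t).
Proof.
move=> t0; have K0 n (x y : Rd R n) : 0 <= Rd_kernel t x y.
  by apply: prodr_ge0 => i _; rewrite cauchy2_ge0// ltW.
split => //.
- exact: measurable_Rd_kernel.
- by move=> x y; apply: eq_bigr => i _; rewrite -cauchy2N opprB.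
elim: d => [|d IH] x.
  under eq_integral do rewrite /Rd_kernel big_ord0.
  rewrite integral_cst//= /Rd_mass expr0 mul1e.
  by rewrite diracT.
have [x0 [xt ->]] := cons_Rd_surj x.
have mKd := @measurable_Rd_kernel d _ t0.
rewrite integral_cons_Rd; last 2 first.
- by apply/measurable_EFinP; apply: measurable_section; exact: measurable_Rd_kernel.
- by move=> y; rewrite lee_fin.
under eq_integral => y0 _.
  under eq_integral => y _ do rewrite Rd_kernelS EFinM.
  rewrite ge0_integralZl ?lee_fin ?cauchy2_ge0 ?(ltW t0)//; last 2 first.
  - by measurability.
  - by move=> y _; rewrite lee_fin.
  rewrite IH; over.
rewrite ge0_integralZr//; last 3 first.
- apply/measurable_EFinP.
  by apply: measurable_section; exact: kernel_measurable (averaging_cauchy2_kernel t0).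
- by move=> y _; rewrite lee_fin cauchy2_ge0// ltW.
- by rewrite lee_fin Rd_mass_ge0.
by rewrite integral_cauchy2// -EFinM /Rd_mass exprS.
Qed.

Lemma energy_Rd_cons d t (f : Rd R d.+1 -> R) : 0 < t -> measurable_fun setT f ->
  energy (lebesgue_Rd d.+1) (Rd_kernel t) f =
  (\int[@lebesgue_measure R]_x0 \int[lebesgue_Rd d]_x
   \int[@lebesgue_measure R]_y0 \int[lebesgue_Rd d]_y
     (cauchy2_kernel t x0 y0 * Rd_kernel t x y *
      (f (cons_Rd (x0, x)) - f (cons_Rd (y0, y))) ^+ 2)%:E)%E.
Proof.
move=> t0 mf; have kK := averaging_Rd_kernel d.+1 t0.
have mK := kernel_measurable kK.
have F0 x y : (0 <= (Rd_kernel t x y * (f x - f y) ^+ 2)%:E)%E.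
  by rewrite lee_fin mulr_ge0 ?sqr_ge0 ?(kernel_ge0 kK).
rewrite /energy integral_cons_Rd; last 2 first.
- apply: measurable_tonelli; [by measurability|exact: F0].
- by move=> x; apply: integral_ge0.
apply: eq_integral => x0 _; apply: eq_integral => x _.
rewrite integral_cons_Rd; last 2 first.
- by measurability.
- by move=> y; exact: F0.
by apply: eq_integral => y0 _; apply: eq_integral => y _; rewrite Rd_kernelS.
Qed.

(** Induction on [d]: [tensor_energy_le] bounds the energy by integrals of energies of slices, each
    of which tends to 0 by the case of the line or by induction, under the domination of
    [energy_le]. *)
Lemma vanishing_Rd_energy (t_ : nat -> R) : (forall n, 0 < t_ n) ->
  t_ n @[n --> \oo] --> 0 ->
  forall d (f : Rd R d -> R), measurable_fun setT f ->
    (\int[lebesgue_Rd d]_x (f x ^+ 2)%:E < +oo)%E ->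
    vanishing_energy (lebesgue_Rd d) (fun n => Rd_kernel (t_ n)) f.
Proof.
move=> t0 tc; elim=> [|d IH] f mf foo.
  rewrite /vanishing_energy (_ : (fun n => _) = fun _ => 0%E); first exact: cvg_cst.
  apply/funext => n; apply: integral0_eq => x _; apply: integral0_eq => y _.
  by rewrite (tuple0 x) (tuple0 y) subrr expr0n mulr0.
pose F (x0 : measurableTypeR R) (x : Rd R d) := f (cons_Rd (x0, x)).
have mF : measurable_fun setT (fun p : measurableTypeR R * Rd R d => F p.1 p.2).
  rewrite (_ : (fun p => _) = f \o @cons_Rd R d); last by apply/funext => -[].
  exact: (measurableT_comp mf (@measurable_cons_Rd R d)).
have F20 x0 x : (0 <= (F x0 x ^+ 2)%:E)%E by rewrite lee_fin sqr_ge0.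
have mF2 : measurable_fun setT (fun p : measurableTypeR R * Rd R d => (F p.1 p.2 ^+ 2)%:E).
  by measurability.
have FooL : (\int[@lebesgue_measure R]_x0 \int[lebesgue_Rd d]_x (F x0 x ^+ 2)%:E < +oo)%E.
  move: foo; rewrite integral_cons_Rd//; first by measurability.
  by move=> x; rewrite lee_fin sqr_ge0.
have FooR : (\int[lebesgue_Rd d]_x \int[@lebesgue_measure R]_x0 (F x0 x ^+ 2)%:E < +oo)%E.
  by rewrite -(tonelli_swap (@lebesgue_measure R) (lebesgue_Rd d) mF2 F20).
have mF2' : measurable_fun setT (fun p : Rd R d * measurableTypeR R => (F p.2 p.1 ^+ 2)%:E).
  by measurability.
have kK1 n := averaging_cauchy2_kernel (t0 n).
have kK2 n := averaging_Rd_kernel d (t0 n).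
have pi20 : 0 <= 2 * pi :> R by rewrite mulr_ge0// pi_ge0.
pose c := Rd_mass d; have c0 : 0 <= c := Rd_mass_ge0 d.
pose u n (x : Rd R d) := energy (@lebesgue_measure R) (cauchy2_kernel (t_ n)) (F ^~ x).
pose v n (x0 : measurableTypeR R) := energy (lebesgue_Rd d) (Rd_kernel (t_ n)) (F x0).
have ucvg : (\int[lebesgue_Rd d]_x u n x)%E @[n --> \oo] --> 0%E.
  apply: (dominated_cvg0 (g := fun x => (4 * (2 * pi))%:E * \int[@lebesgue_measure R]_x0 (F x0 x ^+ 2)%:E)%E).
  - by move=> n; exact: measurable_energy_left (kK1 n) _ mF.
  - apply: measurable_funeM; apply: (@measurable_tonelli _ _ _ _ _ (@lebesgue_measure R) (fun x x0 => (F x0 x ^+ 2)%:E)) => //.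
  - by move=> n x; exact: energy_ge0 (kK1 n) _.
  - by move=> n x; apply: (energy_le (kK1 n)); measurability.
  - rewrite ge0_integralZl//.
    + by rewrite lte_mul_pinfty// lee_fin mulr_ge0.
    + apply: (@measurable_tonelli _ _ _ _ _ (@lebesgue_measure R) (fun x x0 => (F x0 x ^+ 2)%:E)) => //.
    + by move=> x _; exact: integral_ge0.
    + by rewrite lee_fin mulr_ge0.
  - move=> x goo; apply: vanishing_cauchy2_energy => //; first by measurability.
    by apply: lty_pmull goo; rewrite !mulr_gt0// pi_gt0.
have vcvg : (\int[@lebesgue_measure R]_x0 v n x0)%E @[n --> \oo] --> 0%E.
  apply: (dominated_cvg0 (g := fun x0 => (4 * c)%:E * \int[lebesgue_Rd d]_x (F x0 x ^+ 2)%:E)%E).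
  - by move=> n; exact: measurable_energy_right (kK2 n) _ mF.
  - by apply: measurable_funeM; exact: (measurable_tonelli (lebesgue_Rd d) mF2 F20).
  - by move=> n x; exact: energy_ge0 (kK2 n) _.
  - by move=> n x; apply: (energy_le (kK2 n)); measurability.
  - rewrite ge0_integralZl//.
    + by rewrite lte_mul_pinfty// lee_fin mulr_ge0.
    + exact: (measurable_tonelli (lebesgue_Rd d) mF2 F20).
    + by move=> x _; exact: integral_ge0.
    + by rewrite lee_fin mulr_ge0.
  - move=> x goo; apply: IH => //; first by measurability.
    by apply: lty_pmull goo; rewrite mulr_gt0// exprn_gt0// mulr_gt0// pi_gt0.
apply: (@squeeze_cvge _ _ _ _ (cst 0%E) _ (fun n =>
  (2 * c)%:E * \int[lebesgue_Rd d]_x u n x + (2 * (2 * pi))%:E * \int[@lebesgue_measure R]_x0 v n x0)%E).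
- near=> n; rewrite (energy_ge0 (averaging_Rd_kernel d.+1 (t0 n)))/=.
  rewrite energy_Rd_cons//.
  exact: (tensor_energy_le (kK1 n) (kK2 n) pi20 c0 mF).
- exact: cvg_cst.
- rewrite -[X in _ --> X](_ : ((2 * c)%:E * 0 + (2 * (2 * pi))%:E * 0)%E = _); last first.
    by rewrite !mule0 adde0.
  by apply: cvgeD; [by rewrite !mule0| exact: cvgeZl|exact: cvgeZl].
Unshelve. all: by end_near. Qed.
End Rd_kernel.

(** * Fourier representation of the energy *)

Section dominated_fubini.
Context {d1 d2 : measure_display} {T1 : measurableType d1}
  {T2 : measurableType d2} {R : realType}.
Variables (m1 : {sigma_finite_measure set T1 -> \bar R})
  (m2 : {sigma_finite_measure set T2 -> \bar R}).
Variables (F : T1 -> T2 -> R) (a : T1 -> R) (b : T2 -> R).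
Hypothesis mF : measurable_fun [set: T1 * T2] (fun p => F p.1 p.2).
Hypotheses (ia : m1.-integrable setT (EFin \o a)) (ib : m2.-integrable setT (EFin \o b)).
Hypotheses (a0 : forall x, 0 <= a x) (b0 : forall y, 0 <= b y).
Hypothesis Fab : forall x y, `|F x y| <= a x * b y.

(** All oscillating integrands below are bounded by such a tensor product, which is what allows
    Fubini's theorem for signed functions. *)
Lemma dominated_integrable_prod :
  (m1 \x m2)%E.-integrable setT (fun p => (F p.1 p.2)%:E).
Proof.
have /integrableP[ma aoo] := ia; have /integrableP[mb boo] := ib.
apply/(integrable12ltyP m1 m2); first by measurability.
apply: (@le_lt_trans _ _ (\int[m1]_x ((a x)%:E * \int[m2]_y (b y)%:E))%E).
  apply: ge0_le_integralT => x; first exact: integral_ge0.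
  rewrite -ge0_integralZl ?lee_fin//; last by move=> y _; rewrite lee_fin.
  by apply: ge0_le_integralT => y //; rewrite -EFinM lee_fin Fab.
rewrite ge0_integralZr//; last 2 first.
- by move=> x _; rewrite lee_fin.
- by apply: integral_ge0 => y _; rewrite lee_fin.
rewrite lte_mul_pinfty//.
- by apply: integral_ge0 => x _; rewrite lee_fin.
- exact: integrable_fin_num.
- by move: boo; under eq_integral do rewrite /= ger0_norm//.
Qed.

Lemma dominated_integrable_right x : m2.-integrable setT (EFin \o F x).
Proof.
apply: (le_integrable measurableT _ _ (integrableZl measurableT (a x) ib)).
  by apply/measurable_EFinP; exact: measurable_section.
by move=> y _; rewrite /= lee_fin (le_trans (Fab x y))// ler_norm.
Qed.

Let Rintegral_innerE x : (\int[m2]_y F x y)%:E = (\int[m2]_y (F x y)%:E)%E.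
Proof.
rewrite /Rintegral fineK//; apply: integrable_fin_num => //.
exact: dominated_integrable_right.
Qed.

Lemma Rintegral_dominated_prod :
  \int[m1]_x \int[m2]_y F x y = fine (\int[m1 \x m2]_p (F p.1 p.2)%:E)%E.
Proof.
rewrite /Rintegral -(integral12_prod_meas1 dominated_integrable_prod).
by congr fine; apply: eq_integral => x _; rewrite Rintegral_innerE.
Qed.

End dominated_fubini.

Lemma dominated_fubini {d1 d2 : measure_display} {T1 : measurableType d1}
    {T2 : measurableType d2} {R : realType}
    (m1 : {sigma_finite_measure set T1 -> \bar R})
    (m2 : {sigma_finite_measure set T2 -> \bar R})
    (F : T1 -> T2 -> R) (a : T1 -> R) (b : T2 -> R) :
  measurable_fun [set: T1 * T2] (fun p => F p.1 p.2) ->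
  m1.-integrable setT (EFin \o a) -> m2.-integrable setT (EFin \o b) ->
  (forall x, 0 <= a x) -> (forall y, 0 <= b y) ->
  (forall x y, `|F x y| <= a x * b y) ->
  \int[m1]_x \int[m2]_y F x y = \int[m2]_y \int[m1]_x F x y.
Proof.
move=> mF ia ib a0 b0 Fab.
have mF' : measurable_fun [set: T2 * T1] (fun p => F p.2 p.1) by measurability.
have ip := dominated_integrable_prod mF ia ib a0 b0 Fab.
rewrite (Rintegral_dominated_prod mF ia ib a0 b0 Fab).
rewrite -(integral21_prod_meas1 ip) /Rintegral.
congr fine; apply: eq_integral => y _; rewrite fineK//.
apply: integrable_fin_num => //.
apply: (dominated_integrable_right (F := fun y x => F x y) (a := b) (b := a) mF') => //.
by move=> {}y x; rewrite mulrC.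
Qed.

Lemma Rintegral_cons_Rd {R : realType} (d : nat) (f : Rd R d.+1 -> R)
    (a : measurableTypeR R -> R) (b : Rd R d -> R) :
  measurable_fun setT f ->
  (@lebesgue_measure R).-integrable setT (EFin \o a) ->
  (lebesgue_Rd d).-integrable setT (EFin \o b) ->
  (forall x, 0 <= a x) -> (forall y, 0 <= b y) ->
  (forall x0 x, `|f (cons_Rd (x0, x))| <= a x0 * b x) ->
  \int[lebesgue_Rd d.+1]_x f x =
  \int[@lebesgue_measure R]_x0 \int[lebesgue_Rd d]_x f (cons_Rd (x0, x)).
Proof.
move=> mf ia ib a0 b0 fab.
pose F (x0 : measurableTypeR R) (x : Rd R d) := f (cons_Rd (x0, x)).
have FE : (fun p : measurableTypeR R * Rd R d => (F p.1 p.2)%:E) = (EFin \o f) \o @cons_Rd R d.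
  by apply/funext => -[].
have mF : measurable_fun setT (fun p : measurableTypeR R * Rd R d => F p.1 p.2).
  rewrite (_ : (fun p => _) = f \o @cons_Rd R d); last by apply/funext => -[].
  exact: (measurableT_comp mf (@measurable_cons_Rd R d)).
rewrite (Rintegral_dominated_prod mF ia ib a0 b0 fab) /Rintegral; congr fine.
rewrite FE.
have := @integral_pushforward _ _ _ _ R _ (@measurable_cons_Rd R d)
  (@lebesgue_measure R \x lebesgue_Rd d)%E setT (EFin \o f).
rewrite preimage_setT; apply => //; first exact/measurable_EFinP.
by rewrite -FE; exact: dominated_integrable_prod fab.
Qed.

(** * Fourier transform of the product kernels *)

Section Rd_kernel_hat.
Context {R : realType}.

Let mcos : measurable_fun [set: R] (@cos R).
Proof. by apply: continuous_measurable_fun; exact: continuous_cos. Qed.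

Let msin : measurable_fun [set: R] (@sin R).
Proof. by apply: continuous_measurable_fun; exact: continuous_sin. Qed.

Let cos_norm_le1 (x : R) : `|cos x| <= 1.
Proof. by rewrite ler_norml cos_geN1 cos_le1. Qed.

Let sin_norm_le1 (x : R) : `|sin x| <= 1.
Proof. by rewrite ler_norml sin_geN1 sin_le1. Qed.

Lemma measurable_dotRd d :
  measurable_fun [set: Rd R d * Rd R d] (fun p => dotRd p.1 p.2).
Proof.
apply: measurable_sum => i; apply: measurable_funM.
  exact: (measurableT_comp (measurable_tnth i) measurable_fst).
exact: (measurableT_comp (measurable_tnth i) measurable_snd).
Qed.

Definition Rd_kernel_hat (d : nat) (t : R) (xi : Rd R d) : R :=
  \prod_(i < d) cauchy2_hat t (tnth xi i).

Lemma Rd_kernel_hat_ge0 d t (xi : Rd R d) : 0 <= t -> 0 <= Rd_kernel_hat t xi.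
Proof. by move=> t0; apply: prodr_ge0 => i _; exact: cauchy2_hat_ge0. Qed.

Lemma Rd_kernel_hat_le1 d t (xi : Rd R d) : 0 <= t -> Rd_kernel_hat t xi <= 1.
Proof.
move=> t0; apply: prodr_ile1 => i _.
by rewrite cauchy2_hat_ge0// cauchy2_hat_le1.
Qed.

Lemma Rd_kernel_hatS d t (x0 : measurableTypeR R) (x : Rd R d) :
  Rd_kernel_hat t (cons_Rd (x0, x)) = cauchy2_hat t x0 * Rd_kernel_hat t x.
Proof.
rewrite /Rd_kernel_hat big_ord_recl !(tnth_nth 0)/=; congr (_ * _).
by apply: eq_bigr => i _; rewrite !(tnth_nth 0).
Qed.

Lemma dotRdS d (x0 y0 : measurableTypeR R) (x y : Rd R d) :
  dotRd (cons_Rd (x0, x)) (cons_Rd (y0, y)) = x0 * y0 + dotRd x y.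
Proof.
rewrite /dotRd big_ord_recl !(tnth_nth 0)/=; congr (_ + _).
by apply: eq_bigr => i _; rewrite !(tnth_nth 0).
Qed.

Lemma measurable_Rd_kernel_hat d t :
  measurable_fun [set: Rd R d] (@Rd_kernel_hat d t).
Proof.
apply: measurable_prod => i _.
exact: (measurableT_comp (measurable_cauchy2_hat t) (measurable_tnth i)).
Qed.

Lemma integrable_Rd_kernel_hat d t : 0 < t ->
  (lebesgue_Rd d).-integrable setT (EFin \o @Rd_kernel_hat d t).
Proof.
move=> t0; have mW n := @measurable_Rd_kernel_hat n t.
apply/integrableP; split; first by apply/measurable_EFinP; exact: mW.
suff [c <-//] : exists c : R,
    (c%:E = \int[lebesgue_Rd d]_x `|(EFin \o @Rd_kernel_hat d t) x|)%E.
  by rewrite ltry.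
suff [c cE] : exists c : R, (c%:E = \int[lebesgue_Rd d]_x (Rd_kernel_hat t x)%:E)%E.
  exists c; rewrite cE; apply: eq_integral => x _.
  by rewrite /= ger0_norm// Rd_kernel_hat_ge0// ltW.
elim: d => [|d [c IH]].
  exists 1; under eq_integral do rewrite /Rd_kernel_hat big_ord0.
  by rewrite integral_cst//= mul1e diracT.
exists (4 / t * c); rewrite integral_cons_Rd; last 2 first.
- by apply/measurable_EFinP; exact: mW.
- by move=> x; rewrite lee_fin Rd_kernel_hat_ge0// ltW.
have mWd := mW d.
have c0 : 0 <= c.
  rewrite -lee_fin IH; apply: integral_ge0 => x _.
  by rewrite lee_fin Rd_kernel_hat_ge0// ltW.
under eq_integral => y0 _.
  under eq_integral => y _ do rewrite Rd_kernel_hatS EFinM.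
  rewrite ge0_integralZl ?lee_fin ?cauchy2_hat_ge0 ?(ltW t0)//; last 2 first.
  - by measurability.
  - by move=> y _; rewrite lee_fin Rd_kernel_hat_ge0// ltW.
  rewrite -IH; over.
rewrite ge0_integralZr//; last 2 first.
- apply/measurable_EFinP; exact: measurable_cauchy2_hat.
- by move=> y _; rewrite lee_fin cauchy2_hat_ge0// ltW.
by rewrite integral_cauchy2_hat.
Qed.

(** The cosine and sine integrals are computed together, since the addition formulas in the
    inductive step mix them. All sine integrals vanish, so only the product of cosine integrals
    survives. *)
Lemma fourier_Rd_kernel_hat d t (z : Rd R d) : 0 < t ->
  \int[lebesgue_Rd d]_xi (Rd_kernel_hat t xi * cos (dotRd z xi)) =
    \prod_(i < d) cauchy2 t (tnth z i) /\
  \int[lebesgue_Rd d]_xi (Rd_kernel_hat t xi * sin (dotRd z xi)) = 0.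
Proof.
move=> t0; elim: d z => [|d IH] z.
  split; rewrite /Rintegral.
    rewrite (eq_integral (cst 1%:E)); last first.
      by move=> x _; rewrite /Rd_kernel_hat /dotRd !big_ord0 cos0 mul1r.
    by rewrite integral_cst//= indicT mulr1 big_ord0.
  rewrite (eq_integral (cst 0%:E)) ?integral0//.
  by move=> x _; rewrite /Rd_kernel_hat /dotRd !big_ord0 sin0 mulr0.
have [z0 [zt ->]] := cons_Rd_surj z; have [IHc IHs] := IH zt.
have mdot : measurable_fun [set: Rd R d] (dotRd zt).
  exact: measurable_section (@measurable_dotRd d).
have mdotS : measurable_fun [set: Rd R d.+1] (dotRd (cons_Rd (z0, zt))).
  exact: measurable_section (@measurable_dotRd d.+1).
have mW n := @measurable_Rd_kernel_hat n t.
have mWd := mW d. have mWdS := mW d.+1.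
have W0 n (x : Rd R n) : 0 <= Rd_kernel_hat t x by rewrite Rd_kernel_hat_ge0// ltW.
have w0 x : 0 <= cauchy2_hat t x by rewrite cauchy2_hat_ge0// ltW.
have iW := integrable_Rd_kernel_hat d t0.
have iw := integrable_cauchy2_hat t0.
have iWg (g : Rd R d -> R) : measurable_fun setT g -> (forall x, `|g x| <= 1) ->
    (lebesgue_Rd d).-integrable setT (EFin \o (fun x => Rd_kernel_hat t x * g x)).
  move=> mg g1; apply: (le_integrable measurableT _ _ iW); first by apply/measurable_EFinP; measurability.
  by move=> x _; rewrite /= lee_fin normrM ler_piMr.
have iwg (g : measurableTypeR R -> R) : measurable_fun setT g -> (forall x, `|g x| <= 1) ->
    (@lebesgue_measure R).-integrable setT (EFin \o (fun x => cauchy2_hat t x * g x)).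
  move=> mg g1; apply: (le_integrable measurableT _ _ iw).
    by apply/measurable_EFinP/measurable_funM => //; exact: measurable_cauchy2_hat.
  by move=> x _; rewrite /= lee_fin normrM ler_piMr.
have mz0 : measurable_fun setT (fun y0 : measurableTypeR R => z0 * y0) by measurability.
have ic := iWg (fun x => cos (dotRd zt x)) (measurableT_comp mcos mdot) (fun=> cos_norm_le1 _).
have is_ := iWg (fun x => sin (dotRd zt x)) (measurableT_comp msin mdot) (fun=> sin_norm_le1 _).
have ic0 := iwg (fun x => cos (z0 * x)) (measurableT_comp mcos mz0) (fun=> cos_norm_le1 _).
have is0 := iwg (fun x => sin (z0 * x)) (measurableT_comp msin mz0) (fun=> sin_norm_le1 _).
have dom (g : R -> R) : (forall x, `|g x| <= 1) -> forall (x0 : measurableTypeR R) (x : Rd R d),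
    `|Rd_kernel_hat t (cons_Rd (x0, x)) *
      g (dotRd (cons_Rd (z0, zt)) (cons_Rd (x0, x)))| <=
    cauchy2_hat t x0 * Rd_kernel_hat t x.
  move=> g1 x0 x; have wW := mulr_ge0 (w0 x0) (W0 _ x).
  by rewrite Rd_kernel_hatS normrM (ger0_norm wW) ler_piMr.
split.
- rewrite (Rintegral_cons_Rd _ iw iW w0 (W0 _) (dom _ cos_norm_le1)); last first.
    by measurability.
  transitivity (\int[@lebesgue_measure R]_y0 (cauchy2_hat t y0 * cos (z0 * y0) *
      \prod_(i < d) cauchy2 t (tnth zt i))).
    apply: eq_Rintegral => y0 _.
    transitivity (\int[lebesgue_Rd d]_y
      (cauchy2_hat t y0 * cos (z0 * y0) * (Rd_kernel_hat t y * cos (dotRd zt y)) -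
       cauchy2_hat t y0 * sin (z0 * y0) * (Rd_kernel_hat t y * sin (dotRd zt y)))).
      by apply: eq_Rintegral => y _; rewrite Rd_kernel_hatS dotRdS cosD; ring.
    rewrite RintegralB//; last 2 first.
    + exact: (integrableZl measurableT _ ic).
    + exact: (integrableZl measurableT _ is_).
    by rewrite !RintegralZl// IHc IHs mulr0 subr0.
  rewrite RintegralZr// Rintegral_cauchy2_hat_cos// big_ord_recl (tnth_nth 0)/=; congr (_ * _).
  by apply: eq_bigr => i _; rewrite !(tnth_nth 0).
- rewrite (Rintegral_cons_Rd _ iw iW w0 (W0 _) (dom _ sin_norm_le1)); last first.
    by measurability.
  transitivity (\int[@lebesgue_measure R]_y0 (cauchy2_hat t y0 * sin (z0 * y0) *
      \prod_(i < d) cauchy2 t (tnth zt i))).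
    apply: eq_Rintegral => y0 _.
    transitivity (\int[lebesgue_Rd d]_y
      (cauchy2_hat t y0 * sin (z0 * y0) * (Rd_kernel_hat t y * cos (dotRd zt y)) +
       cauchy2_hat t y0 * cos (z0 * y0) * (Rd_kernel_hat t y * sin (dotRd zt y)))).
      by apply: eq_Rintegral => y _; rewrite Rd_kernel_hatS dotRdS sinD; ring.
    rewrite RintegralD//; last 2 first.
    + exact: (integrableZl measurableT _ ic).
    + exact: (integrableZl measurableT _ is_).
    by rewrite !RintegralZl// IHc IHs mulr0 addr0.
  by rewrite RintegralZr// Rintegral_cauchy2_hat_sin// mul0r.
Qed.

End Rd_kernel_hat.

Lemma measurable_Rintegral {d1 d2 : measure_display} {T1 : measurableType d1}
    {T2 : measurableType d2} {R : realType}
    (m2 : {sigma_finite_measure set T2 -> \bar R}) (F : T1 -> T2 -> R) :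
  measurable_fun [set: T1 * T2] (fun p => F p.1 p.2) ->
  measurable_fun setT (fun x => \int[m2]_y F x y).
Proof.
move=> mF; have mEF : measurable_fun setT (fun p : T1 * T2 => (F p.1 p.2)%:E).
  by measurability.
rewrite /Rintegral; apply: (measurableT_comp (fine_measurable measurableT)) => //.
under eq_fun do rewrite integralE.
apply: emeasurable_funB.
- apply: (@measurable_tonelli _ _ _ _ _ m2 (fun x y => ((fun y => (F x y)%:E)^\+ y)%E)) => //.
  rewrite (_ : (fun p => _) = (fun p : T1 * T2 => (F p.1 p.2)%:E)^\+%E).
    exact: measurable_funepos.
  by apply/funext => p; rewrite unlock.
- apply: (@measurable_tonelli _ _ _ _ _ m2 (fun x y => ((fun y => (F x y)%:E)^\- y)%E)) => //.
  rewrite (_ : (fun p => _) = (fun p : T1 * T2 => (F p.1 p.2)%:E)^\-%E).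
    exact: measurable_funeneg.
  by apply/funext => p; rewrite unlock.
Qed.

Lemma integrable_norm_mul {d : measure_display} {T : measurableType d} {R : realType}
    (mu : {measure set T -> \bar R}) (f g : T -> R) :
  mu.-integrable setT (EFin \o f) -> measurable_fun setT g ->
  (forall x, `|g x| <= 1) -> mu.-integrable setT (EFin \o (fun x => g x * f x)).
Proof.
move=> if_ mg g1; apply: (le_integrable measurableT _ _ if_).
  have /integrableP[/measurable_EFinP mf _] := if_.
  by apply/measurable_EFinP; measurability.
by move=> x _; rewrite /= lee_fin normrM ler_piMl.
Qed.

(** * Energy of an integrable function in terms of its transform *)

Section fourier_identity.
Context {R : realType} {d : nat}.
Local Notation mu := (lebesgue_Rd d).
Implicit Types (t : R) (x y xi : Rd R d).

Let mcos : measurable_fun [set: R] (@cos R).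
Proof. by apply: continuous_measurable_fun; exact: continuous_cos. Qed.

Let msin : measurable_fun [set: R] (@sin R).
Proof. by apply: continuous_measurable_fun; exact: continuous_sin. Qed.

Let cos_norm_le1 (x : R) : `|cos x| <= 1.
Proof. by rewrite ler_norml cos_geN1 cos_le1. Qed.

Let sin_norm_le1 (x : R) : `|sin x| <= 1.
Proof. by rewrite ler_norml sin_geN1 sin_le1. Qed.

Let mdot := @measurable_dotRd R d.

Lemma Rd_kernel_le t x y : 0 < t -> Rd_kernel t x y <= (4 / t) ^+ d.
Proof.
move=> t0; apply: (@le_trans _ _ (\prod_(i < d) (4 / t))).
  apply: ler_prod => i _; rewrite cauchy2_ge0 ?(ltW t0)//=.
  set z := _ - _.
  rewrite /cauchy2 ler_pdivrMr; last by rewrite exprn_gt0// ltr_pwDl ?sqr_ge0// exprn_gt0.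
  have -> : 4 * t ^+ 3 = 4 / t * (t ^+ 2) ^+ 2 by field; rewrite gt_eqF.
  rewrite ler_wpM2l ?divr_ge0 ?(ltW t0)// ler_sqr ?nnegrE ?addr_ge0 ?sqr_ge0//.
  by rewrite lerDl sqr_ge0.
by rewrite prodr_const card_ord.
Qed.

Lemma Rd_kernel_fourier t x y : 0 < t ->
  \int[mu]_xi (Rd_kernel_hat t xi * cos (dotRd x xi - dotRd y xi)) = Rd_kernel t x y.
Proof.
move=> t0; transitivity (\prod_(i < d) cauchy2 t (tnth (subRd x y) i)); last first.
  by apply: eq_bigr => i _; rewrite tnth_mktuple.
have [<- _] := fourier_Rd_kernel_hat (subRd x y) t0.
apply: eq_Rintegral => xi _; congr (_ * cos _).
rewrite /dotRd -sumrB; apply: eq_bigr => i _; rewrite tnth_mktuple; ring.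
Qed.

Variable f : Rd R d -> R.
Hypothesis if1 : mu.-integrable setT (EFin \o f).

Let mf : measurable_fun setT f.
Proof. by have /integrableP[/measurable_EFinP] := if1. Qed.

(** The squared modulus of [fourierL1 f xi], kept real. *)
Definition fourier_sqr xi : R :=
  (\int[mu]_x (cos (dotRd x xi) * f x)) ^+ 2 + (\int[mu]_x (sin (dotRd x xi) * f x)) ^+ 2.

Let C xi := \int[mu]_x (cos (dotRd x xi) * f x).
Let S xi := \int[mu]_x (sin (dotRd x xi) * f x).
Let M := \int[mu]_x `|f x|.

Let mC : measurable_fun setT C.
Proof.
by apply: (measurable_Rintegral mu (F := fun xi x => cos (dotRd x xi) * f x)); measurability.
Qed.

Let mS : measurable_fun setT S.
Proof.
by apply: (measurable_Rintegral mu (F := fun xi x => sin (dotRd x xi) * f x)); measurability.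
Qed.

Lemma measurable_fourier_sqr : measurable_fun setT fourier_sqr.
Proof. by rewrite /fourier_sqr; measurability. Qed.

Let bounded_transform (g : Rd R d -> R) : measurable_fun setT g ->
  (forall x, `|g x| <= 1) -> `|\int[mu]_x (g x * f x)| <= M.
Proof.
move=> mg g1; have ig := integrable_norm_mul if1 mg g1.
apply: (le_trans (le_normr_Rintegral measurableT ig)).
apply: le_Rintegral => //.
- exact: integrable_norm ig.
- exact: integrable_norm if1.
- by move=> x _; rewrite normrM ler_piMl.
Qed.

Let mdotr xi : measurable_fun setT (fun x => dotRd x xi).
Proof. by measurability. Qed.

Let icos xi : mu.-integrable setT (EFin \o (fun x => cos (dotRd x xi) * f x)).
Proof. by apply: (integrable_norm_mul if1 (g := fun x => cos (dotRd x xi))) => //; measurability. Qed.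

Let isin xi : mu.-integrable setT (EFin \o (fun x => sin (dotRd x xi) * f x)).
Proof. by apply: (integrable_norm_mul if1 (g := fun x => sin (dotRd x xi))) => //; measurability. Qed.

(** The real part of [exp(i x.xi)] times the transform of [f] at [xi]. Integrating it against [f] in
    [x] gives [fourier_sqr xi], which is thereby a double integral of [cos((x - y).xi) f x f y]. *)
Let D x xi := \int[mu]_y (cos (dotRd x xi - dotRd y xi) * f y).

Let DE x xi : D x xi = cos (dotRd x xi) * C xi + sin (dotRd x xi) * S xi.
Proof.
rewrite /D /C /S -!RintegralZl// -RintegralD//.
- by apply: eq_Rintegral => y _; rewrite cosB; ring.
- exact: (integrableZl measurableT _ (icos xi)).
- exact: (integrableZl measurableT _ (isin xi)).
Qed.

Let mD : measurable_fun [set: Rd R d * Rd R d] (fun p => D p.1 p.2).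
Proof.
rewrite (_ : (fun p => _) = (fun p : Rd R d * Rd R d =>
    cos (dotRd p.1 p.2) * C p.2 + sin (dotRd p.1 p.2) * S p.2)).
  by measurability.
by apply/funext => p; exact: DE.
Qed.

Let D_le x xi : `|D x xi| <= M.
Proof.
by apply: (bounded_transform (g := fun y => cos (dotRd x xi - dotRd y xi))) => //; measurability.
Qed.

Let fourier_sqrE xi : fourier_sqr xi = \int[mu]_x (D x xi * f x).
Proof.
transitivity (\int[mu]_x (C xi * (cos (dotRd x xi) * f x) + S xi * (sin (dotRd x xi) * f x))).
  rewrite RintegralD//; [by rewrite !RintegralZl// -/(C xi) -/(S xi) -!expr2| |].
  - exact: (integrableZl measurableT _ (icos xi)).
  - exact: (integrableZl measurableT _ (isin xi)).
by apply: eq_Rintegral => x _; rewrite DE; ring.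
Qed.

Lemma fourier_sqr_le xi : fourier_sqr xi <= M * M.
Proof.
rewrite fourier_sqrE; apply: (le_trans (ler_norm _)).
have ig : mu.-integrable setT (EFin \o (fun x => D x xi * f x)).
  apply: (le_integrable measurableT _ _ (integrableZl measurableT M if1)).
    by apply/measurable_EFinP; measurability.
  move=> x _; rewrite /= lee_fin !normrM ler_wpM2r// (le_trans (D_le _ _))//.
  exact: ler_norm.
apply: (le_trans (le_normr_Rintegral measurableT ig)).
rewrite -RintegralZl//; last exact: integrable_norm if1.
apply: le_Rintegral => //.
- exact: integrable_norm ig.
- exact: (integrableZl measurableT _ (integrable_norm if1)).
- by move=> x _; rewrite normrM ler_wpM2r.
Qed.

Lemma fourier_sqr_ge0 xi : 0 <= fourier_sqr xi.
Proof. by rewrite addr_ge0 ?sqr_ge0. Qed.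

Lemma integrable_kernel_hat_fourier_sqr t : 0 < t ->
  mu.-integrable setT (EFin \o (fun xi => Rd_kernel_hat t xi * fourier_sqr xi)).
Proof.
move=> t0; have mW := @measurable_Rd_kernel_hat R d t; have mfs := measurable_fourier_sqr.
apply: (le_integrable measurableT _ _ (integrableZl measurableT (M * M) (integrable_Rd_kernel_hat d t0))).
  by apply/measurable_EFinP; measurability.
move=> xi _; rewrite /= lee_fin !normrM [leRHS]mulrC ler_wpM2l//.
rewrite ger0_norm ?fourier_sqr_ge0// (le_trans (fourier_sqr_le xi))// -normrM.
exact: ler_norm.
Qed.

(** Two uses of Fubini's theorem bring the integral in [xi] inside, where [Rd_kernel_fourier]
    evaluates it. The factor [Rd_kernel_hat t] supplies the integrability in [xi]. *)
Lemma Rintegral_kernel_hat_fourier_sqr t : 0 < t ->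
  \int[mu]_xi (Rd_kernel_hat t xi * fourier_sqr xi) =
  \int[mu]_x \int[mu]_y (Rd_kernel t x y * f x * f y).
Proof.
move=> t0; have mW := @measurable_Rd_kernel_hat R d t.
have iW := integrable_Rd_kernel_hat d t0.
have W0 xi : 0 <= Rd_kernel_hat t xi by rewrite Rd_kernel_hat_ge0// ltW.
have M0 : 0 <= M by exact: Rintegral_ge0.
have iaf := integrable_norm if1.
transitivity (\int[mu]_xi \int[mu]_x (Rd_kernel_hat t xi * (D x xi * f x))).
  apply: eq_Rintegral => xi _; rewrite fourier_sqrE RintegralZl//.
  apply: (le_integrable measurableT _ _ (integrableZl measurableT M if1)).
    by apply/measurable_EFinP; measurability.
  move=> x _; rewrite /= lee_fin !normrM ler_wpM2r// (le_trans (D_le _ _))//.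
  exact: ler_norm.
rewrite (dominated_fubini (m1 := mu) (m2 := mu) (a := @Rd_kernel_hat R d t)
  (b := fun x => M * `|f x|)); last 6 first.
- by measurability.
- exact: iW.
- exact: (integrableZl measurableT _ iaf).
- exact: W0.
- by move=> x; rewrite mulr_ge0.
- move=> xi x; rewrite normrM ger0_norm// ler_wpM2l// normrM.
  by rewrite ler_wpM2r.
apply: eq_Rintegral => x _.
transitivity (\int[mu]_xi \int[mu]_y (f x *
    (Rd_kernel_hat t xi * (cos (dotRd x xi - dotRd y xi) * f y)))).
  apply: eq_Rintegral => xi _; rewrite /D.
  have ic : mu.-integrable setT (EFin \o (fun y => cos (dotRd x xi - dotRd y xi) * f y)).
    apply: (integrable_norm_mul if1 (g := fun y => cos (dotRd x xi - dotRd y xi))) => //.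
    by measurability.
  rewrite RintegralZl//; last exact: (integrableZl measurableT _ ic).
  by rewrite RintegralZl//; ring.
rewrite (dominated_fubini (m1 := mu) (m2 := mu)
  (a := fun xi => `|f x| * Rd_kernel_hat t xi) (b := fun y => `|f y|)); last 6 first.
- by measurability.
- exact: (integrableZl measurableT _ iW).
- exact: iaf.
- by move=> xi; rewrite mulr_ge0.
- by [].
- move=> xi y; rewrite !normrM (ger0_norm (W0 xi)) -mulrA.
  by rewrite ler_wpM2l// ler_wpM2l// ler_piMl.
apply: eq_Rintegral => y _.
have iWc : mu.-integrable setT
    (EFin \o (fun xi => Rd_kernel_hat t xi * cos (dotRd x xi - dotRd y xi))).
  apply: (le_integrable measurableT _ _ iW); first by apply/measurable_EFinP; measurability.
  by move=> xi _; rewrite /= lee_fin normrM ler_piMr.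
rewrite -(Rd_kernel_fourier x y t0) -mulrA -RintegralZr//.
by apply: eq_Rintegral => xi _; ring.
Qed.

Hypothesis f2oo : (\int[mu]_x (f x ^+ 2)%:E < +oo)%E.

(** Expanding the square, [K (f x - f y)^2 + 2 K f x f y = K f x^2 + K f y^2], and the right side
    integrates to twice the mass times the squared norm. The identity is stated as a sum so that no
    difference of extended reals occurs. *)
Lemma energy_fourier t : 0 < t ->
  (energy mu (Rd_kernel t) f +
   2%:E * \int[mu]_xi (Rd_kernel_hat t xi * fourier_sqr xi)%:E =
   (2 * Rd_mass d)%:E * \int[mu]_x (f x ^+ 2)%:E)%E.
Proof.
move=> t0; have kK := averaging_Rd_kernel d t0.
have mK := kernel_measurable kK; have K0 := kernel_ge0 kK.
have iaf := integrable_norm if1.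
have mV : measurable_fun setT (fun p : Rd R d * Rd R d =>
    Rd_kernel t p.1 p.2 * f p.1 * f p.2) by measurability.
have Vdom x y : `|Rd_kernel t x y * f x * f y| <= (4 / t) ^+ d * `|f x| * `|f y|.
  rewrite !normrM ger0_norm// ler_wpM2r// ler_wpM2r//; exact: Rd_kernel_le.
have a0 x : 0 <= (4 / t) ^+ d * `|f x|.
  by rewrite mulr_ge0// exprn_ge0// divr_ge0// ltW.
have ia : mu.-integrable setT (EFin \o (fun x => (4 / t) ^+ d * `|f x|)).
  exact: (integrableZl measurableT _ iaf).
have iV := dominated_integrable_prod (F := fun x y => Rd_kernel t x y * f x * f y)
  mV ia iaf a0 (fun y => normr_ge0 (f y)) Vdom.
have VE : (2%:E * \int[mu]_xi (Rd_kernel_hat t xi * fourier_sqr xi)%:E =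
    \int[(mu \x mu)%E]_p (2 * (Rd_kernel t p.1 p.2 * f p.1 * f p.2))%:E)%E.
  under [RHS]eq_integral do rewrite EFinM.
  rewrite integralZl//; congr (_ * _)%E.
  rewrite -[LHS]fineK; last exact: integrable_fin_num (integrable_kernel_hat_fourier_sqr t0).
  rewrite -[RHS]fineK; last exact: integrable_fin_num iV.
  congr EFin; rewrite -/(Rintegral _ _ _) Rintegral_kernel_hat_fourier_sqr//.
  exact: (Rintegral_dominated_prod (F := fun x y => Rd_kernel t x y * f x * f y)
    mV ia iaf a0 (fun y => normr_ge0 (f y)) Vdom).
have sq x y : 0 <= Rd_kernel t x y * (f x - f y) ^+ 2 by rewrite mulr_ge0 ?sqr_ge0.
have sq1 x y : 0 <= Rd_kernel t x y * f x ^+ 2 by rewrite mulr_ge0 ?sqr_ge0.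
have sq2 x y : 0 <= Rd_kernel t x y * f y ^+ 2 by rewrite mulr_ge0 ?sqr_ge0.
have eE : (energy mu (Rd_kernel t) f =
    \int[(mu \x mu)%E]_p (Rd_kernel t p.1 p.2 * (f p.1 - f p.2) ^+ 2)%:E)%E.
  by rewrite /energy double_integral//; [measurability].
have rE : (\int[(mu \x mu)%E]_p (Rd_kernel t p.1 p.2 * f p.1 ^+ 2 +
    Rd_kernel t p.1 p.2 * f p.2 ^+ 2)%:E = (2 * Rd_mass d)%:E * \int[mu]_x (f x ^+ 2)%:E)%E.
  under eq_integral do rewrite EFinD.
  rewrite ge0_integralD//; [|by move=> p _; rewrite lee_fin|by measurability
    |by move=> p _; rewrite lee_fin|by measurability].
  rewrite -(double_integral mu mu (F := fun x y => (Rd_kernel t x y * f x ^+ 2)%:E))//; last by measurability.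
  rewrite -(double_integral mu mu (F := fun x y => (Rd_kernel t x y * f y ^+ 2)%:E))//; last by measurability.
  rewrite (integral_kernel_right kK)// (integral_kernel_left kK)//.
  rewrite -ge0_muleDl ?lee_fin ?Rd_mass_ge0// -EFinD; congr (_%:E * _)%E; ring.
rewrite VE eE -rE -integralD//.
- by apply: eq_integral => p _; rewrite -EFinD; congr EFin; ring.
- apply/integrableP; split; first by measurability.
  under eq_integral do rewrite gee0_abs ?lee_fin//.
  rewrite -eE (le_lt_trans (energy_le kK mf))// lte_mul_pinfty// lee_fin mulr_ge0//.
  exact: Rd_mass_ge0.
- exact: (integrableZl measurableT 2 iV).
Qed.

(* The energy at scale [t] plus twice the integral of [Rd_kernel_hat t * fourier_sqr]
   does not depend on [t]; comparing with scales tending to 0, at which the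
   energy vanishes, stands for Plancherel's theorem. *)
Lemma energy_le_fourier t : 0 < t ->
  (energy mu (Rd_kernel t) f <=
   2%:E * \int[mu]_xi ((1 - Rd_kernel_hat t xi) * fourier_sqr xi)%:E)%E.
Proof.
move=> t0; pose t_ n : R := n.+1%:R^-1.
have t_0 n : 0 < t_ n by rewrite invr_gt0.
have mW := @measurable_Rd_kernel_hat R d; have mfs := measurable_fourier_sqr.
have mWt := mW t.
have I0 u : 0 < u -> (0 <= \int[mu]_xi (Rd_kernel_hat u xi * fourier_sqr xi)%:E)%E.
  move=> u0; apply: integral_ge0 => xi _.
  by rewrite lee_fin mulr_ge0 ?fourier_sqr_ge0// Rd_kernel_hat_ge0// ltW.
set J := (\int[mu]_xi ((1 - _) * _)%:E)%E.
have W1 u xi : 0 < u -> 0 <= (1 - Rd_kernel_hat u xi) * fourier_sqr xi.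
  by move=> u0; rewrite mulr_ge0 ?fourier_sqr_ge0// subr_ge0 Rd_kernel_hat_le1// ltW.
have W0 u xi : 0 < u -> 0 <= Rd_kernel_hat u xi * fourier_sqr xi.
  by move=> u0; rewrite mulr_ge0 ?fourier_sqr_ge0// Rd_kernel_hat_ge0// ltW.
(* Equate the identities at the scales [t] and [t_ n]. As [Rd_kernel_hat (t_ n) <= 1], its integral
   is at most [J + It], and the finite [It] cancels, whether or not [J] is finite. *)
have step n : (energy mu (Rd_kernel t) f <= energy mu (Rd_kernel (t_ n)) f + 2%:E * J)%E.
  set It := (\int[mu]_xi (Rd_kernel_hat t xi * fourier_sqr xi)%:E)%E.
  have Ifin : (2%:E * It)%E \is a fin_num.
    by rewrite fin_numM// integrable_fin_num//; exact: integrable_kernel_hat_fourier_sqr.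
  have Et := energy_fourier t0; have En := energy_fourier (t_0 n).
  rewrite -/It -{}En in Et.
  rewrite -(leeD2rE _ _ Ifin) {}Et -[leRHS]addeA.
  apply: leeD; first exact: lexx.
  rewrite -ge0_muleDr; [|by apply: integral_ge0 => xi _; rewrite lee_fin W1
    |by apply: integral_ge0 => xi _; rewrite lee_fin W0].
  apply: lee_wpmul2l; first by rewrite lee_fin.
  rewrite -ge0_integralD//; [|by move=> xi _; rewrite lee_fin W1|by measurability
    |by move=> xi _; rewrite lee_fin W0|by measurability].
  apply: ge0_le_integralT => xi; first by rewrite lee_fin W0.
  rewrite -EFinD lee_fin -mulrDl subrK ler_wpM2r ?fourier_sqr_ge0//.
  by rewrite Rd_kernel_hat_le1// ltW.
have van : energy mu (Rd_kernel (t_ n)) f @[n --> \oo] --> 0%E.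
  apply: (vanishing_Rd_energy t_0 _ mf f2oo).
  exact: cvg_harmonic.
have e0 n : (0 <= energy mu (Rd_kernel (t_ n)) f)%E.
  exact: energy_ge0 (averaging_Rd_kernel d (t_0 n)) _.
apply/lee_addgt0Pr => e e_gt0.
have [N _ /(_ N (leqnn N))] := (ge0_cvg0P e0).1 van _ e_gt0 => Ne.
by rewrite (le_trans (step N))// addeC leeD.
Qed.
End fourier_identity.

(** * Energies on cubes and Sobolev norm *)

Section cubes.
Context {R : realType}.

Definition in_cube (d : nat) (t : R) (x y : Rd R d) : bool :=
  [forall i : 'I_d, `|tnth x i - tnth y i| < t].

(** The product form suits induction on [d] and comparison with [Rd_kernel]; [cube_indicE] gives
    back the boolean form for geometric arguments. *)
Definition cube_indic (d : nat) (t : R) (x y : Rd R d) : R :=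
  \prod_(i < d) (`|tnth x i - tnth y i| < t)%R%:R.

Lemma cube_indicE d t (x y : Rd R d) : cube_indic t x y = (in_cube t x y)%:R.
Proof.
rewrite /cube_indic /in_cube; case: (boolP [forall i, _]) => [/forallP h|].
  by rewrite big1// => i _; rewrite h.
by case/forallPn => i hi; rewrite (bigD1 i)//= (negbTE hi) mul0r.
Qed.

Lemma cube_indic_ge0 d t (x y : Rd R d) : 0 <= cube_indic t x y.
Proof. by rewrite cube_indicE. Qed.

Lemma cube_indicC d t (x y : Rd R d) : cube_indic t x y = cube_indic t y x.
Proof. by apply: eq_bigr => i _; rewrite distrC. Qed.

Let measurable_dist_lt t :
  measurable_fun [set: measurableTypeR R] (fun z : R => (`|z| < t)%R%:R : R).
Proof.
rewrite (_ : (fun z => _) = \1_(`]- t, t[%classic)).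
  exact: measurable_indic.
by apply/funext => z; rewrite indicE mem_setE in_itv/= ltr_norml.
Qed.

Lemma measurable_cube_indic d t :
  measurable_fun [set: Rd R d * Rd R d] (fun p => cube_indic t p.1 p.2).
Proof.
apply: measurable_prod => i _.
apply: (measurableT_comp (measurable_dist_lt t)); apply: measurable_funB.
  exact: (measurableT_comp (measurable_tnth i) measurable_fst).
exact: (measurableT_comp (measurable_tnth i) measurable_snd).
Qed.

Lemma integral_cube_indic d t (x : Rd R d) : 0 < t ->
  (\int[lebesgue_Rd d]_y (cube_indic t x y)%:E = ((2 * t) ^+ d)%:E)%E.
Proof.
move=> t0; elim: d x => [|d IH] x.
  under eq_integral do rewrite /cube_indic big_ord0.
  by rewrite integral_cst//= mul1e diracT.
have [x0 [xt ->]] := cons_Rd_surj x.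
have mQ n := @measurable_cube_indic n t; have mQd := mQ d.
have QS y0 y : cube_indic t (cons_Rd (x0, xt)) (cons_Rd (y0, y)) =
    (`|x0 - y0| < t)%R%:R * cube_indic t xt y.
  rewrite /cube_indic big_ord_recl !(tnth_nth 0)/=; congr (_ * _).
  by apply: eq_bigr => i _; rewrite !(tnth_nth 0).
rewrite integral_cons_Rd; last 2 first.
- by apply/measurable_EFinP; apply: measurable_section; exact: mQ.
- by move=> y; rewrite lee_fin cube_indic_ge0.
under eq_integral => y0 _.
  under eq_integral => y _ do rewrite QS EFinM.
  rewrite ge0_integralZl ?lee_fin//; last 2 first.
  - by measurability.
  - by move=> y _; rewrite lee_fin cube_indic_ge0.
  rewrite IH; over.
have mI : measurable_fun [set: measurableTypeR R] (fun y0 => (`|x0 - y0| < t)%R%:R : R).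
  by apply: (measurableT_comp (measurable_dist_lt t)); apply: measurable_funB.
rewrite ge0_integralZr//; last 2 first.
- by measurability.
- by rewrite lee_fin exprn_ge0// mulr_ge0// ltW.
rewrite exprS EFinM; congr (_ * _)%E.
transitivity (\int[@lebesgue_measure R]_y0 (\1_(`]x0 - t, x0 + t[%classic) y0)%:E)%E.
  apply: eq_integral => y0 _; rewrite indicE mem_setE in_itv/=; congr (_%:R)%:E.
  by rewrite distrC ltr_distl.
rewrite integral_indic// setIT.
transitivity (@lebesgue_measure R `](x0 - t)%R, (x0 + t)%R[%classic) => //.
by rewrite lebesgue_measure_itv/= lte_fin ltrD2l gtrN// -EFinB; congr EFin; ring.
Qed.

End cubes.

(** * From transforms of truncations to the Sobolev norm *)

Section sobolev_bound.
Context {R : realType}.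

Lemma one_sub_prod_le (I : Type) (r : seq I) (w : I -> R) :
  (forall i, 0 <= w i <= 1) ->
  1 - \prod_(i <- r) w i <= \sum_(i <- r) (1 - w i).
Proof.
move=> w01; elim: r => [|i r IH]; first by rewrite !big_nil subrr.
rewrite !big_cons; have /andP[w0 w1] := w01 i.
have : 0 <= \prod_(j <- r) w j <= 1.
  by rewrite prodr_ge0 ?prodr_ile1// => j _; have /andP[] := w01 j.
by move=> /andP[p0 p1]; nra.
Qed.

(** With [u = t |x|]: if [u > 1], the left side is at most 1. Otherwise [exp(- u) >= 1 - u] bounds
    it by [1 - (1 + u)(1 - u) = u^2], which is at most [u^(2 s)] because [s <= 1]. *)
Lemma one_sub_cauchy2_hat_le (s t x : R) : 0 < s -> s <= 1 -> 0 < t ->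
  1 - cauchy2_hat t x <= (t * `|x|) `^ (2 * s).
Proof.
move=> s0 s1 t0; rewrite /cauchy2_hat; set u := t * `|x|.
have u0 : 0 <= u by rewrite mulr_ge0// ltW.
have [u1|u1] := leP u 1; last first.
  apply: (@le_trans _ _ 1).
    by rewrite lerBlDr lerDl mulr_ge0 ?expR_ge0// addr_ge0.
  rewrite -[leLHS](powRr0 u); apply: ler_powR; first exact: ltW.
  by rewrite mulr_ge0// ltW.
apply: (@le_trans _ _ (u ^+ 2)).
  have := expR_ge1Dx (- u); nra.
have [->|un0] := eqVneq u 0; first by rewrite expr0n/= powR_ge0.
have ugt0 : 0 < u by rewrite lt_neqAle eq_sym un0.
have -> : u ^+ 2 = u `^ (2 * s) * u `^ (2 - 2 * s).
  by rewrite -powRD ?un0 ?implybT// subrKC powR_mulrn.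
have e1 : 1 `^ (2 - 2 * s) = 1 :> R by rewrite powR1.
rewrite ler_piMr ?powR_ge0// -[leRHS]e1.
by apply: ge0_ler_powR; rewrite ?nnegrE//; lra.
Qed.

Lemma normRd_ge0 d (x : Rd R d) : 0 <= normRd x.
Proof. exact: sqrtr_ge0. Qed.

Lemma coord_le_normRd d (x : Rd R d) i : `|tnth x i| <= normRd x.
Proof.
rewrite -sqrtr_sqr /normRd ler_wsqrtr// (bigD1 i)//= lerDl.
by apply: sumr_ge0 => j _; rewrite sqr_ge0.
Qed.

Lemma measurable_normRd d : measurable_fun [set: Rd R d] (@normRd R d).
Proof.
have msqrt : measurable_fun [set: R] (@Num.sqrt R).
  by apply: continuous_measurable_fun; exact: sqrt_continuous.
apply: (measurableT_comp msqrt).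
apply: measurable_sum => i; apply: measurable_funX.
exact: measurable_tnth.
Qed.

Lemma one_sub_Rd_kernel_hat_le d (s t : R) (xi : Rd R d) : 0 < s -> s <= 1 -> 0 < t ->
  1 - Rd_kernel_hat t xi <= d%:R * t `^ (2 * s) * normRd xi `^ (2 * s).
Proof.
move=> s0 s1 t0; rewrite /Rd_kernel_hat.
apply: (le_trans (one_sub_prod_le _ _)).
  by move=> i; rewrite cauchy2_hat_ge0 ?cauchy2_hat_le1// ltW.
rewrite -mulrA -powRM ?normRd_ge0 ?(ltW t0)//.
rewrite -[d in d%:R]card_ord mulr_natl -sumr_const; apply: ler_sum => i _.
apply: (le_trans (one_sub_cauchy2_hat_le _ s0 s1 t0)).
apply: ge0_ler_powR; rewrite ?nnegrE ?mulr_ge0 ?normRd_ge0 ?(ltW t0) ?(ltW s0)//.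
by rewrite ler_wpM2l ?(ltW t0)// coord_le_normRd.
Qed.

Lemma normc_sqr (z : R[i]) : Normc.normc z ^+ 2 = complex.Re z ^+ 2 + complex.Im z ^+ 2.
Proof. by case: z => a b /=; rewrite sqr_sqrtr// addr_ge0 ?sqr_ge0. Qed.

Variable d : nat.
Local Notation mu := (lebesgue_Rd d).
Variable psi : Rd R d -> R.
Hypothesis mpsi : measurable_fun setT psi.
Hypothesis psi2 : (\int[mu]_x (psi x ^+ 2)%:E < +oo)%E.

Definition truncation (n : nat) (x : Rd R d) : R :=
  psi x * \1_[set x | normRd x <= n%:R] x.

Let mball n : measurable [set x : Rd R d | normRd x <= n%:R].
Proof.
rewrite -[X in measurable X]setTI.
rewrite (_ : [set x | _] = @normRd R d @^-1` `]-oo, n%:R]); last first.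
  by apply/seteqP; split => x /=; rewrite in_itv.
exact: measurable_normRd.
Qed.

Lemma measurable_truncation n : measurable_fun setT (truncation n).
Proof. by apply: measurable_funM => //; exact: measurable_indic. Qed.

Lemma truncation_norm_le n x : `|truncation n x| <= `|psi x|.
Proof. by rewrite normrM ler_piMr// indicE; case: (_ \in _); rewrite ?normr1 ?normr0. Qed.

Lemma truncation_sqr_lty n : (\int[mu]_x (truncation n x ^+ 2)%:E < +oo)%E.
Proof.
apply: le_lt_trans psi2; apply: ge0_le_integralT => x; first by rewrite lee_fin sqr_ge0.
rewrite lee_fin -(real_normK (num_real (truncation n x))) -(real_normK (num_real (psi x))).
by rewrite ler_sqr ?nnegrE// truncation_norm_le.
Qed.

Lemma truncation_cvg x : truncation n x @[n --> \oo] --> psi x.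
Proof.
apply: cvg_near_cst; exists (Num.truncn (normRd x)).+1 => // n /= xn.
rewrite /truncation indicE mem_set ?mulr1//=.
by rewrite ltW// (lt_le_trans (truncnS_gt _))// ler_nat.
Qed.

(** On the ball [|psi| <= 1 + psi^2], and the ball lies in a cube of finite volume. The half-side is
    [n.+1] because the cube is open and the ball closed. *)
Lemma integrable_truncation n : mu.-integrable setT (EFin \o truncation n).
Proof.
pose o : Rd R d := [tuple 0 | i < d].
have n10 : 0 < n.+1%:R :> R by [].
have mQ := @measurable_cube_indic R d n.+1%:R.
have mtr := measurable_truncation n.
have iQ : mu.-integrable setT (EFin \o cube_indic n.+1%:R o).
  apply/integrableP; split; first by apply/measurable_EFinP; measurability.
  under eq_integral do rewrite /= ger0_norm ?cube_indic_ge0//.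
  by rewrite integral_cube_indic// ltry.
have i2 : mu.-integrable setT (EFin \o (fun x => psi x ^+ 2)).
  apply/integrableP; split; first by apply/measurable_EFinP; measurability.
  by under eq_integral do rewrite /= ger0_norm ?sqr_ge0//.
apply: (le_integrable measurableT _ _ (integrableD measurableT iQ i2)).
  exact/measurable_EFinP.
move=> x _; rewrite /= lee_fin /truncation indicE normrM.
have [|_] := boolP (x \in _); last by rewrite normr0 mulr0.
rewrite inE/= => xn; rewrite normr1 mulr1.
rewrite cube_indicE (_ : in_cube _ _ _ = true); last first.
  apply/forallP => i; rewrite tnth_mktuple sub0r normrN.
  by rewrite (le_lt_trans (coord_le_normRd _ _))// (le_lt_trans xn)// ltr_nat.
rewrite [leRHS]ger0_norm ?addr_ge0 ?sqr_ge0// -(real_normK (num_real (psi x))).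
rewrite (_ : true%:R = 1 :> R)//.
by have := normr_ge0 (psi x); have := sqr_ge0 (`|psi x| - 1); nra.
Qed.

Variable h : Rd R d -> R[i].
Hypothesis psih : is_fourierL2 psi h.

(** The constant is [8 = 2 * 2 * 2]: one factor for splitting [psi] into a truncation and a
    remainder, one from [energy_le_fourier], one for splitting the transform of the truncation
    around [h]. Both remainders tend to 0, by [energy_le] and by the definition of [h]. *)
Lemma energy_le_fourierL2 t : 0 < t ->
  (energy mu (Rd_kernel t) psi <=
   8%:E * \int[mu]_xi ((1 - Rd_kernel_hat t xi) * Normc.normc (h xi) ^+ 2)%:E)%E.
Proof.
move=> t0; have [mRe mIm hcvg] := psih.
have kK := averaging_Rd_kernel d t0.
pose H (xi : Rd R d) : R := Normc.normc (h xi) ^+ 2.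
pose E (n : nat) (xi : Rd R d) : R := Normc.normc (h xi - fourierL1 (truncation n) xi) ^+ 2.
have mH : measurable_fun setT H.
  rewrite (_ : H = fun xi => complex.Re (h xi) ^+ 2 + complex.Im (h xi) ^+ 2).
    by measurability.
  by apply/funext => xi; exact: normc_sqr.
have mW := @measurable_Rd_kernel_hat R d t.
pose w (xi : Rd R d) : R := 1 - Rd_kernel_hat t xi.
have w0 xi : 0 <= w xi by rewrite subr_ge0 Rd_kernel_hat_le1// ltW.
have w1 xi : w xi <= 1 by rewrite lerBlDr lerDl Rd_kernel_hat_ge0// ltW.
have mw : measurable_fun setT w by rewrite /w; measurability.
have H0 xi : 0 <= H xi by exact: sqr_ge0.
have E0 n xi : 0 <= E n xi by exact: sqr_ge0.
have EE n xi : E n xi =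
    (complex.Re (h xi) - \int[mu]_x (cos (dotRd x xi) * truncation n x)) ^+ 2 +
    (complex.Im (h xi) + \int[mu]_x (sin (dotRd x xi) * truncation n x)) ^+ 2.
  rewrite /E normc_sqr /fourierL1; case: (h xi) => a b /=.
  by rewrite opprK.
have mdot := @measurable_dotRd R d.
have mcos : measurable_fun [set: R] (@cos R).
  by apply: continuous_measurable_fun; exact: continuous_cos.
have msin : measurable_fun [set: R] (@sin R).
  by apply: continuous_measurable_fun; exact: continuous_sin.
have mE n : measurable_fun setT (E n).
  have mtr := measurable_truncation n.
  rewrite (_ : E n = fun xi =>
    (complex.Re (h xi) - \int[mu]_x (cos (dotRd x xi) * truncation n x)) ^+ 2 +
    (complex.Im (h xi) + \int[mu]_x (sin (dotRd x xi) * truncation n x)) ^+ 2); last exact/funext.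
  have mC : measurable_fun setT (fun xi => \int[mu]_x (cos (dotRd x xi) * truncation n x)).
    by apply: (measurable_Rintegral mu (F := fun xi x => cos (dotRd x xi) * truncation n x)); measurability.
  have mS : measurable_fun setT (fun xi => \int[mu]_x (sin (dotRd x xi) * truncation n x)).
    by apply: (measurable_Rintegral mu (F := fun xi x => sin (dotRd x xi) * truncation n x)); measurability.
  by measurability.
have fs_le n xi : fourier_sqr (truncation n) xi <= 2 * H xi + 2 * E n xi.
  rewrite EE /H normc_sqr /fourier_sqr.
  set a := complex.Re _; set b := complex.Im _; set u := Rintegral _ _ _; set v := Rintegral _ _ _.
  by have := sqr_ge0 (2 * a - u); have := sqr_ge0 (2 * b + v); nra.
have c0 : 0 <= Rd_mass d :> R := Rd_mass_ge0 d.
set J := (\int[mu]_xi ((1 - _) * _)%:E)%E.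
have bound n : (energy mu (Rd_kernel t) psi <= 8%:E * J + (8%:E * \int[mu]_xi (E n xi)%:E +
    (8 * Rd_mass d)%:E * \int[mu]_x ((psi x - truncation n x) ^+ 2)%:E))%E.
  have mtr := measurable_truncation n.
  have -> : energy mu (Rd_kernel t) psi =
      energy mu (Rd_kernel t) (fun x => (truncation n x + (psi x - truncation n x))%R).
    by congr energy; apply/funext => x; rewrite addrC subrK.
  apply: (le_trans (energyD kK mtr (measurable_funB mpsi mtr))).
  rewrite addeA; apply: leeD; last first.
    apply: (@le_trans _ _ (2%:E * ((4 * Rd_mass d)%:E *
        \int[mu]_x ((psi x - truncation n x) ^+ 2)%:E))%E).
      apply: lee_wpmul2l; first by rewrite lee_fin.
      exact: (energy_le kK (measurable_funB mpsi mtr)).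
    by rewrite muleA -EFinM mulrA -natrM.
  have h1 := energy_le_fourier (integrable_truncation n) (truncation_sqr_lty n) t0.
  apply: (@le_trans _ _ (2%:E * (2%:E * \int[mu]_xi (2%:E * (w xi * H xi)%:E + 2%:E * (E n xi)%:E)))%E).
    apply: lee_wpmul2l; first by rewrite lee_fin.
    apply: (le_trans h1); apply: lee_wpmul2l; first by rewrite lee_fin.
    apply: ge0_le_integralT => xi.
      by rewrite lee_fin mulr_ge0 ?fourier_sqr_ge0//; exact: w0.
    rewrite -!EFinM -EFinD lee_fin -/(w xi) (le_trans (ler_wpM2l (w0 xi) (fs_le n xi)))//.
    have := ler_piMl (E0 n xi) (w1 xi); nra.
  have wH0 xi : 0 <= w xi * H xi by exact: mulr_ge0.
  rewrite ge0_integralD//; last 4 first.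
  - by move=> xi _; rewrite mule_ge0// lee_fin.
  - by measurability.
  - by move=> xi _; rewrite mule_ge0// lee_fin.
  - by measurability.
  rewrite !ge0_integralZl//; last 4 first.
  - by measurability.
  - by move=> xi _; rewrite lee_fin.
  - by measurability.
  - by move=> xi _; rewrite lee_fin.
  have I1 : (0 <= \int[mu]_xi (w xi * H xi)%:E)%E.
    by apply: integral_ge0 => xi _; rewrite lee_fin.
  have I2 : (0 <= \int[mu]_xi (E n xi)%:E)%E.
    by apply: integral_ge0 => xi _; rewrite lee_fin.
  have -> (X Y : \bar R) : (0 <= X -> 0 <= Y ->
      2%:E * (2%:E * (2%:E * X + 2%:E * Y)) = 8%:E * X + 8%:E * Y)%E.
    by move=> X0 Y0; rewrite !ge0_muleDr ?mule_ge0// !muleA -!EFinM -!natrM.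
  - exact: lexx.
  - exact: I1.
  - exact: I2.
apply/lee_addgt0Pr => e e0.
have e16 : 0 < e / 16 by rewrite divr_gt0.
have m1 : 0 < Rd_mass d + 1 :> R by exact: ltr_wpDl c0 ltr01.
have em : 0 < e / (16 * (Rd_mass d + 1)) by rewrite divr_gt0// mulr_gt0.
have I1 n : (0 <= \int[mu]_xi (E n xi)%:E)%E by apply: integral_ge0 => xi _; rewrite lee_fin.
have I2 n : (0 <= \int[mu]_x ((psi x - truncation n x) ^+ 2)%:E)%E.
  by apply: integral_ge0 => xi _; rewrite lee_fin sqr_ge0.
have tc := cvg_L2_dominated mpsi measurable_truncation truncation_cvg truncation_norm_le psi2.
have n1 := (ge0_cvg0P I1).1 hcvg _ e16.
have n2 := (ge0_cvg0P I2).1 tc _ em.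
have [n [N1 N2]] : exists n, (\int[mu]_xi (E n xi)%:E <= (e / 16)%:E)%E /\
    (\int[mu]_x ((psi x - truncation n x) ^+ 2)%:E <= (e / (16 * (Rd_mass d + 1)))%:E)%E.
  have [N _ /(_ N (leqnn N)) []] := filterI n1 n2.
  by exists N.
apply: (le_trans (bound n)); apply: leeD; first exact: lexx.
apply: (@le_trans _ _ (8%:E * (e / 16)%:E +
    (8 * Rd_mass d)%:E * (e / (16 * (Rd_mass d + 1)))%:E)%E).
  by apply: leeD; apply: lee_wpmul2l; rewrite ?lee_fin ?mulr_ge0.
rewrite -!EFinM -EFinD lee_fin.
have -> : 8 * (e / 16) + 8 * Rd_mass d * (e / (16 * (Rd_mass d + 1))) =
    e / 2 * (1 + Rd_mass d / (Rd_mass d + 1)).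
  by field; rewrite gt_eqF.
have : Rd_mass d / (Rd_mass d + 1) <= 1 :> R by rewrite ler_pdivrMr// mul1r lerDl.
by nra.
Qed.
End sobolev_bound.

Section sobolev_cube.
Context {R : realType} {d : nat}.
Local Notation mu := (lebesgue_Rd d).
Variables (psi : Rd R d -> R) (s : R).
Hypothesis mpsi : measurable_fun setT psi.
Hypothesis psi2 : (\int[mu]_x (psi x ^+ 2)%:E < +oo)%E.
Hypotheses (s0 : 0 < s) (s1 : s <= 1).

Lemma energy_le_sobolev t : 0 < t ->
  (energy mu (Rd_kernel t) psi <=
   (8 * d.+1%:R * t `^ (2 * s))%:E * sobolev_norm s psi ^+ 2)%E.
Proof.
move=> t0; have kK := averaging_Rd_kernel d t0.
(* With [d.+1] in place of [d], [k] can be inverted also in dimension 0. *)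
set k := 8 * d.+1%:R * t `^ (2 * s).
have k0 : 0 < k by rewrite !mulr_gt0 ?powR_gt0.
have e0 : (0 <= energy mu (Rd_kernel t) psi)%E := energy_ge0 kK _.
have efin : energy mu (Rd_kernel t) psi \is a fin_num.
  rewrite ge0_fin_numE// (le_lt_trans (energy_le kK mpsi))// lte_mul_pinfty//.
  by rewrite lee_fin mulr_ge0// Rd_mass_ge0.
set e := energy _ _ _ in e0 efin *.
have ek0 : (0 <= k^-1%:E * e)%E by rewrite mule_ge0// lee_fin invr_ge0 ltW.
(* The norm is an infimum of square roots, so the bound is put in the form of a lower bound and
   checked for each transform [h]. *)
suff : (sqrte (k^-1%:E * e) <= sobolev_norm s psi)%E.
  move=> h; have : (k^-1%:E * e <= sobolev_norm s psi ^+ 2)%E.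
    rewrite -(sqr_sqrte ek0) lee_sqr//.
    - by rewrite sqrte_ge0.
    - by rewrite (le_trans _ h)// sqrte_ge0.
  move=> h2; have -> : e = (k%:E * (k^-1%:E * e))%E.
    by rewrite muleA -EFinM mulfV ?gt_eqF// mul1e.
  by apply: lee_wpmul2l => //; rewrite lee_fin ltW.
apply: le_ereal_inf_tmp => _ [h psih <-].
set I := (\int[mu]_xi _)%E.
have I0 : (0 <= I)%E.
  by apply: integral_ge0 => xi _; rewrite lee_fin mulr_ge0 ?sqr_ge0// powR_ge0.
rewrite poweR12_sqrt// lee_sqrt//.
rewrite -(lee_pmul2l (x := k%:E)) ?lte_fin// muleA -EFinM mulfV ?gt_eqF// mul1e.
apply: (le_trans (energy_le_fourierL2 mpsi psi2 psih t0)).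
apply: (@le_trans _ _ (8%:E * \int[mu]_xi ((d.+1%:R * t `^ (2 * s))%:E *
    (Normc.normc (h xi) ^+ 2 * normRd xi `^ (2 * s))%:E)))%E.
  apply: lee_wpmul2l; first by rewrite lee_fin.
  apply: ge0_le_integralT => xi.
    by rewrite lee_fin mulr_ge0 ?sqr_ge0// subr_ge0 Rd_kernel_hat_le1// ltW.
  rewrite -EFinM lee_fin [leRHS]mulrCA [leLHS]mulrC ler_wpM2l ?sqr_ge0//.
  apply: (le_trans (one_sub_Rd_kernel_hat_le xi s0 s1 t0)).
  rewrite ler_wpM2r ?powR_ge0// ler_wpM2r ?powR_ge0//.
  by rewrite ler_nat.
have [mRe mIm _] := psih; have mnorm := @measurable_normRd R d.
rewrite ge0_integralZl//.
- by rewrite muleA -EFinM mulrA.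
- apply/measurable_EFinP; apply: measurable_funM; last first.
    by apply: (measurableT_comp (measurable_powR _)).
  rewrite (_ : (fun xi => _) = fun xi => complex.Re (h xi) ^+ 2 + complex.Im (h xi) ^+ 2).
    by measurability.
  by apply/funext => xi; exact: normc_sqr.
- by move=> xi _; rewrite lee_fin mulr_ge0 ?sqr_ge0// powR_ge0.
- by rewrite lee_fin mulr_ge0// powR_ge0.
Qed.

(** If [|z| < 2 t] then [t^2 + z^2 <= 5 t^2], hence [cauchy2 t z >= 4 / (25 t)]. *)
Lemma cube_indic_le_kernel t (x y : Rd R d) : 0 < t ->
  cube_indic (2 * t) x y <= (25 * t / 4) ^+ d * Rd_kernel t x y.
Proof.
move=> t0; rewrite /cube_indic /Rd_kernel.
have -> : (25 * t / 4) ^+ d = \prod_(i < d) (25 * t / 4) by rewrite prodr_const card_ord.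
rewrite -big_split/=; apply: ler_prod => i _; rewrite ler0n/=.
set z := _ - _; have c0 : 0 <= 25 * t / 4 by rewrite divr_ge0// mulr_ge0// ltW.
have [zt|_] := boolP (`|z| < 2 * t); last by rewrite mulr_ge0// cauchy2_ge0// ltW.
rewrite /= mulr1n.
have z2 : z ^+ 2 <= 4 * t ^+ 2.
  rewrite -(real_normK (num_real z)); have := normr_ge0 z; nra.
rewrite /cauchy2 mulrA ler_pdivlMr ?exprn_gt0 ?ltr_pwDl ?sqr_ge0 ?exprn_gt0// mul1r.
have -> : 25 * t / 4 * (4 * t ^+ 3) = (5 * t ^+ 2) ^+ 2 by field.
by rewrite ler_sqr ?nnegrE ?addr_ge0 ?sqr_ge0 ?mulr_ge0 ?sqr_ge0//; lra.
Qed.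

Lemma cube_energy_le_sobolev t : 0 < t ->
  (energy mu (cube_indic (2 * t)) psi <=
   ((25 * t / 4) ^+ d * (8 * d.+1%:R * t `^ (2 * s)))%:E * sobolev_norm s psi ^+ 2)%E.
Proof.
move=> t0; have kK := averaging_Rd_kernel d t0.
have mK := kernel_measurable kK.
have c0 : 0 <= (25 * t / 4) ^+ d by rewrite exprn_ge0// divr_ge0// mulr_ge0// ltW.
have K0 x y : (0 <= (Rd_kernel t x y * (psi x - psi y) ^+ 2)%:E)%E.
  by rewrite lee_fin mulr_ge0 ?sqr_ge0// (kernel_ge0 kK).
apply: (@le_trans _ _ (((25 * t / 4) ^+ d)%:E * energy mu (Rd_kernel t) psi)%E); last first.
  by rewrite EFinM -muleA lee_wpmul2l ?lee_fin// energy_le_sobolev.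
rewrite /energy -ge0_integralZl ?lee_fin//; last 2 first.
- by apply: measurable_tonelli => //; measurability.
- by move=> x _; apply: integral_ge0.
apply: ge0_le_integralT => x.
  by apply: integral_ge0 => y _; rewrite lee_fin mulr_ge0 ?sqr_ge0// cube_indic_ge0.
rewrite -ge0_integralZl ?lee_fin//; last by measurability.
apply: ge0_le_integralT => y.
  by rewrite lee_fin mulr_ge0 ?sqr_ge0// cube_indic_ge0.
by rewrite -EFinM lee_fin [leRHS]mulrA ler_wpM2r ?sqr_ge0// cube_indic_le_kernel.
Qed.

End sobolev_cube.

(** * Dyadic decomposition of the weak form *)

(** Summing the recursion, the partial sums satisfy [S_(n+1) <= m + rho S_n + c / (1 - theta)]; the
    bound is the fixed point of this affine map. *)
Lemma sum_recursion_le {R : realType} (a : nat -> R) (rho theta c m : R) (n : nat) :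
  0 <= rho -> rho < 1 -> 0 <= theta -> theta < 1 -> 0 <= c -> 0 <= m ->
  a 0%N <= m -> (forall k, a k.+1 <= rho * a k + c * theta ^+ k) ->
  \sum_(k < n) a k <= (m + c / (1 - theta)) / (1 - rho).
Proof.
move=> rho0 rho1 th0 th1 c0 m0 a0m ha.
have r1 : 0 < 1 - rho by rewrite subr_gt0.
have t1 : 0 < 1 - theta by rewrite subr_gt0.
have geo k : \sum_(i < k) c * theta ^+ i <= c / (1 - theta).
  rewrite -mulr_sumr ler_wpM2l// -[leRHS]mul1r ler_pdivlMr//.
  have := subrX1 theta k; have := exprn_ge0 k th0.
  by move=> h e; rewrite -opprB mulrN mulrC -e; lra.
have c1 : 0 <= c / (1 - theta) by rewrite divr_ge0// ltW.
set M := _ / _; have M0 : 0 <= M by rewrite divr_ge0 ?(ltW r1)// addr_ge0.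
elim: n => [|n IH]; first by rewrite big_ord0.
rewrite big_ord_recl/=.
apply: (@le_trans _ _ (m + (rho * M + c / (1 - theta)))).
  apply: lerD => //.
  apply: (@le_trans _ _ (\sum_(i < n) (rho * a i + c * theta ^+ i))).
    by apply: ler_sum => i _; exact: ha.
  by rewrite big_split/=; apply: lerD; [rewrite -mulr_sumr ler_wpM2l|exact: geo].
rewrite le_eqVlt; apply/orP; left; apply/eqP; rewrite /M.
by move: (c / (1 - theta)) => u; field; rewrite gt_eqF.
Qed.

Lemma ge0_integralZl_real {d : measure_display} {T : measurableType d} {R : realType}
    (mu : {measure set T -> \bar R}) (k : R) (f : T -> R) :
  measurable_fun setT f -> (forall x, 0 <= f x) -> 0 <= k ->
  (\int[mu]_x (k * f x)%:E = k%:E * \int[mu]_x (f x)%:E)%E.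
Proof.
move=> mf f0 k0; under eq_integral do rewrite EFinM.
by rewrite ge0_integralZl//; [exact/measurable_EFinP|move=> x _; rewrite lee_fin].
Qed.

(** * The weak form at one scale and the passage from [t] to [t / 2] *)

Section one_scale.
Context {R : realType} {d : nat}.
Local Notation mu := (lebesgue_Rd d).
Variables (G psi : Rd R d -> R).
Hypotheses (mG : measurable_fun setT G) (mpsi : measurable_fun setT psi).
Hypothesis G0 : forall w, 0 <= G w.

Let mQ t := @measurable_cube_indic R d t.

Definition cube_mass (t : R) (w : Rd R d) : \bar R :=
  (\int[mu]_v (cube_indic t w v * psi v ^+ 2)%:E)%E.

(** The form [J(t)], with the integral in [v] inside because the averaging is done at fixed [w]. *)
Definition cube_form (t : R) : \bar R := (\int[mu]_w ((G w)%:E * cube_mass t w))%E.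

Lemma cube_mass_ge0 t w : (0 <= cube_mass t w)%E.
Proof.
by apply: integral_ge0 => v _; rewrite lee_fin mulr_ge0 ?sqr_ge0// cube_indic_ge0.
Qed.

Lemma measurable_cube_mass t : measurable_fun setT (cube_mass t).
Proof.
have mQt := mQ t; apply: measurable_tonelli; first by measurability.
by move=> w v; rewrite lee_fin mulr_ge0 ?sqr_ge0// cube_indic_ge0.
Qed.

Lemma cube_form_ge0 t : (0 <= cube_form t)%E.
Proof. by apply: integral_ge0 => w _; rewrite mule_ge0 ?lee_fin// cube_mass_ge0. Qed.

Section fixed_scale.
Variables (t h : R).
Hypothesis h0 : 0 <= h.
Hypothesis Gh : forall v, (\int[mu]_w (cube_indic t v w * G w)%:E <= h%:E)%E.

(** After Tonelli's theorem, [G] is integrated over the cube around [v], where [Gh] bounds it by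
    [h]. *)
Lemma cube_transfer (e : Rd R d -> \bar R) : measurable_fun setT e ->
  (forall v, 0 <= e v)%E ->
  (\int[mu]_w ((G w)%:E * \int[mu]_v ((cube_indic t w v)%:E * e v))
   <= h%:E * \int[mu]_v e v)%E.
Proof.
move=> me e0; have mQt := mQ t.
have Qe0 w v : (0 <= (cube_indic t w v)%:E * e v)%E.
  by rewrite mule_ge0 ?lee_fin ?cube_indic_ge0.
rewrite (_ : (\int[mu]_w _)%E =
    \int[mu]_w \int[mu]_v ((G w)%:E * ((cube_indic t w v)%:E * e v)))%E; last first.
  apply: eq_integral => w _; rewrite ge0_integralZl ?lee_fin//.
  by measurability.
rewrite (tonelli_swap mu mu (F := fun w v => (G w)%:E * ((cube_indic t w v)%:E * e v))%E);
  last 2 first.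
- by measurability.
- by move=> w v; rewrite mule_ge0 ?lee_fin.
rewrite -ge0_integralZl ?lee_fin//.
apply: ge0_le_integralT => v.
  by apply: integral_ge0 => w _; rewrite mule_ge0 ?lee_fin.
rewrite (_ : (\int[mu]_w _)%E = \int[mu]_w ((cube_indic t v w * G w)%:E * e v))%E; last first.
  by apply: eq_integral => w _; rewrite muleA -EFinM cube_indicC (mulrC (G w)).
rewrite ge0_integralZr//; last 2 first.
- by measurability.
- by move=> w _; rewrite lee_fin mulr_ge0 ?cube_indic_ge0.
by rewrite lee_wpmul2r.
Qed.

Lemma cube_form_le : (cube_form t <= h%:E * \int[mu]_v (psi v ^+ 2)%:E)%E.
Proof.
rewrite /cube_form /cube_mass.
under eq_integral do under eq_integral do rewrite EFinM.
apply: cube_transfer; first by measurability.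
by move=> v; rewrite lee_fin sqr_ge0.
Qed.

Hypothesis t0 : 0 < t.

(** By the triangle inequality in each coordinate the points [v] and [v'] differ by less than
    [3 t / 2], hence by less than [2 t]. *)
Lemma in_cube_triangle (w v v' : Rd R d) :
  cube_indic (t / 2) w v * cube_indic t w v' <=
  cube_indic t w v * cube_indic (2 * t) v v'.
Proof.
rewrite !cube_indicE; case: (boolP (in_cube (t / 2) w v)) => [/forallP h1|_]; last first.
  by rewrite mul0r mulr_ge0.
case: (boolP (in_cube t w v')) => [/forallP h2|_]; last by rewrite mulr0 mulr_ge0.
have -> : in_cube t w v.
  by apply/forallP => i; rewrite (lt_trans (h1 i))// ltr_pdivrMr// ltr_pMr// ltr1n.
have -> // : in_cube (2 * t) v v'.
apply/forallP => i; have := h1 i; have := h2 i; rewrite !ltr_norml.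
by move=> /andP[? ?] /andP[? ?]; apply/andP; split; lra.
Qed.

Variable eta : R.
Hypothesis eta0 : 0 < eta.

(* Young's inequality
   [psi v ^+ 2 <= (1 + eta) * psi v' ^+ 2 + (1 + eta^-1) * (psi v - psi v') ^+ 2]
   averaged over [v'] in the cube of half-side [t] around [w]. *)
Lemma cube_poincare w :
  (((2 * t) ^+ d)%:E * cube_mass (t / 2) w <=
   ((1 + eta) * t ^+ d)%:E * cube_mass t w +
   (1 + eta^-1)%:E * \int[mu]_v ((cube_indic t w v)%:E *
      \int[mu]_v' (cube_indic (2 * t) v v' * (psi v - psi v') ^+ 2)%:E))%E.
Proof.
have mQt := mQ t; have mQt2 := mQ (t / 2); have mQ2t := mQ (2 * t).
have Q0 u x y := @cube_indic_ge0 R d u x y.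
pose e (v : Rd R d) : \bar R := (\int[mu]_v' (cube_indic (2 * t) v v' * (psi v - psi v') ^+ 2)%:E)%E.
have e0 v : (0 <= e v)%E by apply: integral_ge0 => v' _; rewrite lee_fin mulr_ge0 ?sqr_ge0.
have me : measurable_fun setT e.
  apply: measurable_tonelli; first by measurability.
  by move=> v v'; rewrite lee_fin mulr_ge0 ?sqr_ge0.
have eta1 : 0 <= 1 + eta by rewrite addr_ge0// ltW.
have eta2 : 0 <= 1 + eta^-1 by rewrite addr_ge0// invr_ge0 ltW.
have t2 : 0 < t / 2 by rewrite divr_gt0.
have s0 v : 0 <= psi v ^+ 2 by exact: sqr_ge0.
have Qs u x v : 0 <= cube_indic u x v * psi v ^+ 2 by exact: mulr_ge0.
have d0 v v' : 0 <= (psi v - psi v') ^+ 2 by exact: sqr_ge0.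
have Qd u x v : 0 <= cube_indic u v x * (psi v - psi x) ^+ 2 by exact: mulr_ge0.
have tcube : 0 <= t ^+ d by rewrite exprn_ge0// ltW.
have t2cube : 0 <= (2 * t) ^+ d by rewrite exprn_ge0// mulr_ge0// ltW.
(* All three terms become integrals over [(v, v')]. Here [(2 t)^d] is the volume of the cube of
   half-side [t] in [v']; in [rhs1E], [t^d] is that of the cube of half-side [t / 2] in [v]. *)
have lhsE : (((2 * t) ^+ d)%:E * cube_mass (t / 2) w = \int[mu]_v \int[mu]_v'
    (cube_indic (t / 2) w v * psi v ^+ 2 * cube_indic t w v')%:E)%E.
  rewrite -ge0_integralZl_real//; last by measurability.
  apply: eq_integral => v _; rewrite ge0_integralZl_real//; last by measurability.
  by rewrite integral_cube_indic// -EFinM mulrC.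
have rhs1E : (((1 + eta) * t ^+ d)%:E * cube_mass t w = \int[mu]_v \int[mu]_v'
    ((1 + eta) * cube_indic (t / 2) w v * (cube_indic t w v' * psi v' ^+ 2))%:E)%E.
  transitivity (\int[mu]_v (((1 + eta) * cube_indic (t / 2) w v)%:E * cube_mass t w))%E.
    rewrite ge0_integralZr ?cube_mass_ge0//; last 2 first.
    - by measurability.
    - by move=> v _; rewrite lee_fin mulr_ge0.
    rewrite ge0_integralZl_real//; last by measurability.
    rewrite integral_cube_indic// -EFinM.
    by congr ((_ * _ ^+ _)%:E * _)%E; field.
  apply: eq_integral => v _; rewrite ge0_integralZl_real//.
    by measurability.
  exact: mulr_ge0.
have rhs2E : ((1 + eta^-1)%:E * (\int[mu]_v ((cube_indic t w v)%:E * e v)) =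
    \int[mu]_v \int[mu]_v' ((1 + eta^-1) * cube_indic t w v *
      (cube_indic (2 * t) v v' * (psi v - psi v') ^+ 2))%:E)%E.
  rewrite -ge0_integralZl ?lee_fin//; last 2 first.
  - by measurability.
  - by move=> v _; rewrite mule_ge0 ?lee_fin.
  apply: eq_integral => v _; rewrite muleA -EFinM ge0_integralZl_real//.
    by measurability.
  exact: mulr_ge0.
rewrite lhsE rhs1E rhs2E !double_integral; last 6 first.
- by measurability.
- by move=> v v'; rewrite lee_fin mulr_ge0// mulr_ge0.
- by measurability.
- by move=> v v'; rewrite lee_fin mulr_ge0// mulr_ge0.
- by measurability.
- by move=> v v'; rewrite lee_fin mulr_ge0.
rewrite -ge0_integralD//; last 4 first.
- by move=> p _; rewrite lee_fin mulr_ge0// mulr_ge0.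
- by measurability.
- by move=> p _; rewrite lee_fin mulr_ge0// mulr_ge0.
- by measurability.
apply: ge0_le_integralT => -[v v'] /=; first by rewrite lee_fin mulr_ge0.
rewrite -EFinD lee_fin.
have young : psi v ^+ 2 <= (1 + eta) * psi v' ^+ 2 + (1 + eta^-1) * (psi v - psi v') ^+ 2.
  rewrite -subr_ge0 (_ : _ - _ = eta^-1 * (eta * psi v' - (psi v - psi v')) ^+ 2).
    by rewrite mulr_ge0 ?sqr_ge0// invr_ge0 ltW.
  by field; rewrite gt_eqF.
have QQ0 : 0 <= cube_indic (t / 2) w v * cube_indic t w v' by exact: mulr_ge0.
have -> : cube_indic (t / 2) w v * psi v ^+ 2 * cube_indic t w v' =
  cube_indic (t / 2) w v * cube_indic t w v' * psi v ^+ 2 by ring.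
apply: (le_trans (ler_wpM2l QQ0 young)); rewrite mulrDr; apply: lerD.
  by rewrite le_eqVlt; apply/orP; left; apply/eqP; ring.
have -> : (1 + eta^-1) * cube_indic t w v *
    (cube_indic (2 * t) v v' * (psi v - psi v') ^+ 2) =
  cube_indic t w v * cube_indic (2 * t) v v' * ((1 + eta^-1) * (psi v - psi v') ^+ 2) by ring.
by rewrite ler_wpM2r ?in_cube_triangle// mulr_ge0.
Qed.

(** [cube_poincare] is integrated against [G]; [cube_transfer] then turns the local differences into
    the energy on cubes of half-side [2 t]. *)
Lemma cube_form_recursion :
  (((2 * t) ^+ d)%:E * cube_form (t / 2) <=
   ((1 + eta) * t ^+ d)%:E * cube_form t +
   ((1 + eta^-1) * h)%:E * energy mu (cube_indic (2 * t)) psi)%E.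
Proof.
have mQt := mQ t; have mQ2t := mQ (2 * t).
have tcube : 0 <= t ^+ d by rewrite exprn_ge0// ltW.
have t2cube : 0 <= (2 * t) ^+ d by rewrite exprn_ge0// mulr_ge0// ltW.
have eta1 : 0 <= 1 + eta by rewrite addr_ge0// ltW.
have eta2 : 0 <= 1 + eta^-1 by rewrite addr_ge0// invr_ge0 ltW.
have mm u := measurable_cube_mass u; have mmt := mm t; have mmt2 := mm (t / 2).
have m0 := cube_mass_ge0.
pose e (v : Rd R d) : \bar R := (\int[mu]_v' (cube_indic (2 * t) v v' * (psi v - psi v') ^+ 2)%:E)%E.
have Qd v v' : (0 <= (cube_indic (2 * t) v v' * (psi v - psi v') ^+ 2)%:E)%E.
  by rewrite lee_fin mulr_ge0 ?sqr_ge0// cube_indic_ge0.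
have e0 v : (0 <= e v)%E by apply: integral_ge0.
have me : measurable_fun setT e.
  by apply: measurable_tonelli => //; measurability.
pose a w : \bar R := (\int[mu]_v ((cube_indic t w v)%:E * e v))%E.
have a0 w : (0 <= a w)%E.
  by apply: integral_ge0 => v _; rewrite mule_ge0 ?lee_fin ?cube_indic_ge0.
have ma : measurable_fun setT a.
  apply: (@measurable_tonelli _ _ _ _ _ mu (fun w v => (cube_indic t w v)%:E * e v)%E).
    by measurability.
  by move=> w v; rewrite mule_ge0 ?lee_fin ?cube_indic_ge0.
apply: (@le_trans _ _ (((1 + eta) * t ^+ d)%:E * cube_form t +
    (1 + eta^-1)%:E * \int[mu]_w ((G w)%:E * a w))%E); last first.
  apply: leeD; first exact: lexx.
  rewrite EFinM -muleA; apply: lee_wpmul2l; first by rewrite lee_fin.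
  exact: cube_transfer.
rewrite /cube_form -!ge0_integralZl ?lee_fin ?mulr_ge0//; last 6 first.
- by measurability.
- by move=> w _; rewrite mule_ge0 ?lee_fin.
- by measurability.
- by move=> w _; rewrite mule_ge0 ?lee_fin.
- by measurability.
- by move=> w _; rewrite mule_ge0 ?lee_fin.
rewrite -ge0_integralD//; last 4 first.
- by move=> w _; rewrite !mule_ge0 ?lee_fin// mulr_ge0.
- by measurability.
- by move=> w _; rewrite !mule_ge0 ?lee_fin.
- by measurability.
apply: ge0_le_integralT => w; first by rewrite !mule_ge0 ?lee_fin.
rewrite muleCA ![(_%:E * ((G w)%:E * _))%E]muleCA -ge0_muleDr; last 2 first.
- by rewrite mule_ge0 ?lee_fin ?mulr_ge0.
- by rewrite mule_ge0 ?lee_fin.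
by apply: lee_wpmul2l; [rewrite lee_fin|exact: cube_poincare].
Qed.

End fixed_scale.
End one_scale.

(** * Hoelder's inequality on cubes and the dyadic scales *)

Lemma hoelder_cube {R : realType} (d : nat) (G : Rd R d -> R) (q t a : R) (v : Rd R d) :
  measurable_fun setT G -> (forall w, 0 <= G w) -> 1 < q -> 0 < t ->
  'N[lebesgue_Rd d]_(q%:E)[EFin \o G]%E = a%:E ->
  (\int[lebesgue_Rd d]_w (cube_indic t v w * G w)%:E <=
   (((2 * t) ^+ d) `^ (1 - q^-1) * a)%:E)%E.
Proof.
move=> mG G0 q1 t0 aE; have mQ := @measurable_cube_indic R d t.
have q0 : 0 < q by rewrite (lt_trans ltr01).
have e0 : 0 < 1 - q^-1 by rewrite subr_gt0 invf_lt1.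
pose p := (1 - q^-1)^-1; have p0 : 0 < p by rewrite invr_gt0.
have mQv : measurable_fun setT (cube_indic t v) by measurability.
have := hoelder (lebesgue_Rd d) mQv mG p0 q0; rewrite invrK subrK => /(_ erefl).
rewrite aE Lnorm1.
have -> : ('N[lebesgue_Rd d]_p%:E[EFin \o cube_indic t v] = (((2 * t) ^+ d) `^ (1 - q^-1))%:E)%E.
  rewrite unlock invrK (eq_integral (fun w => (cube_indic t v w)%:E)); last first.
    move=> w _; rewrite /= cube_indicE; case: in_cube => /=.
      by rewrite normr1 powR1.
    by rewrite normr0 powR0// gt_eqF.
  by rewrite integral_cube_indic// poweR_EFin.
by rewrite -EFinM; under eq_integral do rewrite /= ger0_norm ?mulr_ge0 ?cube_indic_ge0//.
Qed.

(** The first alternative serves [u < r] and the second [r <= u]; in each, the least admissible [k]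
    gives the other inequality. The exponents stay natural numbers, at the price of two families of
    scales. *)
Lemma dyadic_scale {R : realType} (r u : R) : 0 < r -> 0 < u ->
  exists k, (r / 2 ^+ k / 2 <= u < r / 2 ^+ k) \/ (r * 2 ^+ k / 2 <= u < r * 2 ^+ k).
Proof.
move=> r0 u0.
have large (x : R) : exists n, x < 2 ^+ n.
  exists (Num.truncn x).+1; rewrite (lt_trans (truncnS_gt _))//.
  by rewrite -natrX ltr_nat ltn_expl.
have p2 n : 0 < 2 ^+ n :> R by rewrite exprn_gt0.
have [ur|ru] := ltP u r.
- have ex : exists n, r / 2 ^+ n / 2 <= u.
    have [n rn] := large (r / u); exists n.
    rewrite ler_pdivrMr// ler_pdivrMr//; move: rn; rewrite ltr_pdivrMr// => rn.
    by rewrite mulrAC (le_trans (ltW rn))// mulrC ler_peMr ?ler1n// mulr_ge0// ltW.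
  case: (ex_minnP ex) => k kP kmin; exists k; left; rewrite kP/=.
  case: k kP kmin => [|k] _ kmin; first by rewrite expr0 divr1.
  rewrite ltNge; apply/negP => h.
  have := kmin k; rewrite ltnn => h2; suff : false by []; apply: h2.
  by rewrite -mulrA -invfM -exprSr.
- have ex : exists n, u < r * 2 ^+ n.
    by have [n rn] := large (u / r); exists n; move: rn; rewrite ltr_pdivrMr// mulrC.
  case: (ex_minnP ex) => k kP kmin; exists k; right; rewrite kP andbT.
  case: k kP kmin => [|k] kP kmin; first by move: kP; rewrite expr0 mulr1 ltNge ru.
  rewrite leNgt; apply/negP => h.
  have := kmin k; rewrite ltnn => h2; suff : false by []; apply: h2.
  by move: h; rewrite exprS [2 * _]mulrC mulrA mulfK.
Qed.

Lemma powR_le_double {R : realType} (gamma x y : R) : gamma < 0 -> 0 < x -> 0 < y ->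
  x <= 2 * y -> y `^ gamma <= 2 `^ (- gamma) * x `^ gamma.
Proof.
move=> g0 x0 y0 xy; have x2 : 0 < x / 2 by rewrite divr_gt0.
have -> : 2 `^ (- gamma) * x `^ gamma = (x / 2) `^ gamma.
  by rewrite powRM ?invr_ge0 ?(ltW x0)// mulrC -[2^-1]powR_inv1// -powRrM mulN1r.
rewrite -(opprK gamma) ![_ `^ (- - gamma)]powRN lef_pV2 ?posrE ?powR_gt0//.
apply: ge0_ler_powR; rewrite ?nnegrE ?oppr_ge0 ?(ltW g0) ?(ltW x2) ?(ltW y0)//.
by rewrite ler_pdivrMr// mulrC.
Qed.

Section weak_form.
Context {R : realType} {d : nat}.
Local Notation mu := (lebesgue_Rd d).

Definition cube_power (gamma t : R) (v w : Rd R d) : R := t `^ gamma * cube_indic t v w.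

Lemma cube_power_ge0 gamma t v w : 0 <= cube_power gamma t v w.
Proof. by rewrite mulr_ge0 ?powR_ge0// cube_indic_ge0. Qed.

Lemma power_le_cube_power (gamma t : R) (v w : Rd R d) : gamma < 0 -> 0 < t ->
  t / 2 <= normRd (subRd v w) < t ->
  normRd (subRd v w) `^ gamma <= 2 `^ (- gamma) * cube_power gamma t v w.
Proof.
move=> g0 t0 /andP[tu ut]; rewrite /cube_power cube_indicE.
have -> : in_cube t v w.
  apply/forallP => i; apply: le_lt_trans ut.
  by rewrite (le_trans _ (coord_le_normRd _ i))// tnth_mktuple.
rewrite mulr1; apply: powR_le_double => //; last by rewrite mulrC -ler_pdivrMr.
by rewrite (lt_le_trans _ tu)// divr_gt0.
Qed.

(** The term of the single scale with [t / 2 <= |v - w| < t] already dominates, with [2^(- gamma)]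
    paying for the replacement of [|v - w|] by [t]; the other terms are nonnegative. *)
Lemma power_le_cube_series (gamma r : R) (v w : Rd R d) : gamma < 0 -> 0 < r ->
  ((normRd (subRd v w) `^ gamma)%:E <=
   \sum_(0 <= k <oo) (2 `^ (- gamma) * (cube_power gamma (r / 2 ^+ k) v w +
                                        cube_power gamma (r * 2 ^+ k) v w))%:E)%E.
Proof.
move=> g0 r0.
set F := fun k : nat => 2 `^ (- gamma) * (cube_power gamma (r / 2 ^+ k) v w +
  cube_power gamma (r * 2 ^+ k) v w).
have p2 n : 0 < 2 ^+ n :> R by rewrite exprn_gt0.
have F0 k : 0 <= F k by rewrite mulr_ge0 ?powR_ge0 ?addr_ge0 ?cube_power_ge0.
(* On the diagonal no dyadic scale exists, but there the power takes the default value 0. *)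
have [u0|u0] := eqVneq (normRd (subRd v w)) 0.
  by rewrite u0 powR0 ?lt_eqF//; apply: nneseries_ge0 => k _ _; exact: F0.
have ugt0 : 0 < normRd (subRd v w) by rewrite lt_neqAle eq_sym u0 normRd_ge0.
have [k kP] := dyadic_scale r0 ugt0.
apply: (@le_trans _ _ (F k)%:E).
  rewrite lee_fin /F mulrDr.
  case: kP => [|] kP; have := power_le_cube_power g0 _ kP.
    move=> h; rewrite (le_trans (h _)) ?divr_gt0// lerDl mulr_ge0 ?powR_ge0//.
    exact: cube_power_ge0.
  move=> h; rewrite (le_trans (h _)) ?mulr_gt0// lerDr mulr_ge0 ?powR_ge0//.
  exact: cube_power_ge0.
apply: le_trans (nneseries_lim_ge k.+1 _); last by move=> i _ _; exact: F0.
by rewrite big_nat_recr//= leeDr// sume_ge0// => i _; exact: F0.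
Qed.

Variables (G psi : Rd R d -> R).
Hypotheses (mG : measurable_fun setT G) (mpsi : measurable_fun setT psi).
Hypothesis G0 : forall w, 0 <= G w.

Lemma measurable_cube_power gamma t :
  measurable_fun [set: Rd R d * Rd R d] (fun p => cube_power gamma t p.1 p.2).
Proof. by have mQ := @measurable_cube_indic R d t; rewrite /cube_power; measurability. Qed.

Lemma integral_cube_power (gamma t : R) :
  (\int[mu]_v \int[mu]_w (cube_power gamma t v w * (psi v ^+ 2 * G w))%:E =
   (t `^ gamma)%:E * cube_form G psi t)%E.
Proof.
have mQ := @measurable_cube_indic R d t.
have s0 v : 0 <= psi v ^+ 2 by exact: sqr_ge0.
have Q0 v w : 0 <= cube_indic t v w by exact: cube_indic_ge0.
have mP := measurable_cube_power gamma t.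
rewrite (tonelli_swap mu mu); last 2 first.
- by measurability.
- by move=> v w; rewrite lee_fin; apply: mulr_ge0; [exact: cube_power_ge0|exact: mulr_ge0].
have mm := @measurable_cube_mass _ _ _ mpsi t.
rewrite /cube_form -ge0_integralZl ?lee_fin ?powR_ge0//; last 2 first.
- by measurability.
- by move=> w _; rewrite mule_ge0 ?lee_fin// cube_mass_ge0.
apply: eq_integral => w _; rewrite /cube_mass muleA -EFinM -ge0_integralZl_real//.
- by apply: eq_integral => v _; rewrite /cube_power cube_indicC; congr EFin; ring.
- by measurability.
- by move=> v; exact: mulr_ge0.
- by rewrite mulr_ge0// powR_ge0.
Qed.

(** Monotone convergence exchanges the series with the double integral, so uniform bounds on partial
    sums suffice. *)
Lemma power_form_le (gamma r : R) (M : \bar R) : gamma < 0 -> 0 < r ->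
  (forall n : nat, \sum_(0 <= k < n) (2 `^ (- gamma))%:E *
     (((r / 2 ^+ k) `^ gamma)%:E * cube_form G psi (r / 2 ^+ k) +
      ((r * 2 ^+ k) `^ gamma)%:E * cube_form G psi (r * 2 ^+ k)) <= M)%E ->
  (\int[mu]_v \int[mu]_w (normRd (subRd v w) `^ gamma * (psi v ^+ 2 * G w))%:E <= M)%E.
Proof.
move=> g0 r0 hM.
have mP t := measurable_cube_power gamma t.
have P0 t v w : 0 <= cube_power gamma t v w by exact: cube_power_ge0.
have s0 v : 0 <= psi v ^+ 2 by exact: sqr_ge0.
have u0 v w : 0 <= psi v ^+ 2 * G w by exact: mulr_ge0.
pose T (t : R) v w := cube_power gamma t v w * (psi v ^+ 2 * G w).
have T0 t v w : 0 <= T t v w by exact: mulr_ge0.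
have mT t : measurable_fun [set: Rd R d * Rd R d] (fun p => T t p.1 p.2).
  by have mPt := mP t; rewrite /T; measurability.
pose F (k : nat) v w : \bar R := ((2 `^ (- gamma))%:E *
  ((T (r / 2 ^+ k) v w)%:E + (T (r * 2 ^+ k) v w)%:E))%E.
have F0 k v w : (0 <= F k v w)%E.
  by rewrite mule_ge0 ?adde_ge0 ?lee_fin ?powR_ge0.
have mF k : measurable_fun [set: Rd R d * Rd R d] (fun p => F k p.1 p.2).
  have m1 := mT (r / 2 ^+ k); have m2 := mT (r * 2 ^+ k).
  by rewrite /F; measurability.
apply: (@le_trans _ _ (\int[mu]_v \int[mu]_w \sum_(0 <= k <oo) F k v w)%E).
  apply: ge0_le_integralT => v.
    by apply: integral_ge0 => w _; rewrite lee_fin mulr_ge0 ?powR_ge0.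
  apply: ge0_le_integralT => w; first by rewrite lee_fin mulr_ge0 ?powR_ge0.
  have c0 k : 0 <= 2 `^ (- gamma) * (cube_power gamma (r / 2 ^+ k) v w +
      cube_power gamma (r * 2 ^+ k) v w).
    by apply: mulr_ge0; [exact: powR_ge0|exact: addr_ge0].
  rewrite EFinM muleC.
  apply: (le_trans (lee_wpmul2l _ (power_le_cube_series v w g0 r0))).
    by rewrite lee_fin.
  rewrite -nneseriesZl; last by move=> k _; rewrite lee_fin.
  apply: lee_nneseries => [k _ _|k _].
    by rewrite -EFinM lee_fin; exact: mulr_ge0.
  rewrite /F /T -EFinD -!EFinM lee_fin le_eqVlt; apply/orP; left; apply/eqP; ring.
rewrite (double_integral mu mu (F := fun v w => (\sum_(0 <= k <oo) F k v w)%E)); last 2 first.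
- by apply: ge0_emeasurable_sum.
- by move=> v w; apply: nneseries_ge0 => k _ _; exact: F0.
rewrite integral_nneseries//.
apply: lime_le.
  by apply: is_cvg_nneseries => k _ _; apply: integral_ge0 => p _; exact: F0.
apply: nearW => n; apply: le_trans (hM n); apply: lee_sum => k _.
have mT1 := mT (r / 2 ^+ k); have mT2 := mT (r * 2 ^+ k).
have TE t : ((t `^ gamma)%:E * cube_form G psi t = \int[(mu \x mu)%E]_p (T t p.1 p.2)%:E)%E.
  rewrite -integral_cube_power double_integral//.
  - by have := mT t => mTt; apply/measurable_EFinP.
  - by move=> v w; rewrite lee_fin; exact: T0.
rewrite !TE.
rewrite -ge0_integralD//; last 4 first.
- by move=> p _; rewrite lee_fin; exact: T0.
- by measurability.
- by move=> p _; rewrite lee_fin; exact: T0.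
- by measurability.
rewrite -ge0_integralZl ?lee_fin ?powR_ge0//.
- by measurability.
- by move=> p _; rewrite -EFinD lee_fin; apply: addr_ge0; exact: T0.
Qed.

End weak_form.

(** * Powers of dyadic scales *)

Lemma powRD_gt0 {R : realType} (t x y : R) : 0 < t -> t `^ (x + y) = t `^ x * t `^ y.
Proof. by move=> t0; rewrite powRD// (gt_eqF t0) implybT. Qed.

Lemma powR_dyadic_div {R : realType} (r x : R) k : 0 < r ->
  (r / 2 ^+ k) `^ x = r `^ x * (2 `^ (- x)) ^+ k.
Proof.
move=> r0; rewrite powRM ?invr_ge0 ?exprn_ge0 ?(ltW r0)//; congr (_ * _).
rewrite -[2 ^+ k]powR_mulrn// -powRN -powRrM -[(2 `^ (- x)) ^+ k]powR_mulrn ?powR_ge0//.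
by rewrite -powRrM mulrC mulNr mulrN mulrC.
Qed.

Lemma powR_dyadic_mul {R : realType} (r x : R) k : 0 < r ->
  (r * 2 ^+ k) `^ x = r `^ x * (2 `^ x) ^+ k.
Proof.
move=> r0; rewrite powRM ?exprn_ge0 ?(ltW r0)//; congr (_ * _).
rewrite -[2 ^+ k]powR_mulrn// -powRrM -[(2 `^ x) ^+ k]powR_mulrn ?powR_ge0//.
by rewrite -powRrM mulrC.
Qed.

Lemma powR2_lt1 {R : realType} (x : R) : x < 0 -> (2 : R) `^ x < 1.
Proof.
move=> x0; rewrite -(opprK x) powRN invf_lt1 ?powR_gt0//.
have x1 : 0 < - x by rewrite oppr_gt0.
have e1 : 1 `^ (- x) = 1 :> R by rewrite powR1.
rewrite -[ltLHS]e1; by apply: gt0_ltr_powR; rewrite ?nnegrE ?ltr1n.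
Qed.

Lemma powR_volume {R : realType} (d : nat) (t e : R) : 0 < t ->
  ((2 * t) ^+ d) `^ e = 2 `^ (d%:R * e) * t `^ (d%:R * e).
Proof.
move=> t0; have t2 : 0 <= 2 * t by rewrite mulr_ge0// ltW.
by rewrite -powR_mulrn// -powRrM powRM// ltW.
Qed.

(** * Summation over the scales *)

Section scales.
Context {R : realType} {d : nat}.
Local Notation mu := (lebesgue_Rd d).
Variables (gamma s e : R).
Hypotheses (gamma0 : gamma < 0) (gammad : 0 < gamma + d%:R) (s0 : 0 < s) (s1 : s <= 1).
Local Notation p := (gamma + d%:R * e).
Hypotheses (p0 : p < 0) (ps0 : 0 < p + 2 * s).

(* [eta] is such that the contraction factor [sigma * (1 + eta)] of the recursion
   on the scales is the midpoint [rho] of [sigma] and 1. *)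
Let sigma : R := 2 `^ (- (gamma + d%:R)).
Let eta : R := (sigma^-1 - 1) / 2.
Let rho : R := (1 + sigma) / 2.
Let V : R := 2 `^ (d%:R * e).
(** The factors are those of [j_rec]: [2^(- gamma)] from [(t / 2)^gamma], [1 + eta^-1] from Young's
    inequality, [(25 / 8)^d] from [(25 t / 4)^d / (2 t)^d], [8 (d + 1)] from [energy_le_sobolev],
    and [V] from Hoelder's bound. *)
Let C1 : R := 2 `^ (- gamma) * (1 + eta^-1) * (25 / 8) ^+ d * (8 * d.+1%:R) * V.

Let sigma_gt0 : 0 < sigma. Proof. exact: powR_gt0. Qed.
Let sigma_lt1 : sigma < 1. Proof. by apply: powR2_lt1; rewrite oppr_lt0. Qed.
Let eta_gt0 : 0 < eta.
Proof. by rewrite divr_gt0// subr_gt0 invf_gt1. Qed.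
Let rho_ge0 : 0 <= rho. Proof. by rewrite /rho; have := sigma_gt0; lra. Qed.
Let rho_lt1 : rho < 1. Proof. by rewrite /rho; have := sigma_lt1; lra. Qed.
Let rhoE : 2 `^ (- gamma) * (1 + eta) / 2 ^+ d = rho.
Proof.
have -> : rho = sigma * (1 + eta) by rewrite /rho /eta; field; rewrite gt_eqF.
rewrite mulrAC; congr (_ * _); rewrite /sigma opprD powRD_gt0//.
by congr (_ * _); rewrite powRN powR_mulrn.
Qed.
Let V_gt0 : 0 < V. Proof. exact: powR_gt0. Qed.
Let C1_gt0 : 0 < C1.
Proof.
have c1 : 0 < 1 + eta^-1 by rewrite addr_gt0// invr_gt0.
by rewrite /C1 !mulr_gt0 ?exprn_gt0 ?powR_gt0 ?divr_gt0.
Qed.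

Variables (G psi : Rd R d -> R) (a b S2 : R).
Hypotheses (mG : measurable_fun setT G) (mpsi : measurable_fun setT psi).
Hypotheses (G0 : forall w, 0 <= G w) (a0 : 0 <= a) (b0 : 0 <= b) (S20 : 0 <= S2).
Hypothesis Ga : forall t v, 0 < t ->
  (\int[mu]_w (cube_indic t v w * G w)%:E <= (((2 * t) ^+ d) `^ e * a)%:E)%E.
Hypothesis psib : (\int[mu]_v (psi v ^+ 2)%:E = b%:E)%E.
Hypothesis psiS : (sobolev_norm s psi ^+ 2 = S2%:E)%E.

Let j t := fine (cube_form G psi t).

Let h0 t : 0 <= ((2 * t) ^+ d) `^ e * a. Proof. by rewrite mulr_ge0// powR_ge0. Qed.

Let jE t : 0 < t -> cube_form G psi t = (j t)%:E.
Proof.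
move=> t0; rewrite fineK// ge0_fin_numE ?cube_form_ge0//.
have := cube_form_le mG mpsi G0 (h0 t) (fun v => Ga v t0).
by rewrite psib -EFinM => /le_lt_trans; apply; exact: ltry.
Qed.

Let j_le t : 0 < t -> t `^ gamma * j t <= V * a * b * t `^ p.
Proof.
move=> t0; have := cube_form_le mG mpsi G0 (h0 t) (fun v => Ga v t0).
rewrite psib -EFinM jE// lee_fin powR_volume// => h.
rewrite (powRD_gt0 _ _ t0).
apply: (le_trans (ler_wpM2l (powR_ge0 _ _) h)).
by rewrite le_eqVlt; apply/orP; left; apply/eqP; rewrite /V; ring.
Qed.

(** [cube_form_recursion] multiplied by [(t / 2)^gamma / (2 t)^d]. In the error term the powers of
    [t] are [gamma - d] from this factor, [d e] from Hoelder's bound and [d + 2 s] from the energy,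
    in total [p + 2 s]. *)
Let j_rec t : 0 < t ->
  (t / 2) `^ gamma * j (t / 2) <=
  rho * (t `^ gamma * j t) + C1 * a * S2 * t `^ (p + 2 * s).
Proof.
move=> t0; have t20 : 0 < t / 2 by rewrite divr_gt0.
have := cube_form_recursion mG mpsi G0 (h0 t) (fun v => Ga v t0) t0 eta_gt0.
have psi2 : (\int[mu]_v (psi v ^+ 2)%:E < +oo)%E by rewrite psib ltry.
have := cube_energy_le_sobolev mpsi psi2 s0 s1 t0; rewrite psiS -EFinM => he.
have c0 : 0 <= (1 + eta^-1) * (((2 * t) ^+ d) `^ e * a).
  by rewrite mulr_ge0// addr_ge0// invr_ge0 ltW.
have c0E : (0%R <= ((1 + eta^-1) * (((2 * t) ^+ d) `^ e * a))%:E)%E by rewrite lee_fin.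
move=> /le_trans/(_ (leeD (lexx _) (lee_wpmul2l c0E he))).
rewrite !jE// -!EFinM -EFinD lee_fin powR_volume//.
set E := (X in _ <= X -> _) => hE.
have v0 : 0 < (2 * t) ^+ d by rewrite exprn_gt0// mulr_gt0.
have k0 : 0 <= (t / 2) `^ gamma / (2 * t) ^+ d.
  by rewrite mulr_ge0 ?powR_ge0// invr_ge0 ltW.
have -> : (t / 2) `^ gamma * j (t / 2) =
    (t / 2) `^ gamma / (2 * t) ^+ d * ((2 * t) ^+ d * j (t / 2)).
  by field; rewrite gt_eqF.
apply: (le_trans (ler_wpM2l k0 hE)).
rewrite -rhoE /E (powR_dyadic_div gamma 1 t0) expr1 !(powRD_gt0 _ _ t0).
rewrite le_eqVlt; apply/orP; left; apply/eqP; rewrite /C1 /V.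
rewrite !exprMn !exprVn (_ : 4 = 2 * 2 :> R); last by ring.
have t2 : (2 : R) ^+ d != 0 by rewrite gt_eqF// exprn_gt0.
have td : t ^+ d != 0 by rewrite gt_eqF// exprn_gt0.
rewrite (_ : 8 = 2 * (2 * 2) :> R); last by ring.
rewrite invfM !exprMn.
by field; rewrite t2 td gt_eqF.
Qed.

(** The ratios of the geometric sequences: [theta] for the errors at the scales [r / 2 ^+ k],
    [theta'] for Hoelder's bounds at the scales [r * 2 ^+ k]. *)
Let theta : R := 2 `^ (- (p + 2 * s)).
Let theta' : R := 2 `^ p.
Let theta_lt1 : theta < 1. Proof. by apply: powR2_lt1; rewrite oppr_lt0. Qed.
Let theta'_lt1 : theta' < 1. Proof. exact: powR2_lt1. Qed.

(** The first quotient sums the small scales by [sum_recursion_le], the second sums the large ones.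
    It is built from [d], [gamma], [s] and [e] only, whence the dependence of the final constant. *)
Definition power_form_cst : R :=
  2 `^ (- gamma) * ((V + C1 / (1 - theta)) / (1 - rho) + V / (1 - theta')).

Lemma power_form_cst_gt0 : 0 < power_form_cst.
Proof.
have r1 : 0 < 1 - rho by rewrite subr_gt0.
have t1 : 0 < 1 - theta by rewrite subr_gt0.
have t2 : 0 < 1 - theta' by rewrite subr_gt0.
rewrite /power_form_cst mulr_gt0 ?powR_gt0// addr_gt0 ?divr_gt0//.
by rewrite addr_gt0 ?divr_gt0.
Qed.

Lemma power_form_bound r : 0 < r ->
  (\int[mu]_v \int[mu]_w (normRd (subRd v w) `^ gamma * (psi v ^+ 2 * G w))%:E <=
   (power_form_cst * a * (r `^ p * b + r `^ (p + 2 * s) * S2))%:E)%E.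
Proof.
move=> r0; apply: (power_form_le mG mpsi G0 gamma0 r0) => n.
have p2 k : 0 < 2 ^+ k :> R by rewrite exprn_gt0.
have rd k : 0 < r / 2 ^+ k by rewrite divr_gt0.
have rm k : 0 < r * 2 ^+ k by rewrite mulr_gt0.
pose A k := (r / 2 ^+ k) `^ gamma * j (r / 2 ^+ k).
pose B k := (r * 2 ^+ k) `^ gamma * j (r * 2 ^+ k).
have r1 : 0 < 1 - rho by rewrite subr_gt0.
have t1 : 0 < 1 - theta by rewrite subr_gt0.
have t2 : 0 < 1 - theta' by rewrite subr_gt0.
have V0 := ltW V_gt0; have C10 := ltW C1_gt0.
pose m := V * a * b * r `^ p; have m0 : 0 <= m by rewrite !mulr_ge0 ?powR_ge0.
pose c := C1 * a * S2 * r `^ (p + 2 * s); have c0 : 0 <= c.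
  by rewrite mulr_ge0 ?powR_ge0// mulr_ge0// mulr_ge0.
have hA : \sum_(k < n) A k <= (m + c / (1 - theta)) / (1 - rho).
  apply: sum_recursion_le => //; first exact: powR_ge0.
    by have := j_le (rd 0%N); rewrite /A expr0 divr1.
  move=> k; have := j_rec (rd k).
  rewrite (powR_dyadic_div (p + 2 * s) k r0) -/theta [C1 * a * S2 * _]mulrA -/c.
  by rewrite -[r / 2 ^+ k / 2]mulrA -invfM -exprSr.
have hB : \sum_(k < n) B k <= m / (1 - theta').
  apply: (@le_trans _ _ (\sum_(k < n) m * theta' ^+ k)).
    apply: ler_sum => k _; have := j_le (rm k).
    by rewrite (powR_dyadic_mul p k r0) mulrA.
  (* A geometric sum is the case of the recursion without error term. *)
  have := @sum_recursion_le _ (fun k => m * theta' ^+ k) theta' 0 0 m n.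
  rewrite mul0r addr0; apply => //; first exact: powR_ge0.
    by rewrite expr0 mulr1.
  by move=> k; rewrite mul0r addr0 exprS mulrCA.
rewrite (_ : (\sum_(0 <= k < n) _)%E =
    (2 `^ (- gamma) * (\sum_(k < n) A k + \sum_(k < n) B k))%:E); last first.
  rewrite big_mkord -big_split/= mulr_sumr -sumEFin; apply: eq_bigr => k _.
  by rewrite !jE// -!EFinM -EFinD.
rewrite lee_fin.
apply: (le_trans (ler_wpM2l (powR_ge0 _ _) (lerD hA hB))).
have rp0 : 0 <= r `^ (p + 2 * s) by exact: powR_ge0.
rewrite /power_form_cst -2![_ * _ * _ in leRHS]mulrA; apply: ler_wpM2l; first exact: powR_ge0.
rewrite -subr_ge0.
(* One constant multiplies both [r^p b] and [r^(p + 2 s) S2]; the difference of the two sides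
   consists of the cross terms so added, all nonnegative. *)
set x := (X in 0 <= X); have -> : x = V / (1 - rho) * (a * r `^ (p + 2 * s) * S2) +
    V / (1 - theta') * (a * r `^ (p + 2 * s) * S2) +
    C1 / (1 - theta) / (1 - rho) * (a * r `^ p * b).
  rewrite /x /m /c; field.
  by rewrite !gt_eqF.
have d1 y : 0 <= y -> 0 <= y / (1 - rho) by move=> y0; rewrite divr_ge0// ltW.
have d2 y : 0 <= y -> 0 <= y / (1 - theta) by move=> y0; rewrite divr_ge0// ltW.
have d3 y : 0 <= y -> 0 <= y / (1 - theta') by move=> y0; rewrite divr_ge0// ltW.
have aS : 0 <= a * r `^ (p + 2 * s) * S2 by rewrite mulr_ge0// mulr_ge0.
have ab : 0 <= a * r `^ p * b by rewrite mulr_ge0// mulr_ge0// powR_ge0.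
apply: addr_ge0; first by apply: addr_ge0; apply: mulr_ge0 => //; [exact: d1|exact: d3].
by apply: mulr_ge0 => //; apply: d1; exact: d2.
Qed.

End scales.

(** * Splitting and choice of the scale *)

Lemma Lfun_measurable {d : measure_display} {T : measurableType d} {R : realType}
    (mu : {measure set T -> \bar R}) (p : \bar R) (f : T -> R) :
  f \in Lfun mu p -> measurable_fun setT f.
Proof. by rewrite inE => /andP[]; rewrite inE. Qed.

Lemma Lfun_Lnorm_fin {d : measure_display} {T : measurableType d} {R : realType}
    (mu : {measure set T -> \bar R}) (p : \bar R) (f : T -> R) :
  f \in Lfun mu p -> exists2 a : R, 0 <= a & 'N[mu]_p[EFin \o f]%E = a%:E.
Proof.
rewrite inE => /andP[_]; rewrite inE /= /finite_norm => Nfin.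
have N0 := Lnorm_ge0 mu p (EFin \o f).
exists (fine 'N[mu]_p[EFin \o f]%E); first exact: fine_ge0.
by rewrite fineK// ge0_fin_numE.
Qed.

Section japanese_bracket.
Context {R : realType} {d : nat}.
Implicit Types v w : Rd R d.

Lemma japanese_gt0 v : 0 < japanese v.
Proof. by rewrite sqrtr_gt0 ltr_pwDl// sqr_ge0. Qed.

Lemma measurable_japanese : measurable_fun [set: Rd R d] (@japanese R d).
Proof.
have msqrt : measurable_fun [set: R] (@Num.sqrt R).
  by apply: continuous_measurable_fun; exact: sqrt_continuous.
have mnorm := @measurable_normRd R d.
by apply: (measurableT_comp msqrt); measurability.
Qed.

Lemma measurable_weighted (a : R) (f : Rd R d -> R) :
  measurable_fun setT (weighted a f) -> measurable_fun setT f.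
Proof.
move=> mf; have mJ : measurable_fun setT (fun v : Rd R d => japanese v `^ (- a)).
  exact: (measurableT_comp (measurable_powR _) measurable_japanese).
rewrite (_ : f = fun v => japanese v `^ (- a) * weighted a f v).
  by measurability.
apply/funext => v; rewrite /weighted mulrA -powRD_gt0 ?japanese_gt0//.
by rewrite addNr powRr0 mul1r.
Qed.

Lemma normRd_sqr v : normRd v ^+ 2 = \sum_(i < d) tnth v i ^+ 2.
Proof. by rewrite sqr_sqrtr// sumr_ge0// => i _; rewrite sqr_ge0. Qed.

Lemma japanese_sqr_le v w :
  japanese v ^+ 2 <= 2 * normRd (subRd v w) ^+ 2 + 2 * japanese w ^+ 2.
Proof.
have jE x : japanese x ^+ 2 = 1 + normRd x ^+ 2 by rewrite sqr_sqrtr// addr_ge0// sqr_ge0.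
rewrite !jE !normRd_sqr mulrDr.
suff : \sum_(i < d) tnth v i ^+ 2 <=
    2 * (\sum_(i < d) tnth (subRd v w) i ^+ 2) + 2 * (\sum_(i < d) tnth w i ^+ 2) by lra.
rewrite !mulr_sumr -big_split/=; apply: ler_sum => i _; rewrite tnth_mktuple.
have := sqr_ge0 (tnth v i - 2 * tnth w i); nra.
Qed.

Lemma measurable_distRd :
  measurable_fun [set: Rd R d * Rd R d] (fun p => normRd (subRd p.1 p.2)).
Proof.
have msqrt : measurable_fun [set: R] (@Num.sqrt R).
  by apply: continuous_measurable_fun; exact: sqrt_continuous.
apply: (measurableT_comp msqrt); apply: measurable_sum => i; apply: measurable_funX.
rewrite (_ : (fun p => _) = (fun p : Rd R d * Rd R d => tnth p.1 i - tnth p.2 i)).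
  apply: measurable_funB.
    exact: (measurableT_comp (measurable_tnth i) measurable_fst).
  exact: (measurableT_comp (measurable_tnth i) measurable_snd).
by apply/funext => p; rewrite tnth_mktuple.
Qed.

(* Either [normRd (subRd v w)] is at least half of [japanese v], and its power is
   absorbed by that of [japanese v], or [japanese v <= 2 * japanese w]. *)
Lemma power_split (gamma x : R) v w : gamma < 0 -> 0 <= x ->
  normRd (subRd v w) `^ gamma * x <=
  2 `^ (- gamma) * japanese v `^ gamma *
    (x + normRd (subRd v w) `^ gamma * (japanese w `^ (- gamma) * x)).
Proof.
move=> g0 x0; set u := normRd _; have u0 : 0 <= u := normRd_ge0 _.
have jv := japanese_gt0 v; have jw := japanese_gt0 w.
have c0 : 0 <= 2 `^ (- gamma) * japanese v `^ gamma by rewrite mulr_ge0 ?powR_ge0.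
have ux0 : 0 <= u `^ gamma * x by rewrite mulr_ge0 ?powR_ge0.
have ng0 : 0 <= - gamma by rewrite oppr_ge0 ltW.
rewrite mulrDr; have [vu|uv] := leP (japanese v) (2 * u).
  have : u `^ gamma <= 2 `^ (- gamma) * japanese v `^ gamma.
    have ugt0 : 0 < u by rewrite -(pmulr_rgt0 _ (ltr0n _ 2)) (lt_le_trans jv).
    exact: powR_le_double.
  move=> h; rewrite -[leLHS]addr0; apply: lerD; first exact: ler_wpM2r.
  exact: mulr_ge0 c0 (mulr_ge0 (powR_ge0 _ _) (mulr_ge0 (powR_ge0 _ _) x0)).
have vw : japanese v <= 2 * japanese w.
  rewrite -ler_sqr ?nnegrE ?mulr_ge0 ?(ltW jv) ?(ltW jw)// exprMn.
  have h : (2 * u) ^+ 2 <= japanese v ^+ 2.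
    by rewrite ler_sqr ?nnegrE ?mulr_ge0 ?(ltW jv)// ltW.
  have := japanese_sqr_le v w; rewrite -/u; move: h; rewrite exprMn; lra.
have h : 1 <= 2 `^ (- gamma) * japanese v `^ gamma * japanese w `^ (- gamma).
  have e1 : japanese w `^ gamma * japanese w `^ (- gamma) = 1.
    by rewrite -powRD_gt0// subrr powRr0.
  by rewrite -[leLHS]e1 ler_wpM2r ?powR_ge0// powR_le_double.
apply: ler_wpDl; first exact: mulr_ge0 c0 x0.
rewrite [X in _ <= _ * X]mulrCA [leRHS]mulrA -[leLHS]mul1r.
exact: ler_wpM2r.
Qed.

End japanese_bracket.

(* [r] balances the two sides: [D * a * r `^ (2 * (s - nu)) = eps]. *)
Lemma optimal_scale {R : realType} (D a b S eps s nu : R) :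
  0 < D -> 0 <= a -> 0 <= b -> 0 <= S -> 0 < eps -> 0 < nu -> nu < s ->
  exists2 r : R, 0 < r &
    D * (a * (r `^ (- (2 * nu)) * b + r `^ (2 * (s - nu)) * S)) <=
    eps * S + D `^ (s / (s - nu)) * (eps `^ (- (nu / (s - nu))) * a `^ (s / (s - nu))) * b.
Proof.
move=> D0 a0 b0 S0 eps0 nu0 nus; have snu : 0 < s - nu by rewrite subr_gt0.
have [a00|an0] := eqVneq a 0.
  exists 1 => //; rewrite a00 mul0r mulr0 addr_ge0 ?mulr_ge0 ?powR_ge0//; exact: ltW.
have agt0 : 0 < a by rewrite lt_neqAle eq_sym an0.
have Da : 0 < D * a by rewrite mulr_gt0.
pose k := 2 * (s - nu); have k0 : k != 0 by rewrite gt_eqF// mulr_gt0.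
pose r := (eps / (D * a)) `^ k^-1.
exists r; first by apply: powR_gt0; exact: divr_gt0.
have rS : D * a * r `^ k = eps.
  rewrite /r -powRrM mulVf// powRr1 ?divr_ge0 ?(ltW eps0) ?(ltW Da)//.
  by rewrite mulrC divfK// gt_eqF.
have rb : D * a * r `^ (- (2 * nu)) =
    D `^ (s / (s - nu)) * (eps `^ (- (nu / (s - nu))) * a `^ (s / (s - nu))).
  have snuE : s / (s - nu) = 1 + nu / (s - nu) by field; rewrite gt_eqF.
  have -> : r `^ (- (2 * nu)) = eps `^ (- (nu / (s - nu))) * (D * a) `^ (nu / (s - nu)).
    rewrite /r -powRrM (_ : k^-1 * _ = - (nu / (s - nu))); last first.
      by rewrite /k; field; rewrite gt_eqF.
    rewrite powRM ?invr_ge0 ?(ltW eps0) ?(ltW Da)//; congr (_ * _).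
    by rewrite -powR_inv1 ?(ltW Da)// -powRrM mulrNN mul1r.
  have Da1 : D * a = (D * a) `^ 1 by rewrite powRr1 ?(ltW Da).
  rewrite {1}Da1 mulrCA -powRD_gt0// -snuE powRM ?(ltW D0)//; ring.
rewrite -/k (_ : D * (a * _) = D * a * r `^ k * S + D * a * r `^ (- (2 * nu)) * b); last by ring.
by rewrite rS rb.
Qed.

Theorem proposition2p7 (R : realType) (d : nat) (s gamma q : R)
    (hd : (2 <= d)%N) (hs0 : 0 < s) (hs1 : s <= 1)
    (hgamma : - d%:R < gamma)
    (hgs : - d%:R < gamma + 2 * s) (hgs0 : gamma + 2 * s <= 0)
    (hq1 : d%:R / (d%:R + 2 * s + gamma) < q)
    (hq2 : q < d%:R / (d%:R + gamma)) :
  let mu := lebesgue_Rd d in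
  let nu := (d%:R - q * (d%:R + gamma)) / (2 * q) in
  exists C0 : R, 0 < C0 /\
    forall (eps : R) (phi g : Rd R d -> R),
      0 < eps ->
      weighted (gamma / 2) phi \in Lfun mu 2%:E ->
      (sobolev_norm s (weighted (gamma / 2) phi) < +oo)%E ->
      (forall v, 0 <= g v) ->
      g \in Lfun mu 1%E ->
      weighted `|gamma| g \in Lfun mu q%:E ->
      (\int[mu]_v ((phi v ^+ 2)%:E * c_gamma gamma g v)
       <= eps%:E * sobolev_norm s (weighted (gamma / 2) phi) ^+ 2
          + C0%:E
            * ('N[mu]_1[EFin \o g]
               + (eps `^ (- (nu / (s - nu))))%:E
                 * 'N[mu]_q%:E[EFin \o weighted `|gamma| g]
                     `^ (s / (s - nu)))
            * \int[mu]_v (phi v ^+ 2 * japanese v `^ gamma)%:E)%E.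

Proof.
move=> mu nu.
have d0 : 0 < d%:R :> R by rewrite ltr0n (leq_trans _ hd).
have D20 : 0 < d%:R + gamma by lra.
have D10 : 0 < d%:R + 2 * s + gamma by lra.
have g0 : gamma < 0 by lra.
have q0 : 0 < q by rewrite (lt_trans _ hq1)// divr_gt0.
have qlo : d%:R < q * (d%:R + 2 * s + gamma) by rewrite -ltr_pdivrMr.
have qhi : q * (d%:R + gamma) < d%:R by rewrite -ltr_pdivlMr.
(* Since [gamma + 2 s <= 0], the lower bound on [q] is at least 1; Hoelder's inequality relies on
   this. *)
have q1 : 1 < q.
  apply: le_lt_trans hq1; rewrite ler_pdivlMr// mul1r; lra.
(* The upper bound on [q] gives [0 < nu], the lower one gives [nu < s]. *)
have nu0 : 0 < nu by rewrite divr_gt0 ?mulr_gt0// subr_gt0.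
have nus : nu < s by rewrite ltr_pdivrMr ?mulr_gt0//; lra.
(* The inverse of the exponent conjugate to [q]. The exponents [p] and [p + 2 s] of the scales
   become [- 2 nu] and [2 (s - nu)]. *)
pose e := 1 - q^-1.
have pE : gamma + d%:R * e = - (2 * nu) by rewrite /e /nu; field; rewrite gt_eqF.
have psE : gamma + d%:R * e + 2 * s = 2 * (s - nu) by rewrite pE; ring.
have p0 : gamma + d%:R * e < 0 by rewrite pE; lra.
have ps0 : 0 < gamma + d%:R * e + 2 * s by rewrite psE; lra.
have gd : 0 < gamma + d%:R by lra.
pose K := @power_form_cst R d gamma s e.
have K0 : 0 < K by exact: power_form_cst_gt0.
pose B := (2 : R) `^ (- gamma); have B0 : 0 < B by exact: powR_gt0.
have BK0 : 0 < B * K by exact: mulr_gt0.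
have C00 : 0 < B + (B * K) `^ (s / (s - nu)) by apply: addr_gt0 => //; exact: powR_gt0.
(* [B], from [power_split], is the coefficient of the [L^1] norm of [g]; the power is what
   [optimal_scale] gives for [D = B * K]. Both are fixed before [eps], [phi] and [g]. *)
exists (B + (B * K) `^ (s / (s - nu))); split=> // eps phi g eps0 psiL psiS g_ge0 gL GL.
set psi := weighted (gamma / 2) phi in psiL psiS *.
set G := weighted `|gamma| g in GL *.
have mpsi := Lfun_measurable psiL; have mg := Lfun_measurable gL.
have mG := Lfun_measurable GL; have mphi := measurable_weighted mpsi.
have absg : `|gamma| = - gamma by rewrite ltr0_norm.
have G0 w : 0 <= G w by apply: mulr_ge0 (powR_ge0 _ _) (g_ge0 w).
have psi2E v : psi v ^+ 2 = japanese v `^ gamma * phi v ^+ 2.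
  rewrite /psi /weighted exprMn; congr (_ * _).
  by rewrite -powR_mulrn ?powR_ge0// -powRrM divfK.
have [n1 n10 gn1] := Lfun_Lnorm_fin gL; have [a a0 Ga] := Lfun_Lnorm_fin GL.
have [b b0 psib] : exists2 b : R, 0 <= b & (\int[mu]_v (psi v ^+ 2)%:E = b%:E)%E.
  have I0 : (0 <= \int[mu]_v (psi v ^+ 2)%:E)%E.
    by apply: integral_ge0 => v _; rewrite lee_fin sqr_ge0.
  exists (fine (\int[mu]_v (psi v ^+ 2)%:E)%E); first exact: fine_ge0.
  by rewrite fineK//; exact: (integrable_fin_num measurableT (Lfun2_integrable_sqr psiL)).
have [S S0 SE] : exists2 S : R, 0 <= S & (sobolev_norm s psi = S%:E)%E.
  have I0 : (0 <= sobolev_norm s psi)%E.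
    by apply: le_ereal_inf_tmp => _ [h _ <-]; exact: poweR_ge0.
  exists (fine (sobolev_norm s psi)); first exact: fine_ge0.
  by rewrite fineK// ge0_fin_numE.
have S2E : (sobolev_norm s psi ^+ 2 = (S ^+ 2)%:E)%E by rewrite SE.
have S20 : 0 <= S ^+ 2 by exact: sqr_ge0.
have Gcube t v : 0 < t ->
    (\int[mu]_w (cube_indic t v w * G w)%:E <= (((2 * t) ^+ d) `^ e * a)%:E)%E.
  by move=> t0; exact: hoelder_cube.
have [r r0 rP] := optimal_scale BK0 a0 b0 S20 eps0 nu0 nus.
have := power_form_bound g0 gd hs0 hs1 p0 ps0 mG mpsi G0 a0 b0 S20 Gcube psib S2E r0.
rewrite -/K psE pE => form_le.
have g1 : (\int[mu]_w (g w)%:E = n1%:E)%E.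
  rewrite -gn1 Lnorm1; apply: eq_integral => w _ /=.
  by rewrite ger0_norm.
have -> : (\int[mu]_v (phi v ^+ 2 * japanese v `^ gamma)%:E = b%:E)%E.
  by rewrite -psib; apply: eq_integral => v _; rewrite psi2E mulrC.
rewrite gn1 Ga S2E poweR_EFin -!EFinM -!EFinD.
have psi0 v : 0 <= psi v ^+ 2 by exact: sqr_ge0.
pose U (v w : Rd R d) : R := normRd (subRd v w) `^ gamma.
have U0 v w : 0 <= U v w by exact: powR_ge0.
have mU : measurable_fun [set: Rd R d * Rd R d] (fun p => U p.1 p.2).
  exact: (measurableT_comp (measurable_powR _) (@measurable_distRd R d)).
(* [power_split] multiplied by [phi v ^+ 2]: the weight [japanese v] to the power [gamma] turns
   [phi^2] into [psi^2], and the inverse weight in [w] turns [g] into [G]. *)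
have split_form : (\int[mu]_v ((phi v ^+ 2)%:E * c_gamma gamma g v) <=
    \int[mu]_v \int[mu]_w (B * (psi v ^+ 2 * g w + U v w * (psi v ^+ 2 * G w)))%:E)%E.
  apply: ge0_le_integralT => v.
    rewrite mule_ge0 ?lee_fin ?sqr_ge0//.
    by apply: integral_ge0 => w _; rewrite lee_fin; exact: mulr_ge0 (U0 v w) (g_ge0 w).
  rewrite (_ : c_gamma gamma g v = \int[mu]_w (U v w * g w)%:E)%E//.
  rewrite -ge0_integralZl ?lee_fin ?sqr_ge0//; last 2 first.
  - by apply/measurable_EFinP; apply: measurable_funM mg; exact: (measurable_section v mU).
  - by move=> w _; rewrite lee_fin; exact: mulr_ge0 (U0 v w) (g_ge0 w).
  apply: ge0_le_integralT => w.
    rewrite -EFinM lee_fin; apply: mulr_ge0 (mulr_ge0 (U0 v w) (g_ge0 w)).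
    exact: sqr_ge0.
  rewrite -EFinM lee_fin psi2E /G /weighted absg.
  have := ler_wpM2l (sqr_ge0 (phi v)) (power_split v w g0 (g_ge0 w)).
  rewrite -/(U v w) -/B; move: (phi v ^+ 2) (japanese v `^ _) (japanese w `^ _) => x y z h.
  by apply: (le_trans h); rewrite le_eqVlt; apply/orP; left; apply/eqP; ring.
apply: (le_trans split_form).
have F1 v w : (0 <= (psi v ^+ 2 * g w)%:E)%E by rewrite lee_fin; exact: mulr_ge0.
have F2 v w : (0 <= (U v w * (psi v ^+ 2 * G w))%:E)%E.
  by rewrite lee_fin; apply: mulr_ge0 (U0 _ _) (mulr_ge0 (psi0 _) (G0 _)).
have F3 v w : (0 <= (psi v ^+ 2 * g w + U v w * (psi v ^+ 2 * G w))%:E)%E.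
  by rewrite EFinD adde_ge0.
have mF1 : measurable_fun [set: Rd R d * Rd R d] (fun p => (psi p.1 ^+ 2 * g p.2)%:E).
  by measurability.
have mF2 : measurable_fun [set: Rd R d * Rd R d]
    (fun p => (U p.1 p.2 * (psi p.1 ^+ 2 * G p.2))%:E).
  by measurability.
have mF3 : measurable_fun [set: Rd R d * Rd R d]
    (fun p => (psi p.1 ^+ 2 * g p.2 + U p.1 p.2 * (psi p.1 ^+ 2 * G p.2))).
  by measurability.
have -> : (\int[mu]_v \int[mu]_w (B * (psi v ^+ 2 * g w + U v w * (psi v ^+ 2 * G w)))%:E =
    B%:E * (\int[mu]_v \int[mu]_w (psi v ^+ 2 * g w)%:E +
      \int[mu]_v \int[mu]_w (U v w * (psi v ^+ 2 * G w))%:E))%E.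
  rewrite (double_integral mu mu mF1 F1) (double_integral mu mu mF2 F2).
  rewrite double_integral; last 2 first.
  - by apply/measurable_EFinP; apply: measurable_funM mF3; exact: measurable_cst.
  - by move=> v w; rewrite EFinM mule_ge0// lee_fin ltW.
  rewrite -(ge0_integralD _ _ _ mF1 _ mF2)//.
  exact: (ge0_integralZl_real _ mF3 (fun p => F3 p.1 p.2) (ltW B0)).
have -> : (\int[mu]_v \int[mu]_w (psi v ^+ 2 * g w)%:E = (b * n1)%:E)%E.
  rewrite EFinM -psib -ge0_integralZr ?lee_fin//; last 2 first.
  - by measurability.
  - by move=> v _; rewrite lee_fin.
  by apply: eq_integral => v _; rewrite ge0_integralZl_real// g1.
apply: (@le_trans _ _ (B%:E * ((b * n1)%:E +
  (K * a * (r `^ (- (2 * nu)) * b + r `^ (2 * (s - nu)) * S ^+ 2))%:E)))%E.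
  by apply: lee_wpmul2l; [rewrite lee_fin ltW|apply: leeD; [exact: lexx|exact: form_le]].
rewrite -EFinD -EFinM lee_fin.
have main : B * (b * n1) + B * K * (a * (r `^ (- (2 * nu)) * b + r `^ (2 * (s - nu)) * S ^+ 2)) <=
    B * (b * n1) + (eps * S ^+ 2 + (B * K) `^ (s / (s - nu)) *
      (eps `^ (- (nu / (s - nu))) * a `^ (s / (s - nu))) * b) by rewrite lerD2l.
rewrite [leLHS](_ : _ = B * (b * n1) +
  B * K * (a * (r `^ (- (2 * nu)) * b + r `^ (2 * (s - nu)) * S ^+ 2))); last by ring.
apply: (le_trans main).
have pD : 0 <= (B * K) `^ (s / (s - nu)) by exact: powR_ge0.
have ea0 : 0 <= eps `^ (- (nu / (s - nu))) * a `^ (s / (s - nu)).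
  by apply: mulr_ge0; exact: powR_ge0.
(* [r1] and [r2] are the cross terms that appear because one constant multiplies both norms of
   [g]. *)
have r1 : 0 <= (B * K) `^ (s / (s - nu)) * (n1 * b) by apply: mulr_ge0 pD (mulr_ge0 n10 b0).
have r2 : 0 <= B * ((eps `^ (- (nu / (s - nu))) * a `^ (s / (s - nu))) * b).
  by apply: mulr_ge0 (ltW B0) (mulr_ge0 ea0 b0).
move: (_ `^ _ * _ `^ _) r2 {main pD ea0} => Z r2; move: ((B * K) `^ _) r1 => Y r1; lra.
Qed.
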